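(* Let $A=\mathbf{F}_q[T]$ and let $\mathfrak{p}$ be a nonzero prime ideal of $A$ of degree $3$. The modular symbols $\eta_{\mathfrak n}\mathbf e/(q-1)$, where $\mathfrak n$ runs over the ideals of $A$ of degree $1$, form a basis of $\mathbf{M}^0_{\mathfrak p}$ over $\mathbf Z$. The winding homomorphism $t\mapsto t\mathbf e/(q-1)$ is an isomorphism of $\mathbf T$-modules $I_E\simeq\mathbf{M}^0_{\mathfrak p}$.
   Context: $K=\mathbf{F}_q(T)$, $\pi=1/T$, $K_\infty=\mathbf{F}_q((\pi))$, $O_\infty=\mathbf{F}_q[[\pi]]$. The degree of a nonzero ideal of $A$ is the degree of a generator; $\deg 0=-\infty$. $\Gamma=\Gamma_0(\mathfrak{p})\subset\mathrm{GL}_2(A)$ is the subgroup of matrices upper triangular modulo $\mathfrak{p}$. Modular symbols: $M$ is the group of degree-zero divisors supported on $\mathbf{P}^1(K)$ with $\Gamma$ acting by homographies. For a commutative ring $R$, $\mathbf{M}_{\mathfrak p}(R)=H_0(\Gamma,M\otimes_{\mathbf Z}R)$ (coinvariants) and $[r,s]$ is the class of $(s)-(r)$. The parabolic subspace $\mathbf{M}^0_{\mathfrak p}(R)$ is the kernel of the boundary map $[r,s]\mapsto(\Gamma s)-(\Gamma r)$ to degree-zero divisors on $\Gamma\backslash\mathbf{P}^1(K)$ with coefficients in $R$; write $\mathbf{M}^0_{\mathfrak p}=\mathbf{M}^0_{\mathfrak p}(\mathbf Z)$ and $\overline{\mathbf{M}^0_{\mathfrak p}}=\mathbf{M}^0_{\mathfrak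 p}/(\mathbf{M}^0_{\mathfrak p})_{\mathrm{tors}}\subset\mathbf{M}^0_{\mathfrak p}(\mathbf Q)$. When $\mathfrak p$ is prime of odd degree, $\mathbf{M}_{\mathfrak p}(\mathbf Z)$ is torsion-free (known), so $\overline{\mathbf{M}^0_{\mathfrak p}}=\mathbf{M}^0_{\mathfrak p}$. For a nonzero ideal $\mathfrak{m}$, the Hecke operator is $$T_{\mathfrak m}[r,s]=\sum_{a,b,d}\left[\begin{pmatrix}a&b\\0&d\end{pmatrix}r,\begin{pmatrix}a&b\\0&d\end{pmatrix}s\right],$$ sum over $a,b,d\in A$ with $(ad)=\mathfrak m$, $(a)+\mathfrak p=A$, $\deg b<\deg d$, $a$ and $d$ monic. $\mathbf T$ is the commutative $\mathbf Z$-subalgebra of $\mathrm{End}(\mathbf{M}^0_{\mathfrak p}(\mathbf C))$ generated by the $T_{\mathfrak m}$ with $\mathfrak m$ prime to $\mathfrak p$. For a nonzero prime $\mathfrak m\neq\mathfrak p$ of $A$, $\eta_{\mathfrak m}=T_{\mathfrak m}-(q^{\deg\mathfrak m}+1)\in\mathbf T$. The Eisenstein ideal $I_E$ is the ideal of $\mathbf T$ generated by all $\eta_{\mathfrak m}$, $\mathfrak m$ prime, $\mathfrak m\neq\mathfrak p$. Tree: $\mathcal T$ is the Bruhat--Tits tree of $\mathrm{PGL}_2(K_\infty)$, with vertex set $\mathrm{GL}_2(K_\infty)/\mathrm{GL}_2(O_\infty)Z(K_\infty)$ and oriented edge set $Y(\mathcal T)=\mathrm{GL}_2(K_\infty)/\mathcal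 I Z(K_\infty)$, where $\mathcal I\subset\mathrm{GL}_2(O_\infty)$ is the Iwahori subgroup of matrices upper triangular modulo $\pi$ and $Z$ is the centre; the canonical surjection gives the origin of an edge, and the opposite edge $\bar e$ of the class of $g$ is the class of $g\begin{pmatrix}0&1\\\pi&0\end{pmatrix}$. Ends of $\mathcal T$ are identified $\mathrm{GL}_2(K_\infty)$-equivariantly with $\mathbf{P}^1(K_\infty)$ so that $\infty$ (resp. $0$) is the end of the half-line of the classes of $\begin{pmatrix}\pi^k&0\\0&1\end{pmatrix}$, $k\le 0$ (resp. $k\geq 0$). Cochains: $\mathbf{H}_{\mathfrak p}(\mathbf Q)$ is the space of cuspidal harmonic cochains: functions $F:Y(\mathcal T)\to\mathbf Q$ with $F(\bar e)=-F(e)$, $\sum_{e\text{ with origin }x}F(e)=0$ for every vertex $x$, $F(\gamma e)=F(e)$ for $\gamma\in\Gamma$, and finite support modulo $\Gamma$. The pairing is $\langle[r,s],F\rangle=\sum_{e\in c}F(e)$, $c$ being the geodesic of $\mathcal T$ from $r$ to $s$; it is perfect on $\mathbf{M}^0_{\mathfrak p}(\mathbf Q)\times\mathbf{H}_{\mathfrak p}(\mathbf Q)$ (Teitelbaum). The winding element $\mathbf e\in\mathbf{M}^0_{\mathfrak p}(\mathbf Q)$ is the unique element with $\langle\mathbf e,F\rangle=\langle[0,\infty],F\rangle$ for all $F\in\mathbf{H}_{\mathfrak p}(\mathbf Q)$. One has $I_E\,\mathbf e\subset(q-1)\overline{\mathbf{M}^0_{\mathfrak p}}$; the winding homomorphism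 is the $\mathbf T$-module homomorphism $I_E\to\overline{\mathbf{M}^0_{\mathfrak p}}$, $t\mapsto t\mathbf e/(q-1)$. *)

(* Defs.v *)
From HB Require Import structures.
From mathcomp Require Import all_boot all_order all_algebra.
From mathcomp Require Import boolp classical_sets functions cardinality fsbigop reals.
From mathcomp Require Import complex freeg ring.
Set Implicit Arguments. Unset Strict Implicit. Unset Printing Implicit Defensive.
Import Order.TTheory GRing.Theory Num.Theory.
Local Open Scope ring_scope.

Record powser (F : Type) := PowSer { coefps : nat -> F }.
Arguments coefps {F}.

HB.instance Definition _ (F : Type) := gen_eqMixin (powser F).
HB.instance Definition _ (F : Type) := gen_choiceMixin (powser F).

Section PowerSeries.
Variable F : fieldType.
Implicit Types f g h : powser F.

Lemma powserP f g : coefps f =1 coefps g -> f = g.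
Proof. by case: f g => [f] [g] /= /funext ->. Qed.

Definition powser0 : powser F := PowSer (fun=> 0).
Definition powserC (a : F) : powser F := PowSer (fun i => if i is 0 then a else 0).
Definition powserX : powser F := PowSer (fun i => (i == 1%N)%:R).
Definition powser_opp f : powser F := PowSer (fun i => - coefps f i).
Definition powser_add f g : powser F :=
  PowSer (fun i => coefps f i + coefps g i).
Definition powser_mul f g : powser F :=
  PowSer (fun i => \sum_(j < i.+1) coefps f j * coefps g (i - j)%N).

Fact powser_addA : associative powser_add.
Proof. by move=> f g h; apply: powserP => i /=; rewrite addrA. Qed.
Fact powser_addC : commutative powser_add.
Proof. by move=> f g; apply: powserP => i /=; rewrite addrC. Qed.
Fact powser_add0 : left_id powser0 powser_add.
Proof. by move=> f; apply: powserP => i /=; rewrite add0r. Qed.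
Fact powser_addN : left_inverse powser0 powser_opp powser_add.
Proof. by move=> f; apply: powserP => i /=; rewrite addNr. Qed.

HB.instance Definition _ := GRing.isZmodule.Build (powser F)
  powser_addA powser_addC powser_add0 powser_addN.

(* Multiplication agrees with that of polynomials on truncations, from which *)
(* the ring axioms follow.                                                   *)
Let trunc n f : {poly F} := \poly_(i < n) coefps f i.

Let coef_mul n f g i : (i < n)%N ->
  coefps (powser_mul f g) i = (trunc n f * trunc n g)`_i.
Proof.
move=> lt_in; rewrite coefM /=; apply: eq_bigr => -[j lt_ji] _ /=.
by rewrite !coef_poly (leq_ltn_trans _ lt_in) // (leq_ltn_trans (leq_subr _ _)).
Qed.

Let eq_coefM n (P Q P' Q' : {poly F}) i : (i < n)%N ->
  (forall j, (j < n)%N -> P`_j = P'`_j) ->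
  (forall j, (j < n)%N -> Q`_j = Q'`_j) ->
  (P * Q)`_i = (P' * Q')`_i.
Proof.
move=> lt_in eqP eqQ; rewrite !coefM; apply: eq_bigr => -[j lt_ji] _ /=.
by rewrite eqP ?eqQ // ?(leq_ltn_trans _ lt_in) // leq_subr.
Qed.

Fact powser_mulA : associative powser_mul.
Proof.
move=> f g h; apply: powserP => i; rewrite !(@coef_mul i.+1) //.
have eq_trunc f' g' j : (j < i.+1)%N ->
  (trunc i.+1 (powser_mul f' g'))`_j = (trunc i.+1 f' * trunc i.+1 g')`_j.
  by move=> lt_ji; rewrite coef_poly lt_ji (@coef_mul i.+1).
rewrite (eq_coefM _ (fun j _ => erefl) (eq_trunc g h)) // mulrA.
by apply/esym/(eq_coefM _ (eq_trunc f g)).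
Qed.
Fact powser_mulC : commutative powser_mul.
Proof.
by move=> f g; apply: powserP => i; rewrite !(@coef_mul i.+1) // mulrC.
Qed.
Fact powser_mul1 : left_id (powserC 1) powser_mul.
Proof.
move=> f; apply: powserP => i /=.
by rewrite big_ord_recl /= mul1r subn0 big1 ?addr0 // => j _; rewrite mul0r.
Qed.
Fact powser_mulDl : left_distributive powser_mul +%R.
Proof.
move=> f g h; apply: powserP => i /=; rewrite -big_split /=.
by apply: eq_bigr => j _; rewrite mulrDl.
Qed.
Fact powser1_neq0 : powserC 1 != 0.
Proof. by apply/eqP => /(congr1 (coefps^~ 0%N)) /eqP /=; rewrite oner_eq0. Qed.

HB.instance Definition _ := GRing.Zmodule_isComNzRing.Build (powser F)
  powser_mulA powser_mulC powser_mul1 powser_mulDl powser1_neq0.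

Definition powser_unit : pred (powser F) := fun f => `[< exists g, g * f = 1 >].
Definition powser_inv f : powser F :=
  if powser_unit f then xget 0 [set g | g * f = 1]%classic else f.

Fact powser_mulV : {in powser_unit, left_inverse 1 powser_inv *%R}.
Proof.
move=> f uf; rewrite /powser_inv (uf : powser_unit f = true).
by move: uf => /asboolP uf; apply: (@xgetPex _ 0 [set g | g * f = 1]%classic).
Qed.
Fact powser_unitP f g : g * f = 1 -> powser_unit f.
Proof. by move=> gf; apply/asboolP; exists g. Qed.
Fact powser_inv_out : {in [predC powser_unit], powser_inv =1 id}.
Proof. by move=> f nu; rewrite /powser_inv; case: ifP nu => // uf /negP []. Qed.

HB.instance Definition _ := GRing.ComNzRing_hasMulInverse.Build (powser F)
  powser_mulV powser_unitP powser_inv_out.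

Fact powser_idomain f g : f * g = 0 -> (f == 0) || (g == 0).
Proof.
move=> fg0; apply/norP => -[f0 g0].
have neq0 h : h != 0 -> exists i, coefps h i != 0.
  move=> h0; apply: contrapT => /forallNP all0; case/negP: h0; apply/eqP.
  by apply: powserP => i; have /negP := all0 i; rewrite negbK => /eqP.
case: (ex_minnP (neq0 _ f0)) => m fm0 minm.
case: (ex_minnP (neq0 _ g0)) => n gn0 minn.
have /eqP : coefps (f * g) (m + n)%N = 0 by rewrite fg0.
have lt_m : (m < (m + n).+1)%N by rewrite ltnS leq_addr.
rewrite /= (bigD1 (Ordinal lt_m)) //= addKn big1 ?addr0; last first.
  move=> j; rewrite -val_eqE /= neq_ltn => /orP[ltj | ltj].
    case: (eqVneq (coefps f j) 0) => [->|/minm]; first by rewrite mul0r.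
    by rewrite leqNgt ltj.
  case: (eqVneq (coefps g (m + n - j)) 0) => [->|/minn]; first by rewrite mulr0.
  rewrite leq_subRL; last by rewrite -ltnS.
  by rewrite leq_add2r leqNgt ltj.
by rewrite mulf_eq0 (negPf fm0) (negPf gn0).
Qed.

HB.instance Definition _ := GRing.ComUnitRing_isIntegral.Build (powser F)
  powser_idomain.
End PowerSeries.

Section LinearAlgebra.
Variable R : nzRingType.

Section Kernel.
Variables (V W : lmodType R) (f : {linear V -> W}).

Definition in_kernel : {pred V} := fun x => f x == 0.

Fact in_kernel_closed : GRing.submod_closed in_kernel.
Proof.
split=> [|a x y]; rewrite !unfold_in ?linear0 //.
by rewrite linearP => /eqP-> /eqP->; rewrite scaler0 addr0.
Qed.

HB.instance Definition _ := GRing.isSubmodClosed.Build R V in_kernel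
  (GRing.submod_closed_semi in_kernel_closed).

Record kernel := Kernel { kernel_val :> V; _ : in_kernel kernel_val }.

HB.instance Definition _ := [isSub for kernel_val].
HB.instance Definition _ := [Choice of kernel by <:].
HB.instance Definition _ := [SubChoice_isSubLmodule of kernel by <:].
End Kernel.

Section QuotientModule.
Variables (V : lmodType R) (S : set V).

Inductive lspan : V -> Prop :=
| lspan0 : lspan 0
| lspanP a x y : S x -> lspan y -> lspan (a *: x + y).

Definition in_lspan : {pred V} := fun x => `[< lspan x >].

Lemma lspanD x y : lspan x -> lspan y -> lspan (x + y).
Proof.
move=> sx sy; elim: sx => [|a z t Sz _ IH]; first by rewrite add0r.
by rewrite -addrA; apply: lspanP.
Qed.

Lemma lspanZ a x : lspan x -> lspan (a *: x).
Proof.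
elim=> [|b z t Sz _ IH]; first by rewrite scaler0; apply: lspan0.
by rewrite scalerDr scalerA; apply: lspanP.
Qed.

Fact in_lspan_closed : GRing.submod_closed in_lspan.
Proof.
split=> [|a x y]; rewrite !unfold_in; first exact/asboolP/lspan0.
by move=> /asboolP sx /asboolP sy; apply/asboolP/lspanD => //; apply: lspanZ.
Qed.

HB.instance Definition _ := GRing.isSubmodClosed.Build R V in_lspan
  (GRing.submod_closed_semi in_lspan_closed).

Definition lquot := Quotient.quot in_lspan.
HB.instance Definition _ := GRing.Zmodule.on lquot.

Definition lquot_pi (x : V) : lquot := \pi_(Quotient.quot in_lspan)%qT x.
Definition lquot_repr (x : lquot) : V := repr (x : Quotient.quot in_lspan).

Lemma lquot_reprK : cancel lquot_repr lquot_pi.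
Proof. exact: reprK. Qed.

Lemma lquot_piP x y : lquot_pi x = lquot_pi y <-> lspan (x - y).
Proof.
rewrite /lquot_pi; split=> [/eqP|sxy].
  by rewrite -Quotient.idealrBE => /asboolP.
by apply/eqP; rewrite -Quotient.idealrBE; apply/asboolP.
Qed.

Fact lquot_pi_is_additive : zmod_morphism lquot_pi.
Proof. exact: (raddfB \pi_(Quotient.quot in_lspan)%qT). Qed.

HB.instance Definition _ :=
  GRing.isZmodMorphism.Build V lquot lquot_pi lquot_pi_is_additive.

Definition lquot_scale a x := lquot_pi (a *: lquot_repr x).

Lemma lquot_scale_pi a x : lquot_scale a (lquot_pi x) = lquot_pi (a *: x).
Proof.
apply/lquot_piP; rewrite -scalerBr; apply: lspanZ.
by apply/lquot_piP; rewrite lquot_reprK.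
Qed.

Fact lquot_scaleA a b x : lquot_scale a (lquot_scale b x) = lquot_scale (a * b) x.
Proof. by rewrite -[x]lquot_reprK !lquot_scale_pi scalerA. Qed.
Fact lquot_scale1 : left_id 1 lquot_scale.
Proof. by move=> x; rewrite -[x]lquot_reprK lquot_scale_pi scale1r. Qed.
Fact lquot_scaleDr : right_distributive lquot_scale +%R.
Proof.
move=> a x y; rewrite -[x]lquot_reprK -[y]lquot_reprK -raddfD !lquot_scale_pi.
by rewrite scalerDr raddfD.
Qed.
Fact lquot_scaleDl x : {morph lquot_scale^~ x : a b / a + b}.
Proof.
by move=> a b; rewrite -[x]lquot_reprK !lquot_scale_pi scalerDl raddfD.
Qed.

HB.instance Definition _ := GRing.Zmodule_isLmodule.Build R lquot
  lquot_scaleA lquot_scale1 lquot_scaleDr lquot_scaleDl.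

Fact lquot_pi_is_scalable : scalable lquot_pi.
Proof. by move=> a x; rewrite -lquot_scale_pi. Qed.

HB.instance Definition _ :=
  GRing.isScalable.Build R V lquot *:%R lquot_pi lquot_pi_is_scalable.

Section Lift.
Variables (W : lmodType R) (f : {linear V -> W}).
Hypothesis f0 : forall x, S x -> f x = 0.

Definition lquot_lift (x : lquot) : W := f (lquot_repr x).

Lemma lquot_lift_pi x : lquot_lift (lquot_pi x) = f x.
Proof.
apply/eqP; rewrite -subr_eq0 -linearB; apply/eqP.
have : lspan (lquot_repr (lquot_pi x) - x).
  by apply/lquot_piP; rewrite lquot_reprK.
by elim=> [|a y z /f0 fy _ fz]; rewrite ?linear0 // linearP fy fz scaler0 addr0.
Qed.

Fact lquot_lift_is_linear : linear lquot_lift.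
Proof.
move=> a x y; rewrite -[x]lquot_reprK -[y]lquot_reprK -linearP.
by rewrite !lquot_lift_pi linearP.
Qed.
End Lift.
End QuotientModule.
End LinearAlgebra.

HB.instance Definition _ (R : nzRingType) (X : choiceType) (M : lmodType R)
    (f : X -> M) :=
  GRing.isZmodMorphism.Build {freeg X / R} M (fglift f) (lift_is_additive f).

Lemma freeg_ind (R : nzRingType) (X : choiceType) (P : {freeg X / R} -> Prop) :
  P 0 -> (forall a x D, P D -> P (<< a *g x >> + D)) -> forall D, P D.
Proof.
move=> P0 PD D; rewrite -[D]freeg_sumE; elim: (dom D) => [|x s IH].
  by rewrite big_nil.
by rewrite big_cons; apply: PD.
Qed.

Lemma freegZ (R : nzRingType) (X : choiceType) (a b : R) (x : X) :
  a *: << b *g x >> = << a * b *g x >>.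
Proof. by apply/eqP/freeg_eqP => y; rewrite coeffZ !coeffU mulrA. Qed.

Fact fglift_is_scalable (R : nzRingType) (X : choiceType) (M : lmodType R)
  (f : X -> M) : scalable (fglift f : {freeg X / R} -> M).
Proof.
move=> a; elim/freeg_ind => [|b x D IH]; first by rewrite scaler0 raddf0 scaler0.
by rewrite scalerDr freegZ !raddfD /= IH !liftU scalerA.
Qed.

HB.instance Definition _ (R : nzRingType) (X : choiceType) (M : lmodType R)
    (f : X -> M) :=
  GRing.isScalable.Build R {freeg X / R} M *:%R (fglift f)
    (fglift_is_scalable f).

Section Divisors.
Variable R : nzRingType.
Implicit Types X Y Z : choiceType.

Definition degree X : {freeg X / R} -> R^o := fglift (fun=> 1).
HB.instance Definition _ X := GRing.Linear.on (@degree X).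

(* Degree-zero divisors with coefficients in R. As the degree-zero divisors *)
(* with integral coefficients are a direct summand of a free group, this is   *)
(* M (x) R when X is the projective line over K.                              *)
Definition div0 X := kernel (@degree X).
HB.instance Definition _ X := GRing.Lmodule.on (div0 X).

Definition pushforward X Y (phi : X -> Y) : {freeg X / R} -> {freeg Y / R} :=
  fglift (fun x => << phi x >>).
HB.instance Definition _ X Y (phi : X -> Y) := GRing.Linear.on (pushforward phi).

Lemma linear_freegP X (M : lmodType R) (f g : {linear {freeg X / R} -> M}) :
  (forall x, f << x >> = g << x >>) -> f =1 g.
Proof.
move=> fg; elim/freeg_ind => [|a x D IH]; first by rewrite !linear0.
by rewrite !linearD IH -[a]mulr1 -freegZ !linearZ /= fg.
Qed.

Lemma pushforwardU X Y (phi : X -> Y) a x :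
  pushforward phi << a *g x >> = << a *g phi x >>.
Proof. by rewrite /pushforward liftU freegZ mulr1. Qed.

Lemma pushforward_comp X Y Z (phi : X -> Y) (psi : Y -> Z) D :
  pushforward (psi \o phi) D = pushforward psi (pushforward phi D).
Proof.
apply: (linear_freegP (g := pushforward psi \o pushforward phi)) => x /=.
by rewrite !pushforwardU.
Qed.

Lemma degreeU X a (x : X) : degree << a *g x >> = a.
Proof. by rewrite /degree liftU [_ *: _]mulr1. Qed.

Lemma degree_pushforward X Y (phi : X -> Y) D :
  degree (pushforward phi D) = degree D.
Proof.
apply: (linear_freegP (f := @degree Y \o pushforward phi)) => x /=.
by rewrite pushforwardU !degreeU.
Qed.

Fact pushforward0_subproof X Y (phi : X -> Y) (D : div0 X) :
  in_kernel (@degree Y) (pushforward phi (kernel_val D)).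
Proof. by case: D => D D0; rewrite /in_kernel /= degree_pushforward. Qed.

Definition pushforward0 X Y (phi : X -> Y) (D : div0 X) : div0 Y :=
  Kernel (pushforward0_subproof phi D).

Fact pushforward0_is_linear X Y (phi : X -> Y) : linear (pushforward0 phi).
Proof. by move=> a D E; apply: val_inj; rewrite /= linearP. Qed.
HB.instance Definition _ X Y (phi : X -> Y) :=
  GRing.isLinear.Build R (div0 X) (div0 Y) *:%R (pushforward0 phi)
    (pushforward0_is_linear phi).

Fact segment_subproof X (r s : X) : in_kernel (@degree X) (<< s >> - << r >>).
Proof. by rewrite /in_kernel linearB /= !degreeU subrr. Qed.

(* The divisor (s) - (r). *)
Definition segment X (r s : X) : div0 X := Kernel (segment_subproof r s).
End Divisors.

Section BaseChange.
Variables (R S : nzRingType) (f : {rmorphism R -> S}).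
Implicit Types X Y : choiceType.

Definition base_change X (D : {freeg X / R}) : {freeg X / S} :=
  \sum_(x <- dom D) << f (coeff x D) *g x >>.

Lemma coeff_base_change X (D : {freeg X / R}) x :
  coeff x (base_change D) = f (coeff x D).
Proof.
rewrite -[in RHS](freeg_sumE D) !raddf_sum; apply: eq_bigr => z _ /=.
by rewrite !coeffU rmorphM rmorph_nat.
Qed.

Fact base_change_is_additive X : zmod_morphism (@base_change X).
Proof.
move=> D E; apply/eqP/freeg_eqP => x.
by rewrite !(coeffB, coeff_base_change) rmorphB.
Qed.
HB.instance Definition _ X := GRing.isZmodMorphism.Build
  {freeg X / R} {freeg X / S} (@base_change X) (@base_change_is_additive X).

Lemma base_changeU X a (x : X) : base_change << a *g x >> = << f a *g x >>.
Proof.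
apply/eqP/freeg_eqP => y.
by rewrite coeff_base_change !coeffU rmorphM rmorph_nat.
Qed.

Lemma degree_base_change X (D : {freeg X / R}) :
  degree (base_change D) = f (degree D).
Proof.
elim/freeg_ind: D => [|a x D IH]; first by rewrite raddf0 !linear0 rmorph0.
by rewrite raddfD /= base_changeU !linearD /= !degreeU IH rmorphD.
Qed.

Lemma pushforward_base_change X Y (phi : X -> Y) (D : {freeg X / R}) :
  pushforward phi (base_change D) = base_change (pushforward phi D).
Proof.
elim/freeg_ind: D => [|a x D IH]; first by rewrite !raddf0.
by rewrite !raddfD /= IH base_changeU !pushforwardU base_changeU.
Qed.

Fact base_change0_subproof X (D : div0 R X) :
  in_kernel (@degree S X) (base_change (kernel_val D)).
Proof.
by case: D => D /= /eqP D0; rewrite /in_kernel /= degree_base_change D0 rmorph0.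
Qed.

Definition base_change0 X (D : div0 R X) : div0 S X :=
  Kernel (base_change0_subproof D).
End BaseChange.

Section ProjectiveLine.
Variable L : fieldType.

(* [None] is the point at infinity. *)
Definition P1 := option L.
HB.instance Definition _ := Choice.on P1.

Definition mx2 (R : nzRingType) (a b c d : R) : 'M[R]_2 :=
  \matrix_(i, j) if i == 0 then if j == 0 then a else b
                 else if j == 0 then c else d.

Definition homography (g : 'M[L]_2) (x : P1) : P1 :=
  match x with
  | Some z => if g 1 0 * z + g 1 1 == 0 then None
              else Some ((g 0 0 * z + g 0 1) / (g 1 0 * z + g 1 1))
  | None => if g 1 0 == 0 then None else Some (g 0 0 / g 1 0)
  end.
End ProjectiveLine.

Section Homography.
Variable L : fieldType.
Implicit Types (g h : 'M[L]_2) (x : P1 L).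

Let toP1 (u v : L) : P1 L := if v == 0 then None else Some (u / v).

Let homographyE g x (u v k : L) : k != 0 -> (u != 0) || (v != 0) ->
    x = toP1 (k * u) (k * v) ->
  homography g x = toP1 (g 0 0 * u + g 0 1 * v) (g 1 0 * u + g 1 1 * v).
Proof.
move=> k0 uv ->; rewrite /toP1 /= mulf_eq0 (negPf k0) /=.
have [v0|v0] /= := eqVneq v 0.
  rewrite v0 eqxx orbF in uv; rewrite v0 !(mulr0, addr0) mulf_eq0 (negPf uv) orbF.
  by case: eqVneq => // g0; rewrite -mulf_div divff // mulr1.
rewrite -mulf_div divff // mul1r.
have E c d : c * (u / v) + d = (c * u + d * v) / v.
  by rewrite mulrDl mulfK // mulrA.
rewrite !E mulf_eq0 invr_eq0 (negPf v0) orbF.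
by case: eqVneq => // w0; rewrite invfM invrK mulrACA mulVf // mulr1.
Qed.

Let toP1_surj x : exists u v, ((u != 0) || (v != 0)) /\ x = toP1 u v.
Proof.
case: x => [z|]; last by exists 1, 0; rewrite oner_neq0 /toP1 eqxx.
by exists z, 1; rewrite oner_neq0 orbT /toP1 oner_eq0 divr1.
Qed.

Lemma mulmx2E (R : nzRingType) (A B : 'M[R]_2) i j :
  (A *m B) i j = A i 0 * B 0 j + A i 1 * B 1 j.
Proof. by rewrite mxE big_ord_recl big_ord1; congr (_ * _ + A i _ * B _ _);
  apply: val_inj. Qed.

Lemma det_mx2 (R : comNzRingType) (A : 'M[R]_2) :
  \det A = A 0 0 * A 1 1 - A 0 1 * A 1 0.
Proof.
by rewrite (expand_det_row _ 0) big_ord_recl big_ord1 /cofactor !det_mx11 !mxE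
  /= expr0 mul1r expr1 mulN1r mulrN; congr (_ * A _ _ - A _ _ * A _ _);
  apply: val_inj.
Qed.

Lemma homographyM g h x : \det h != 0 ->
  homography (g *m h) x = homography g (homography h x).
Proof.
move=> h0; have [u [v [uv ->]]] := toP1_surj x.
have k1 : (1 : L) != 0 by exact: oner_neq0.
rewrite (homographyE (g *m h) k1 uv) ?mul1r //.
rewrite (homographyE h k1 uv) ?mul1r //.
rewrite (homographyE g (u := h 0 0 * u + h 0 1 * v)
  (v := h 1 0 * u + h 1 1 * v) k1) ?mul1r //.
  by rewrite !mulmx2E; congr toP1; rewrite !mulrDl !mulrDr !mulrA addrACA.
apply: contraTT uv; rewrite !negb_or !negbK => /andP[/eqP e1 /eqP e2].
suff H w : \det h * w = 0 -> w = 0.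
  apply/andP; split; apply/eqP/H; rewrite det_mx2.
    transitivity (h 1 1 * (h 0 0 * u + h 0 1 * v)
                  - h 0 1 * (h 1 0 * u + h 1 1 * v)).
      by rewrite mulrBl !mulrDr opprD !mulrA addrACA [h 1 1 * h 0 1]mulrC subrr
        addr0 [h 1 1 * _]mulrC.
    by rewrite e1 e2 !mulr0 subrr.
  transitivity (h 0 0 * (h 1 0 * u + h 1 1 * v)
                - h 1 0 * (h 0 0 * u + h 0 1 * v)).
    by rewrite mulrBl !mulrDr opprD !mulrA addrACA [h 1 0 * h 0 0]mulrC subrr
      add0r [h 1 0 * _]mulrC.
  by rewrite e1 e2 !mulr0 subrr.
by move/eqP; rewrite mulf_eq0 (negPf h0) => /eqP.
Qed.

Lemma homography1 x : homography 1%:M x = x.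
Proof.
case: x => [z|] /=; rewrite !mxE /= ?eqxx //.
by rewrite mul0r add0r oner_eq0 mul1r addr0 divr1.
Qed.
End Homography.

(* Locked: unification would otherwise unfold the arithmetic of fractions. *)
HB.lock Definition actA (F : finFieldType) (g : 'M[{poly F}]_2)
    (x : P1 {fraction {poly F}}) : P1 {fraction {poly F}} :=
  homography (map_mx (@tofrac {poly F}) g) x.

Section CongruenceSubgroup.
Variables (F : finFieldType) (p : {poly F}).

Let A := {poly F}.
Let K := {fraction {poly F}}.
Local Notation P1K := (P1 K).

Definition Gamma0 (g : 'M[A]_2) : bool := (g \in unitmx) && (p %| g 1 0).

Lemma Gamma0_1 : Gamma0 1%:M.
Proof. by rewrite /Gamma0 unitmx1 mxE dvdp0. Qed.

Lemma Gamma0M g h : Gamma0 g -> Gamma0 h -> Gamma0 (g *m h).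
Proof.
move=> /andP[ug pg] /andP[uh ph]; rewrite /Gamma0 unitmx_mul ug uh /=.
by rewrite mulmx2E dvdp_add // ?(dvdp_mulr _ pg) // dvdp_mull.
Qed.

Lemma Gamma0V g : Gamma0 g -> Gamma0 (invmx g).
Proof.
move=> /andP[ug pg]; rewrite /Gamma0 unitmx_inv ug /=.
have inv10 : (invmx g) 1 0 = - ((\det g)^-1 * g 1 0).
  rewrite /invmx ug !mxE /cofactor !det_mx11 !mxE /= expr1 mulN1r mulrN.
  by congr (- (_ * g _ _)); apply: val_inj.
by rewrite inv10 dvdpNr dvdp_mull.
Qed.

Lemma actAM (g h : 'M[A]_2) x : \det h != 0 -> actA (g *m h) x = actA g (actA h x).
Proof.
move=> h0; rewrite !actA.unlock map_mxM homographyM //.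
by rewrite det_map_mx tofrac_eq0.
Qed.

Lemma Gamma0_det g : Gamma0 g -> \det g != 0.
Proof.
move=> /andP[ug _]; apply: contraTneq ug => d0.
by rewrite unitmxE d0 unitr0.
Qed.

Lemma actA1 (x : P1K) : actA 1%:M x = x.
Proof. by rewrite !actA.unlock map_mx1 homography1. Qed.

(* A point of Gamma \ P^1(K) is represented by the orbit itself, as a set. *)
Definition cusp (x : P1K) : set P1K :=
  [set actA g x | g in [set g | Gamma0 g]]%classic.

Lemma cusp_act g x : Gamma0 g -> cusp (actA g x) = cusp x.
Proof.
move=> Gg; apply/seteqP; split=> y /= [h Gh <-].
  by exists (h *m g); [exact: Gamma0M | rewrite actAM // Gamma0_det].
exists (h *m invmx g); first by apply/Gamma0M/Gamma0V.
rewrite -actAM; last exact: Gamma0_det.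
by rewrite -mulmxA mulVmx ?mulmx1 //; case/andP: Gg.
Qed.
End CongruenceSubgroup.

Section HeckeCosets.
Variables (F : finFieldType) (p : {poly F}).
Let A := {poly F}.

Lemma mx2_eqP (R : nzRingType) (M N : 'M[R]_2) :
  M 0 0 = N 0 0 -> M 0 1 = N 0 1 -> M 1 0 = N 1 0 -> M 1 1 = N 1 1 -> M = N.
Proof.
move=> e00 e01 e10 e11; apply/matrixP.
have ord2 (i : 'I_2) : i = 0 \/ i = 1.
  by case: i => [[|[]]] // ?; [left | right]; apply: val_inj.
by move=> i j; case: (ord2 i) => ->; case: (ord2 j) => ->.
Qed.

Lemma hermite (N : 'M[A]_2) :
    coprimep (N 0 0) p -> p %| N 1 0 -> \det N != 0 ->
  exists u a b d, [/\ Gamma0 p u, N = u *m mx2 a b 0 d &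
    [/\ a * d %= \det N, coprimep a p, (size b < size d)%N,
        a \is monic & d \is monic]].
Proof.
move=> cNp pN detN.
have g0N0 : gcdp (N 0 0) (N 1 0) != 0.
  apply: contra detN; rewrite gcdp_eq0 => /andP[/eqP N00 /eqP N10].
  by rewrite det_mx2 N00 N10 mul0r mulr0 subrr.
set g0 := gcdp _ _ in g0N0.
have lg0 : lead_coef g0 != 0 by rewrite lead_coef_eq0.
pose g : A := (lead_coef g0)^-1 *: g0.
have gmon : g \is monic by rewrite monicE lead_coefZ mulVf.
have gN0 : g != 0 by exact: monic_neq0.
have gg0 : g %= g0 by rewrite eqp_scale ?invr_eq0.
have gN00 : g %| N 0 0 by rewrite (eqp_dvdl _ gg0) dvdp_gcdl.
have /dvdpP[x xg] := gN00.
have /dvdpP[y yg] : g %| N 1 0 by rewrite (eqp_dvdl _ gg0) dvdp_gcdr.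
have [[u0 v0] /= uv0] := Bezoutp (N 0 0) (N 1 0).
have {uv0} uvg : u0 * N 0 0 + v0 * N 1 0 %= g.
  by rewrite eqp_sym (eqp_trans gg0) // eqp_sym.
set P := _ + _ in uvg.
have P0 : lead_coef P != 0.
  by rewrite lead_coef_eq0; apply: contraNneq gN0 => P0; rewrite -eqp0 -P0 eqp_sym.
pose w := (lead_coef P)^-1 *: u0; pose v := (lead_coef P)^-1 *: v0.
have wv1 : w * x + v * y = 1.
  apply: (mulIf gN0); rewrite mul1r /w /v.
  transitivity ((lead_coef P)^-1 *: P).
    by rewrite /P xg yg scalerDr -!scalerAl mulrDl -!scalerAl !mulrA.
  have {2}-> : P = lead_coef P *: g.
    by rewrite {1}(eqpfP uvg) (monicP gmon) divr1.
  by rewrite scalerA mulVf // scale1r.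
pose B := w * N 0 1 + v * N 1 1; pose D := x * N 1 1 - y * N 0 1.
have detE : \det N = g * D by rewrite det_mx2 xg yg /D; ring.
have D0 : D != 0 by apply: contraNneq detN => D0; rewrite detE D0 mulr0.
have lD : lead_coef D != 0 by rewrite lead_coef_eq0.
pose d := (lead_coef D)^-1 *: D.
have Dd : (lead_coef D)%:P * d = D.
  by rewrite mul_polyC scalerA mulfV // scale1r.
have dmon : d \is monic by rewrite monicE lead_coefZ mulVf.
have dN0 : d != 0 by exact: monic_neq0.
have BE : B = B %/ d * d + B %% d by exact: divp_eq.
set k := B %/ d in BE; set b := B %% d in BE.
have cgp : coprimep g p by rewrite coprimep_sym (coprimep_dvdl gN00) // coprimep_sym.
have py : p %| y by move: pN; rewrite yg Gauss_dvdpl // coprimep_sym.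
exists (mx2 x (- v) y w *m mx2 1 k 0 (lead_coef D)%:P), g, b, d.
split.
- apply: Gamma0M; rewrite /Gamma0 unitmxE det_mx2 !mxE /=.
    by rewrite py andbT mulNr opprK [x * w]mulrC wv1 unitr1.
  by rewrite mul1r mulr0 subr0 dvdp0 andbT poly_unitE size_polyC lD coefC eqxx unitfE.
- apply: mx2_eqP; rewrite !mulmx2E !mxE /=.
  + by rewrite xg; ring.
  + transitivity (x * (k * d + b) - v * ((lead_coef D)%:P * d)); last by ring.
    by rewrite -BE Dd /B /D -[LHS]mul1r -wv1; ring.
  + by rewrite yg; ring.
  + transitivity (y * (k * d + b) + w * ((lead_coef D)%:P * d)); last by ring.
    by rewrite -BE Dd /B /D -[LHS]mul1r -wv1; ring.
split=> //; last by rewrite ltn_modpN0.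
by rewrite detE eqp_mull // eqp_scale ?invr_eq0.
Qed.

Lemma hermite_inj u (a b d a' b' d' : A) : Gamma0 p u ->
    mx2 a b 0 d = u *m mx2 a' b' 0 d' -> a \is monic -> a' \is monic ->
    d \is monic -> d' \is monic ->
    (size b < size d)%N -> (size b' < size d')%N ->
  [/\ a = a', b = b' & d = d'].
Proof.
move=> Gu E ma ma' md md' bd bd'.
have e i j : mx2 a b 0 d i j = u i 0 * mx2 a' b' 0 d' 0 j + u i 1 * mx2 a' b' 0 d' 1 j.
  by rewrite E mulmx2E.
have := e 0 0; have := e 0 1; have := e 1 0; have := e 1 1.
rewrite !mxE /= !mulr0 !addr0 => e11 e10 e01 e00.
have u10 : u 1 0 = 0.
  by apply/eqP; move/esym/eqP: e10; rewrite mulf_eq0 (negPf (monic_neq0 ma')) orbF.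
move: e11; rewrite u10 mul0r add0r => e11.
have ud : u 0 0 * u 1 1 \is a GRing.unit.
  have : \det u \is a GRing.unit by rewrite -unitmxE; case/andP: Gu.
  by rewrite det_mx2 u10 mulr0 subr0.
have unitP (c f f' : A) : c \is a GRing.unit -> f \is monic -> f' \is monic ->
    f = c * f' -> c = 1.
  move=> uc mf mf' ff'; apply: (mulIf (monic_neq0 mf')); rewrite -ff' mul1r.
  apply/eqP; rewrite -(eqp_monic mf mf') ff' -[X in _ %= X]mul1r eqp_mulr //.
  by rewrite -size_poly_eq1 -[size c == 1%N]andbT; move: uc; rewrite poly_unitE => /andP[->].
move: ud; rewrite unitrM => /andP[u0 u1].
have u00 := unitP _ _ _ u0 ma ma' e00; have u11 := unitP _ _ _ u1 md md' e11.
rewrite u00 mul1r in e00; rewrite u11 mul1r in e11.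
rewrite u00 mul1r in e01; split=> //.
have : d' %| b - b' by rewrite e01 addrC addKr dvdp_mull.
have [/eqP|b0 /(dvdp_leq b0)] := eqVneq (b - b') 0.
  by rewrite subr_eq0 => /eqP.
rewrite leqNgt => /negP[]; apply: leq_ltn_trans (size_polyD _ _) _.
by rewrite size_polyN gtn_max bd' -e11 bd.
Qed.
End HeckeCosets.

Section ModularSymbols.
Variables (F : finFieldType) (p : {poly F}).
Local Notation A := {poly F}.
Local Notation P1K := (P1 {fraction {poly F}}).

(* Triples (a, b, d). Since a * d generates (m) and deg b < deg d, bounding   *)
(* the sizes by that of m excludes nothing and makes the type finite.         *)
Definition hecke_index (m : A) : Type :=
  ({poly_(size m) F} * {poly_(size m) F} * {poly_(size m) F})%type.
HB.instance Definition _ (m : A) := Finite.on (hecke_index m).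

Definition hecke_cond (m : A) (t : hecke_index m) : bool :=
  let: (a, b, d) := t in
  [&& (a : A) * (d : A) %= m, coprimep a p, (size b < size d)%N,
      (a : A) \is monic & (d : A) \is monic].

Definition hecke_mx (m : A) (t : hecke_index m) : 'M[A]_2 :=
  let: (a, b, d) := t in mx2 (a : A) b 0 d.

Definition hecke_set (m : A) : {set hecke_index m} := [set t | hecke_cond t].

Lemma hecke_det m t : t \in hecke_set m -> \det (hecke_mx t) != 0.
Proof.
case: t => [[a b] d]; rewrite inE /= => /and5P[_ _ _ ma md].
by rewrite det_mx2 !mxE /= mulr0 subr0 mulf_neq0 // monic_neq0.
Qed.

Lemma hecke_sum_Gamma0 m (W : nmodType) (Phi : 'M[A]_2 -> W) g :
    (forall u N, Gamma0 p u -> \det N != 0 -> Phi (u *m N) = Phi N) ->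
    Gamma0 p g ->
  \sum_(t in hecke_set m) Phi (hecke_mx t *m g) =
  \sum_(t in hecke_set m) Phi (hecke_mx t).
Proof.
move=> PhiG Gg; pose S := hecke_set m.
have [pg ug] : p %| g 1 0 /\ \det g \is a GRing.unit.
  by case/andP: Gg; rewrite unitmxE.
pose rel (t t' : hecke_index m) := `[< exists2 u, Gamma0 p u & hecke_mx t *m g = u *m hecke_mx t' >].
have relS t : t \in S -> exists2 t', t' \in S & rel t t'.
  case: t => [[a b] d]; rewrite inE /= => /and5P[adm cap bd ma md].
  set t := (a, b, d).
  have eqp_det : \det (hecke_mx t *m g) %= m.
    rewrite det_mulmx det_mx2 !mxE /= mulr0 subr0; apply: eqp_trans adm.
    rewrite -[X in _ %= X]mulr1 eqp_mull // -size_poly_eq1.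
    by move: ug; rewrite poly_unitE => /andP[].
  have m0 : m != 0.
    by rewrite -eqp0 -(eqp_ltrans adm) eqp0 mulf_neq0 ?monic_neq0.
  have det0 : \det (hecke_mx t *m g) != 0.
    by rewrite -eqp0 (eqp_ltrans eqp_det) eqp0.
  have [||//|u [a' [b' [d' [Gu E [adE cap' bd' ma' md']]]]]] := @hermite _ p (hecke_mx t *m g).
  - rewrite mulmx2E !mxE /=.
    apply/coprimepP => r rN rp.
    have r10 : r %| g 1 0 := dvdp_trans rp pg.
    have ra0 : r %| (a : A) * g 0 0.
      by rewrite -(dvdp_addl _ (dvdp_mull (b : A) r10)).
    have r00 : r %| g 0 0.
      by move: ra0; rewrite Gauss_dvdpr // (coprimep_dvdr rp) // coprimep_sym.
    have : r %| \det g by rewrite det_mx2 dvdp_sub // ?(dvdp_mulr _ r00) // dvdp_mull.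
    have /eqp_dvdr -> : \det g %= 1.
      by rewrite -size_poly_eq1; move: ug; rewrite poly_unitE => /andP[].
    by rewrite dvdp1 size_poly_eq1.
  - by rewrite mulmx2E !mxE /= mul0r add0r dvdp_mull.
  have adm' : a' * d' %= m by exact: eqp_trans adE eqp_det.
  have sa : (size a' <= size m)%N.
    by rewrite dvdp_leq // -(eqp_dvdr _ adm') dvdp_mulr.
  have sd : (size d' <= size m)%N.
    by rewrite dvdp_leq // -(eqp_dvdr _ adm') dvdp_mull.
  exists (npolyp _ a', npolyp _ b', npolyp _ d').
    by rewrite inE /= !npolypK ?(leq_trans (ltnW bd')) // adm' cap' bd' ma' md'.
  apply/asboolP; exists u => //.
  by rewrite E /= !npolypK // ?(leq_trans (ltnW bd')).
pose s t := odflt t [pick t' in S | rel t t'].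
have sP t : t \in S -> s t \in S /\ rel t (s t).
  rewrite /s => /relS[t' t'S rt]; case: pickP => [t'' /andP[] //|/(_ t')].
  by rewrite t'S rt.
have s_inj : {in S &, injective s}.
  move=> t1 t2 S1 S2 eq_s.
  have [sS1 /asboolP[u1 G1 E1]] := sP _ S1.
  have [sS2 /asboolP[u2 G2 E2]] := sP _ S2.
  have E : hecke_mx t1 = (u1 *m invmx u2) *m hecke_mx t2.
    have [_ /andP[u2U _]] := (Gg, G2).
    have /andP[gU _] := Gg.
    apply: (can_inj (mulmxK gU)).
    by rewrite E1 eq_s -!mulmxA E2 mulKmx.
  case: t1 t2 S1 S2 E {eq_s sS1 sS2 E1 E2} => [[a1 b1] d1] [[a2 b2] d2].
  rewrite !inE /= => /and5P[_ _ bd1 ma1 md1] /and5P[_ _ bd2 ma2 md2] E.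
  have [] := hermite_inj (Gamma0M G1 (Gamma0V G2)) E ma1 ma2 md1 md2 bd1 bd2.
  by move=> /val_inj-> /val_inj-> /val_inj->.
have imS : s @: S = S.
  apply/eqP; rewrite eqEcard card_in_imset // leqnn andbT.
  by apply/fintype.subsetP => _ /imsetP[t tS ->]; case: (sP _ tS).
have -> : \sum_(t in hecke_set m) Phi (hecke_mx t) =
    \sum_(t in s @: S) Phi (hecke_mx t) by rewrite imS.
rewrite big_imset //=; apply: eq_bigr => t tS.
by have [sS /asboolP[u Gu ->]] := sP _ tS; rewrite PhiG // hecke_det.
Qed.

Lemma actA_Gamma0M u N x : Gamma0 p u -> \det N != 0 ->
  cusp p (actA (u *m N) x) = cusp p (actA N x).
Proof. by move=> Gu N0; rewrite actAM // cusp_act. Qed.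

Section Coefficients.
Variable R : comNzRingType.

Definition coinv_rel : set (div0 R P1K) :=
  [set x | exists2 g, Gamma0 p g & exists D, x = pushforward0 (actA g) D - D]%classic.

Definition modsym : Type := lquot coinv_rel.
HB.instance Definition _ := GRing.Lmodule.on modsym.

Definition msclass : div0 R P1K -> modsym := lquot_pi coinv_rel.
HB.instance Definition _ := GRing.Linear.on msclass.

(* [r, s] is the class of (s) - (r). *)
Definition symb (r s : P1K) : modsym := msclass (segment R r s).

Definition boundary0 (D : div0 R P1K) : {freeg (set P1K) / R} :=
  pushforward (cusp p) (val D).

Fact boundary0_is_linear : linear boundary0.
Proof. by move=> a D E; rewrite /boundary0 linearP. Qed.
HB.instance Definition _ := GRing.isLinear.Build R (div0 R P1K)
  {freeg (set P1K) / R} *:%R boundary0 boundary0_is_linear.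

Fact boundary0_rel D : coinv_rel D -> boundary0 D = 0.
Proof.
move=> [g Gg [E ->]]; rewrite linearB; apply/eqP; rewrite subr_eq0; apply/eqP.
rewrite /= /boundary0 /= -pushforward_comp.
by congr (pushforward _ _); apply/funext => x; apply: cusp_act.
Qed.

(* The factorization of boundary0 through the coinvariants; lquot_lift_pi and *)
(* boundary0_rel show that it does not depend on representatives.             *)
Definition boundary : modsym -> {freeg (set P1K) / R} :=
  lquot_lift boundary0.
HB.instance Definition _ := GRing.isLinear.Build R modsym
  {freeg (set P1K) / R} *:%R boundary (lquot_lift_is_linear boundary0_rel).

Definition modsym0 : Type := kernel boundary.
HB.instance Definition _ := GRing.Lmodule.on modsym0.

Definition hecke_div (m : A) (D : div0 R P1K) : modsym :=
  \sum_(t in hecke_set m) msclass (pushforward0 (actA (hecke_mx t)) D).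

Fact hecke_div_is_linear m : linear (hecke_div m).
Proof.
move=> a D E; rewrite /hecke_div scaler_sumr -big_split /=.
by apply: eq_bigr => t _; rewrite !linearP.
Qed.
HB.instance Definition _ m := GRing.isLinear.Build R (div0 R P1K)
  modsym *:%R (hecke_div m) (hecke_div_is_linear m).

Lemma pushforward0M g h (D : div0 R P1K) : \det h != 0 ->
  pushforward0 (actA (g *m h)) D =
  pushforward0 (actA g) (pushforward0 (actA h) D).
Proof.
move=> h0.
have -> : actA (g *m h) = actA g \o actA h by apply/funext => x; apply: actAM.
by apply: val_inj; apply: pushforward_comp.
Qed.

Lemma msclass_act g D : Gamma0 p g ->
  msclass (pushforward0 (actA g) D) = msclass D.
Proof.
move=> Gg; apply/lquot_piP; rewrite -[X in lspan _ X]addr0 -[_ - D]scale1r.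
by apply: lspanP; [exists g => //; exists D | exact: lspan0].
Qed.

Fact hecke_div_rel m D : coinv_rel D -> hecke_div m D = 0.
Proof.
move=> [g Gg [E ->]]; rewrite linearB; apply/eqP; rewrite subr_eq0; apply/eqP.
rewrite [RHS](esym (hecke_sum_Gamma0
  (Phi := fun N => msclass (pushforward0 (actA N) E)) m _ Gg)).
  apply: eq_bigr => t _; congr msclass; apply/esym/pushforward0M.
  exact: Gamma0_det Gg.
move=> u N Gu N0 /=.
transitivity (msclass (pushforward0 (actA u) (pushforward0 (actA N) E))).
  by congr msclass; apply: pushforward0M.
exact: msclass_act.
Qed.

Definition hecke (m : A) : modsym -> modsym := lquot_lift (hecke_div m).
HB.instance Definition _ m := GRing.isLinear.Build R modsym modsym *:%R
  (hecke m) (lquot_lift_is_linear (@hecke_div_rel m)).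

Lemma hecke_symb m r s : hecke m (symb r s) =
  \sum_(t in hecke_set m) symb (actA (hecke_mx t) r) (actA (hecke_mx t) s).
Proof.
rewrite /hecke /symb [LHS](lquot_lift_pi (@hecke_div_rel m)).
apply: eq_bigr => t _; congr msclass; apply: val_inj => /=.
by rewrite linearB /= !pushforwardU.
Qed.

Definition hecke_cusp (m : A) (c : set P1K) : {freeg (set P1K) / R} :=
  \sum_(t in hecke_set m) << cusp p (actA (hecke_mx t) (xget None c)) >>.

Lemma hecke_cuspE m x : hecke_cusp m (cusp p x) =
  \sum_(t in hecke_set m) << cusp p (actA (hecke_mx t) x) >>.
Proof.
rewrite /hecke_cusp; set y := xget _ _.
have [g Gg <-] : cusp p x y.
  apply: (@xgetPex _ None (cusp p x)); exists x, 1%:M; rewrite /= ?actA1 //.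
  exact: Gamma0_1.
rewrite -(hecke_sum_Gamma0 (Phi := fun N => << cusp p (actA N x) >>) m _ Gg).
  by apply: eq_bigr => t _; rewrite (actAM _ _ (Gamma0_det Gg)).
by move=> u N Gu N0; rewrite (actA_Gamma0M _ Gu N0).
Qed.

Lemma boundary_hecke m x :
  boundary (hecke m x) = fglift (hecke_cusp m) (boundary x).
Proof.
rewrite -[x]lquot_reprK; set D := lquot_repr x.
rewrite /hecke [X in boundary X](lquot_lift_pi (@hecke_div_rel m)).
rewrite /boundary [in RHS](lquot_lift_pi boundary0_rel).
rewrite -/(boundary _) linear_sum /=.
under eq_bigr do rewrite /boundary (lquot_lift_pi boundary0_rel) /boundary0 /=.
rewrite /boundary0 /=; elim/freeg_ind: (kernel_val D) => [|a y E IH].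
  by rewrite big1 ?linear0 // => t _; rewrite !linear0.
rewrite linearD linearD /= -IH !pushforwardU liftU hecke_cuspE scaler_sumr.
rewrite -big_split /=; apply: eq_bigr => t _.
by rewrite !linearD /= !pushforwardU freegZ mulr1.
Qed.

Fact hecke0_subproof m (x : modsym0) : in_kernel boundary (hecke m (val x)).
Proof.
by case: x => x /= /eqP x0; rewrite /in_kernel /= boundary_hecke x0 linear0.
Qed.

Definition hecke0 (m : A) (x : modsym0) : modsym0 := Kernel (hecke0_subproof m x).
End Coefficients.

Section BaseChange.
Variables (R S : comNzRingType) (f : {rmorphism R -> S}).

(* Extension of scalars along f; see modsym_base_class for the independence   *)
(* of the representative.                                                     *)
Definition modsym_base (x : modsym R) : modsym S :=
  msclass (base_change0 f (lquot_repr x)).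

Lemma modsym_base_class D : modsym_base (msclass D) = msclass (base_change0 f D).
Proof.
have base0B (E E' : div0 R P1K) :
    base_change0 f (E - E') = base_change0 f E - base_change0 f E'.
  by apply: val_inj; rewrite /= raddfB.
have base0D (E E' : div0 R P1K) :
    base_change0 f (E + E') = base_change0 f E + base_change0 f E'.
  by apply: val_inj; rewrite /= raddfD.
apply/lquot_piP; rewrite -base0B.
have : lspan (@coinv_rel R) (lquot_repr (msclass D) - D).
  by apply/lquot_piP; rewrite lquot_reprK.
elim=> [|a x y [g Gg [E ->]] _ IH].
  have -> : base_change0 f 0 = 0 :> div0 S P1K by apply: val_inj; rewrite /= raddf0.
  exact: lspan0.
rewrite base0D; apply: lspanD => //.
rewrite scalerBr -linearZ base0B -[_ - _]scale1r -[_ *: _]addr0.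
apply: lspanP; last exact: lspan0.
exists g => //; exists (base_change0 f (a *: E)).
congr (_ - _); apply: val_inj => /=.
by rewrite pushforward_base_change.
Qed.

Lemma boundary_base x : boundary (modsym_base x) = base_change f (boundary x).
Proof.
rewrite -[x in RHS]lquot_reprK /boundary (lquot_lift_pi (@boundary0_rel R)).
rewrite (lquot_lift_pi (@boundary0_rel S)).
exact: pushforward_base_change.
Qed.

Fact modsym0_base_subproof (x : modsym0 R) :
  in_kernel (@boundary S) (modsym_base (val x)).
Proof.
by case: x => x /= /eqP x0; rewrite /in_kernel /= boundary_base x0 raddf0.
Qed.

Definition modsym0_base (x : modsym0 R) : modsym0 S :=
  Kernel (modsym0_base_subproof x).
End BaseChange.
End ModularSymbols.

Section Tree.
Variable F : finFieldType.
Local Notation A := {poly F}.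
Local Notation Oinf := (powser F).
Local Notation Kinf := {fraction (powser F)}.

Definition pi_inf : Kinf := tofrac (powserX F).

(* The embedding of A in K_oo sends T to 1/pi. *)
Definition poly_Kinf (a : A) : Kinf :=
  (map_poly (fun c : F => tofrac (powserC c)) a).[pi_inf^-1].

Definition ratfrac_Kinf (x : {fraction A}) : Kinf :=
  poly_Kinf \n_(repr x) / poly_Kinf \d_(repr x).

Definition P1_Kinf (x : P1 {fraction A}) : P1 Kinf := omap ratfrac_Kinf x.

Definition GL2_Kinf : set 'M[Kinf]_2 := [set g | g \in unitmx]%classic.

Definition scalar_Kinf : set Kinf := [set z | z != 0]%classic.

Definition GL2_O : set 'M[Oinf]_2 := [set k | k \in unitmx]%classic.

Definition iwahori : set 'M[Oinf]_2 :=
  [set k | k \in unitmx /\ exists h, k 1 0 = powserX F * h]%classic.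

(* Vertices and edges are cosets of GL_2(O_oo) Z(K_oo) and of I Z(K_oo) in    *)
(* GL_2(K_oo), represented as subsets of 'M_2(K_oo); functions on edges are   *)
(* functions on such subsets, only their values on [edges] being relevant.    *)
Definition vertex (g : 'M[Kinf]_2) : set 'M[Kinf]_2 :=
  [set z *: (g *m map_mx (@tofrac Oinf) k) | z in scalar_Kinf & k in GL2_O]%classic.

Definition edge (g : 'M[Kinf]_2) : set 'M[Kinf]_2 :=
  [set z *: (g *m map_mx (@tofrac Oinf) k) | z in scalar_Kinf & k in iwahori]%classic.

Definition edges : set (set 'M[Kinf]_2) := [set edge g | g in GL2_Kinf]%classic.

(* g I Z |-> g GL_2(O_oo) Z *)
Definition origin (e : set 'M[Kinf]_2) : set 'M[Kinf]_2 :=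
  [set g *m map_mx (@tofrac Oinf) k | g in e & k in GL2_O]%classic.

(* g I Z |-> g w I Z for w = (0, 1; pi, 0), which normalizes I Z. *)
Definition opposite (e : set 'M[Kinf]_2) : set 'M[Kinf]_2 :=
  [set g *m mx2 0 1 pi_inf 0 | g in e]%classic.

Definition translate (h : 'M[Kinf]_2) (c : set 'M[Kinf]_2) : set 'M[Kinf]_2 :=
  [set h *m g | g in c]%classic.

(* The class of diag(pi^k, 1) for k = -n. *)
Definition ray_infty (n : nat) : set 'M[Kinf]_2 :=
  vertex (mx2 (pi_inf ^- n) 0 0 1).

(* The sequence of vertices v is, up to finitely many terms and a shift, a     *)
(* half-line representing the end x: by equivariance the latter is the        *)
(* translate of the half-line towards oo by some g with g oo = x.             *)
Definition tends_to (v : nat -> set 'M[Kinf]_2) (x : P1 Kinf) : Prop :=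
  exists g, [/\ GL2_Kinf g, homography g None = x &
    exists k l, forall n, v (n + k)%N = translate g (ray_infty (n + l)%N)].

(* c is an infinite path without backtracking, going from r to s. *)
Definition geodesic (r s : P1 Kinf) (c : int -> set 'M[Kinf]_2) : Prop :=
  [/\ forall i, edges (c i),
      forall i, origin (opposite (c i)) = origin (c (i + 1)),
      forall i, c (i + 1) <> opposite (c i),
      tends_to (fun n => origin (c (- n%:Z))) r &
      tends_to (fun n => origin (c n%:Z)) s].

Variable p : A.

Definition cuspidal (f : set 'M[Kinf]_2 -> rat) : Prop :=
  [/\ forall e, edges e -> f (opposite e) = - f e,
      forall g, GL2_Kinf g ->
        \sum_(e \in [set e | edges e /\ origin e = vertex g]%classic) f e = 0,
      forall g e, Gamma0 p g -> edges e ->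
        f (translate (map_mx poly_Kinf g) e) = f e &
      exists2 S : set (set 'M[Kinf]_2), finite_set S &
        forall e, edges e -> f e != 0 -> exists g e',
          [/\ Gamma0 p g, S e' & e = translate (map_mx poly_Kinf g) e']].

(* l is the linear form <-, f> on M_p(Q); it is unique since the symbols        *)
(* [r, s] span. The edges c i are distinct, so the sum over the range of c is *)
(* the sum along the path; it has finitely many nonzero terms for cuspidal f. *)
Definition is_pairing (f : set 'M[Kinf]_2 -> rat)
    (l : {scalar (modsym p rat)}) : Prop :=
  forall r s c, geodesic (P1_Kinf r) (P1_Kinf s) c ->
    l (symb p rat r s) = \sum_(e \in range c) f e.

Definition is_winding (e : modsym0 p rat) : Prop :=
  forall f l, cuspidal f -> is_pairing f l ->
    l (val e) = l (symb p rat (Some 0) None).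
End Tree.

Section EisensteinIdeal.
Variables (R : realType) (F : finFieldType) (p : {poly F}).
Local Notation V := (modsym0 p R[i]).

(* Elements of End(M^0_p(C)) are plain functions, composed by \o and added     *)
(* pointwise; hecke_alg is the smallest subring containing the generators.    *)
Inductive hecke_alg : set (V -> V) :=
| hecke_alg1 : hecke_alg id
| hecke_algT m : m != 0 -> coprimep m p -> hecke_alg (hecke0 m)
| hecke_algB t u : hecke_alg t -> hecke_alg u -> hecke_alg (fun x => t x - u x)
| hecke_algM t u : hecke_alg t -> hecke_alg u -> hecke_alg (t \o u).

Definition eisenstein_op (m : {poly F}) : V -> V :=
  fun x => hecke0 m x - x *+ (#|F| ^ (size m).-1 + 1).

Inductive eis_ideal : set (V -> V) :=
| eis_eta m : irreducible_poly m -> ~~ (m %= p) -> eis_ideal (eisenstein_op m)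
| eisD t u : eis_ideal t -> eis_ideal u -> eis_ideal (fun x => t x + u x)
| eisM s t : hecke_alg s -> eis_ideal t -> eis_ideal (s \o t).

Definition int_base : modsym0 p int -> V := modsym0_base (intr : {rmorphism int -> R[i]}).
Definition rat_base : modsym0 p rat -> V := modsym0_base (ratr : {rmorphism rat -> R[i]}).

(* The action of t in the Hecke algebra on M^0_p(Z): the element mapped by    *)
(* M^0_p(Z) -> M^0_p(C) to the image under t (0 if there is none).            *)
Definition hecke_act (t : V -> V) (x : modsym0 p int) : modsym0 p int :=
  xget 0 [set y | int_base y = t (int_base x)]%classic.

(* t e / (q - 1), as the element of M^0_p(Z) with this image in M^0_p(C) (0    *)
(* if there is none).                                                         *)
Definition winding_hom (e : modsym0 p rat) (t : V -> V) : modsym0 p int :=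
  xget 0 [set y | int_base y = (#|F|%:R - 1)^-1 *: t (rat_base e)]%classic.
End EisensteinIdeal.

(* Ideals of degree 1 are represented by their monic generators. *)
Definition deg1 (F : finFieldType) :=
  {n : {poly_2 F} | ((n : {poly F}) \is monic) && (size n == 2%N)}.

Definition deg1_gen (F : finFieldType) (n : deg1 F) : {poly F} := val (val n).

Definition is_Zbasis (I : finType) (V : zmodType) (b : I -> V) : Prop :=
  forall x, exists! c : {ffun I -> int}, x = \sum_i b i *~ c i.

(* Main.v *)
Require Import Defs.
From HB Require Import structures.
From mathcomp Require Import all_boot all_order all_algebra.
From mathcomp Require Import boolp classical_sets functions cardinality fsbigop reals.
From mathcomp Require Import complex freeg.
From mathcomp Require Import ring.
Set Implicit Arguments. Unset Strict Implicit. Unset Printing Implicit Defensive.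
Import Order.TTheory GRing.Theory Num.Theory.
Local Open Scope ring_scope.

(** Write xi_n for the modular symbol [1/n, 0], with n monic of degree one, and
    q for the number of elements of F.

    Any symbol is a sum of Manin symbols [g 0, g oo] with g in GL_2(A), and such
    a symbol depends only on the class of the lower row of g in the projective
    line over A/p. As p has degree three, each class contains a row of coprime
    entries of degree at most one, unique up to a constant factor ([reduced_row_ex],
    [reduced_row_uniq]). By the three-term relation the symbols are therefore
    spanned by [0, oo] and the xi_n, and the boundary map shows that the xi_n span
    the parabolic symbols ([inv_symb0_span]). They are independent over any ring:
    giving to a row with reduced form (c, d) the weight v(d) - v(c), where v is the
    indicator function of the multiples of n by nonzero constants, satisfies the
    relations between Manin symbols, and summing these weights along the Euclidean
    algorithm ([cocycle_diff]) gives a linear form that is 1 on xi_n and 0 on the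
    other basis elements ([dual_form]).

    For an irreducible m not associate to p, eta_m = T_m - (q^deg m + 1) sends [0, oo]
    to q - 1 times an integral parabolic symbol ([eta_integral]), which is xi_m when m
    is monic of degree one ([eta_deg1]). The same holds for the winding element e:
    if f is a cuspidal cochain, then so is its image under a Hecke operator
    ([hecke_cochain_cuspidal]), whose pairing is the pairing with f composed with
    the operator ([hecke_cochain_pairing]); and the uniqueness of e says that
    parabolic symbols are separated by these pairings. Hence
    eta_m e = eta_m [0, oo] ([winding_eta]). Manipulating the sums along geodesics
    requires that cuspidal cochains have finite support on a geodesic between two
    cusps ([geodesic_support_finite]); this holds because far vertices of a ray
    towards a cusp are inequivalent under GL_2(A) ([ray_inequivalent]).

    It follows that t e / (q - 1) is integral for every t in the Eisenstein ideal,
    and that the values at the eta_n are the xi_n, which form a basis: the winding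
    homomorphism is surjective. It is injective because t commutes with eta_n
    ([hecke_commute]), so that t xi_n = eta_n (t e) / (q - 1) is determined by
    t e. *)

(** * Points of the projective line and invertible matrices *)

Section HomographyPoints.
Variable L : fieldType.

(** The point with homogeneous coordinates (u : v). *)
Definition ptL (u v : L) : P1 L := if v == 0 then None else Some (u / v).

Lemma homography_ptL (g : 'M[L]_2) (u v : L) : (u != 0) || (v != 0) ->
  homography g (ptL u v) = ptL (g 0 0 * u + g 0 1 * v) (g 1 0 * u + g 1 1 * v).
Proof.
move=> uv; rewrite /ptL; have [v0|v0] /= := eqVneq v 0.
  rewrite v0 eqxx orbF in uv; rewrite v0 !mulr0 !addr0 mulf_eq0 (negPf uv) orbF.
  by case: eqP => // _; rewrite -mulf_div divff // mulr1.
have E x y : x * (u / v) + y = (x * u + y * v) / v by rewrite mulrDl mulfK // mulrA.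
rewrite !E mulf_eq0 invr_eq0 (negPf v0) orbF.
by case: eqP => // /eqP w0; rewrite invfM invrK mulrACA mulVf // mulr1.
Qed.
End HomographyPoints.

Lemma fraction_numden (D : idomainType) (x : {fraction D}) :
  x = tofrac \n_(repr x)%qT / tofrac \d_(repr x)%qT.
Proof.
have d0 : tofrac \d_(repr x)%qT != 0 :> {fraction D}.
  by rewrite tofrac_eq0 denom_ratioP.
apply: (mulIf d0); rewrite mulfVK //.
have tE a : tofrac a = \pi_({fraction D})%qT (Ratio a 1) by rewrite piE.
rewrite -{1}[x]reprK !tE -[LHS]FracField.pi_mul.
apply/eqmodP; rewrite /= FracField.equivfE /FracField.mulf.
by rewrite !numden_Ratio ?mulf_neq0 ?denom_ratioP ?oner_eq0 // !mulr1 mulrC.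
Qed.

Section Points.
Variable F : finFieldType.
Local Notation A := {poly F}.
Local Notation K := {fraction A}.
Local Notation P1K := (P1 K).

Definition pt (a c : A) : P1K :=
  if c == 0 then None else Some (tofrac a / tofrac c).

Lemma ptE (a c : A) : pt a c = ptL (tofrac a) (tofrac c).
Proof. by rewrite /pt /ptL tofrac_eq0. Qed.

Lemma pt_mull (k a c : A) : k != 0 -> pt (k * a) (k * c) = pt a c.
Proof.
move=> k0; rewrite /pt mulf_eq0 (negPf k0) /=; case: eqP => // _.
by rewrite !tofracM -mulf_div divff ?mul1r // tofrac_eq0.
Qed.

Lemma pt_coprime (r : P1K) : exists a c, coprimep a c /\ r = pt a c.
Proof.
case: r => [z|]; last by exists 1, 0; rewrite coprimep0 eqpxx /pt eqxx.
have d0 : \d_(repr z)%qT != 0 := denom_ratioP _.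
have nd0 : (\n_(repr z)%qT != 0) || (\d_(repr z)%qT != 0) by rewrite d0 orbT.
set n := \n_(repr z)%qT in nd0 *; set d := \d_(repr z)%qT in d0 nd0 *.
exists (n %/ gcdp n d), (d %/ gcdp n d); split; first exact: coprimep_div_gcd.
have g0 : gcdp n d != 0 by rewrite gcdp_eq0 negb_and.
rewrite -(pt_mull _ _ g0) [gcdp n d * (n %/ _)]mulrC [gcdp n d * _]mulrC.
rewrite !divpK ?dvdp_gcdl ?dvdp_gcdr //.
by rewrite /pt (negPf d0) {1}[z]fraction_numden.
Qed.

Lemma coprimep_neq0 (a c : A) : coprimep a c -> (a != 0) || (c != 0).
Proof.
rewrite -negb_and; apply: contraTN => /andP[/eqP-> /eqP->].
by rewrite coprimep0 eqp01.
Qed.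

Lemma unit_polyP (x : A) :
  reflect (exists2 u : F, u != 0 & x = u%:P) (x \is a GRing.unit).
Proof.
rewrite poly_unitE; apply: (iffP andP) => [[/eqP s1 u0]|[u u0 ->]].
  by exists x`_0; [rewrite -unitfE | rewrite [x in LHS]size1_polyC ?s1].
by rewrite size_polyC u0 coefC eqxx unitfE.
Qed.

Lemma eqp_scaleP (x y : A) : x %= y -> exists2 u : F, u != 0 & y = u *: x.
Proof.
rewrite eqp_sym => /eqpP[[u v] /= /andP[u0 v0] e]; exists (u^-1 * v).
  by rewrite mulf_neq0 ?invr_eq0.
by rewrite -scalerA -e scalerA mulVf // scale1r.
Qed.

Lemma unitmx2P (g : 'M[A]_2) : reflect
  (exists2 u : F, u != 0 & g 0 0 * g 1 1 - g 0 1 * g 1 0 = u%:P) (g \in unitmx).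
Proof. by rewrite unitmxE det_mx2; apply: unit_polyP. Qed.

Lemma coprime_cross (a c b d : A) :
  coprimep a c -> coprimep b d -> a * d = b * c ->
  exists2 u : F, u != 0 & b = u *: a /\ d = u *: c.
Proof.
move=> ac bd e; have ab : a %= b.
  apply/andP; split.
    by rewrite -(Gauss_dvdpl _ ac) -e dvdp_mulr.
  by rewrite -(Gauss_dvdpl _ bd) e dvdp_mulr.
have cd : c %= d.
  apply/andP; split.
    by rewrite coprimep_sym in ac; rewrite -(Gauss_dvdpr _ ac) e dvdp_mull.
  by rewrite coprimep_sym in bd; rewrite -(Gauss_dvdpr _ bd) -e dvdp_mull.
have [u u0 bE] := eqp_scaleP ab; have [v v0 dE] := eqp_scaleP cd.
have [a0|a0] := eqVneq a 0.
  by exists v => //; rewrite dE bE a0 !scaler0.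
exists u => //; split=> //; move: e; rewrite bE dE -scalerAl -scalerAr.
have [c0|c0] := eqVneq c 0; first by rewrite c0 !scaler0.
move/eqP; rewrite -subr_eq0 -scalerBl scaler_eq0 mulf_eq0 (negPf a0) (negPf c0).
by rewrite !orbF subr_eq0 => /eqP->.
Qed.

Lemma pt_inj (a c b d : A) : coprimep a c -> coprimep b d -> pt a c = pt b d ->
  exists2 u : F, u != 0 & b = u *: a /\ d = u *: c.
Proof.
move=> ac bd e; apply: coprime_cross => //; move: e; rewrite /pt.
have [->|c0] := eqVneq c 0; have [->|d0] //= := eqVneq d 0.
  by rewrite !mulr0.
case=> e; apply/eqP; rewrite -tofrac_eq !tofracM.
by rewrite -eqr_div ?tofrac_eq0 // e.
Qed.

Lemma actA_pt (g : 'M[A]_2) (a c : A) : (a != 0) || (c != 0) ->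
  actA g (pt a c) = pt (g 0 0 * a + g 0 1 * c) (g 1 0 * a + g 1 1 * c).
Proof.
move=> ac; have acF : (tofrac a != 0 :> K) || (tofrac c != 0 :> K).
  by rewrite !tofrac_eq0.
by rewrite actA.unlock !ptE (homography_ptL _ acF) !mxE -!tofracM -!tofracD.
Qed.

Lemma actA_oo (g : 'M[A]_2) : actA g None = pt (g 0 0) (g 1 0).
Proof. by rewrite actA.unlock /pt /= !mxE tofrac_eq0; case: ifP. Qed.

Lemma actA_0 (g : 'M[A]_2) : actA g (Some 0) = pt (g 0 1) (g 1 1).
Proof. by rewrite actA.unlock /pt /= !mxE !mulr0 !add0r tofrac_eq0. Qed.

Lemma unitmx_det0 (g : 'M[A]_2) : g \in unitmx -> \det g != 0.
Proof. by rewrite unitmxE; apply: contraTneq => ->; rewrite unitr0. Qed.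

Lemma unitmx_row (g : 'M[A]_2) : g \in unitmx -> coprimep (g 1 0) (g 1 1).
Proof.
case/unitmx2P=> u u0 e; apply/Bezout_coprimepP; exists (- g 0 1, g 0 0) => /=.
by rewrite mulNr addrC e -size_poly_eq1 size_polyC u0.
Qed.

Lemma unitmx_col (g : 'M[A]_2) : g \in unitmx -> coprimep (g 0 0) (g 1 0).
Proof.
case/unitmx2P=> u u0 e; apply/Bezout_coprimepP; exists (g 1 1, - g 0 1) => /=.
by rewrite mulNr mulrC e -size_poly_eq1 size_polyC u0.
Qed.

Lemma bezout1 (a c : A) : coprimep a c -> exists b d, a * d - b * c = 1.
Proof.
move=> /Bezout_eq1_coprimepP[[d b] /= e]; exists (- b), d.
by rewrite mulNr opprK mulrC.
Qed.

Lemma complete_col (a c : A) : coprimep a c ->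
  exists2 g : 'M[A]_2, g \in unitmx & g 0 0 = a /\ g 1 0 = c.
Proof.
move=> /bezout1[b [d e]]; exists (mx2 a b c d); last by rewrite !mxE.
by apply/unitmx2P; exists 1; rewrite ?oner_neq0 // !mxE /= e.
Qed.

Lemma complete_row (c d : A) : coprimep c d ->
  exists2 g : 'M[A]_2, g \in unitmx & g 1 0 = c /\ g 1 1 = d.
Proof.
move=> /bezout1[b [a e]]; exists (mx2 (- b) (- a) c d); last by rewrite !mxE.
apply/unitmx2P; exists 1; rewrite ?oner_neq0 // !mxE /= polyC1 -e.
by rewrite !mulNr opprK addrC [c * a]mulrC.
Qed.

Lemma pt_gl2 (r : P1K) : exists2 g : 'M[A]_2, g \in unitmx & actA g None = r.
Proof.
have [a [c [ac ->]]] := pt_coprime r; have [g ug [<- <-]] := complete_col ac.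
by exists g => //; rewrite actA_oo.
Qed.

Definition swap_mx : 'M[A]_2 := mx2 0 1 1 0.
Definition shear_mx (t : A) : 'M[A]_2 := mx2 1 t 0 1.

Lemma swap_unit : swap_mx \in unitmx.
Proof.
apply/unitmx2P; exists (-1); first by rewrite oppr_eq0 oner_neq0.
by rewrite !mxE /= mul0r mulr1 sub0r polyCN.
Qed.

Lemma shear_unit t : shear_mx t \in unitmx.
Proof.
by apply/unitmx2P; exists 1; rewrite ?oner_neq0 // !mxE /= mulr0 subr0 mulr1.
Qed.

Lemma mul_swapE (g : 'M[A]_2) i :
  ((g *m swap_mx) i 0 = g i 1) * ((g *m swap_mx) i 1 = g i 0).
Proof. by rewrite !mulmx2E !mxE /= !mulr0 !mulr1 add0r addr0. Qed.

Lemma mul_shearE (g : 'M[A]_2) t i :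
  ((g *m shear_mx t) i 0 = g i 0) * ((g *m shear_mx t) i 1 = g i 0 * t + g i 1).
Proof. by rewrite !mulmx2E !mxE /= !mulr0 !mulr1 addr0. Qed.

Lemma actA_swap (g : 'M[A]_2) :
  (actA (g *m swap_mx) None = actA g (Some 0)) *
  (actA (g *m swap_mx) (Some 0) = actA g None).
Proof. by rewrite !actA_oo !actA_0 !mul_swapE. Qed.

(** Reducing the second column of a matrix modulo the first does not move the
    image of infinity, so Euclid's algorithm on the lower row joins any point
    to infinity through pairs of the form (g 0, g oo). *)
Lemma gl2_ind (P : P1K -> Prop) : P None ->
  (forall g, g \in unitmx -> P (actA g (Some 0)) -> P (actA g None)) ->
  forall r, P r.
Proof.
move=> P0 Pg r; have [g ug <-] := pt_gl2 r.
have [n] := ubnP (size (g 1 0)); elim: n => // n IH in g ug *; rewrite ltnS => sg.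
have [c0|c0] := eqVneq (g 1 0) 0; first by rewrite actA_oo /pt c0 eqxx.
set t := - (g 1 1 %/ g 1 0).
have ug' : g *m shear_mx t \in unitmx by rewrite unitmx_mul ug shear_unit.
have -> : actA g None = actA (g *m shear_mx t) None.
  by rewrite !actA_oo !mul_shearE.
apply: Pg => //; rewrite -(actA_swap _).1; apply: IH.
  by rewrite unitmx_mul ug' swap_unit.
rewrite mul_swapE mul_shearE; apply: leq_trans sg.
have -> : g 1 0 * t + g 1 1 = g 1 1 %% g 1 0.
  by rewrite /t {2}(divp_eq (g 1 1) (g 1 0)) mulrN mulrC addKr.
by rewrite ltn_modp.
Qed.
End Points.

(** * A function on the projective line from the Euclidean algorithm *)

Section EuclidCocycle.
Variables (F : finFieldType) (W : zmodType).
Local Notation A := {poly F}.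
Local Notation P1K := (P1 {fraction A}).
Variable xi : A -> A -> W.
Hypothesis xiZ : forall (u v : F) c d, u != 0 -> v != 0 -> coprimep c d ->
  xi (u *: c) (v *: d) = xi c d.
Hypothesis xi_sym : forall c d, coprimep c d -> xi d c = - xi c d.
Hypothesis xi_tri : forall (u : F) d r, u != 0 -> coprimep d r ->
  xi (u *: d + r) d = xi (u *: d + r) r - xi d r.

(** The first argument is fuel: it bounds the number of divisions. *)
Fixpoint euclid_sum_rec n (c d : A) : W :=
  if n is n'.+1 then
    if d == 0 then 0 else xi c d + euclid_sum_rec n' d (c %% d)
  else 0.

Definition euclid_sum (c d : A) := euclid_sum_rec (size d) c d.

Lemma euclid_sum_rec_fuel n k (c d : A) : (size d <= n)%N -> (size d <= k)%N ->
  euclid_sum_rec n c d = euclid_sum_rec k c d.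
Proof.
elim: n k c d => [|n IH] [|k] c d //=; rewrite ?leqn0 ?size_poly_eq0.
- by move=> /eqP-> _; rewrite eqxx.
- by move=> _ /eqP->; rewrite eqxx.
move=> dn dk; case: eqP => // /eqP d0; congr (_ + _).
have lt := ltn_modpN0 c d0.
by apply: IH; rewrite -ltnS (leq_trans lt).
Qed.

Lemma euclid_sum_recE n (c d : A) : (size d <= n)%N ->
  euclid_sum_rec n c d = euclid_sum c d.
Proof. by move=> dn; apply: euclid_sum_rec_fuel. Qed.

Lemma euclid_sum0 c : euclid_sum c 0 = 0.
Proof. by rewrite /euclid_sum size_poly0. Qed.

Lemma euclid_sumE c d : d != 0 ->
  euclid_sum c d = xi c d + euclid_sum d (c %% d).
Proof.
move=> d0; rewrite {1}/euclid_sum -[size d]prednK ?size_poly_gt0 //=.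
rewrite (negPf d0) euclid_sum_recE //.
by rewrite -ltnS prednK ?size_poly_gt0 // ltn_modpN0.
Qed.

Lemma euclid_sumZ (u v : F) c d : u != 0 -> v != 0 -> coprimep c d ->
  euclid_sum (u *: c) (v *: d) = euclid_sum c d.
Proof.
have [n] := ubnP (size d); elim: n => // n IH in u v c d *.
rewrite ltnS => sd u0 v0 cd; have [->|d0] := eqVneq d 0.
  by rewrite scaler0 !euclid_sum0.
rewrite euclid_sumE ?scaler_eq0 ?negb_or ?v0 // [in RHS]euclid_sumE //.
rewrite xiZ // modpZr // modpZl.
congr (_ + _); apply: IH => //; first by rewrite (leq_trans _ sd) // ltn_modpN0.
by rewrite coprimep_modr coprimep_sym.
Qed.

(** The value at a / c is the sum of xi along the Euclidean algorithm joining
    a / c to infinity; it reads off the lower rows of the successive matrices,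
    so only c and the inverse of a modulo c are needed. *)
Definition cocycle (r : P1K) : W :=
  let g := xget 1%:M [set g | g \in unitmx /\ actA g None = r]%classic in
  euclid_sum (g 1 0) (g 1 1 %% g 1 0).

Lemma cocycle_oo (g : 'M[A]_2) : g \in unitmx ->
  cocycle (actA g None) = euclid_sum (g 1 0) (g 1 1 %% g 1 0).
Proof.
move=> ug; rewrite /cocycle; set h := xget _ _.
have [uh hg] : h \in unitmx /\ actA h None = actA g None.
  exact: (@xgetPex _ _ [set g' | g' \in unitmx /\ actA g' None = actA g None]
    (ex_intro _ g (conj ug erefl))).
move: hg; rewrite !actA_oo => /(pt_inj (unitmx_col uh) (unitmx_col ug)).
case=> u u0 [e0 e1]; rewrite e1.
have [a a0 da] := unitmx2P _ uh; have [b b0 db] := unitmx2P _ ug.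
have cop : coprimep (h 1 0) (h 1 1 %% h 1 0).
  by rewrite coprimep_modr unitmx_row.
(* The lower right entries are inverse to the upper left ones modulo the
   common lower left entry, up to constants. *)
suff -> : g 1 1 %% (u *: h 1 0) = (b / (u * a)) *: (h 1 1 %% h 1 0).
  by rewrite euclid_sumZ // mulf_neq0 // invr_eq0 mulf_neq0.
rewrite modpZr // -modpZl; apply/eqP; rewrite -subr_eq0 -modpN -modpD.
apply/eqP/modp_eq0P; set k := b / (u * a).
have : h 1 0 %| h 0 0 * (g 1 1 - k *: h 1 1).
  have E : h 0 0 * g 1 1 = (u^-1 * b)%:P + g 0 1 * h 1 0.
    rewrite polyCM -db mulrBr e0 e1 mul_polyC -scalerAl scalerA mulVf // scale1r.
    by rewrite -scalerAr mul_polyC scalerA mulVf // scale1r subrK.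
  have E' : h 0 0 * h 1 1 = a%:P + h 0 1 * h 1 0 by rewrite -da subrK.
  have -> : h 0 0 * (g 1 1 - k *: h 1 1) = (g 0 1 - k *: h 0 1) * h 1 0.
    rewrite mulrBr -scalerAr E E' scalerDr -[k *: a%:P]mul_polyC -polyCM.
    have -> : k * a = u^-1 * b by rewrite /k invfM; field; rewrite u0 a0.
    by rewrite opprD addrACA subrr add0r mulrBl scalerAl.
  exact: dvdp_mull.
rewrite Gauss_dvdpr; last by rewrite coprimep_sym unitmx_col.
by move=> ->.
Qed.

(** If one of the points g 0 and g oo has a larger denominator, the other one is the
    next step of its Euclidean algorithm. If the denominators
    have the same degree, both algorithms continue with the same remainder, and
    the three-term relation compares the first steps. *)
Lemma cocycle_diff (g : 'M[A]_2) : g \in unitmx ->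
  cocycle (actA g None) - cocycle (actA g (Some 0)) = xi (g 1 0) (g 1 1).
Proof.
move=> ug; have ugS : g *m swap_mx F \in unitmx by rewrite unitmx_mul ug swap_unit.
rewrite -(actA_swap g).1 !cocycle_oo // !mul_swapE.
have := unitmx_row ug; set c := g 1 0; set d := g 1 1 => cd.
have dc : coprimep d c by rewrite coprimep_sym.
have [ltdc|ltcd|eqs] := ltngtP (size d) (size c).
- rewrite (modp_small ltdc); have [d0|d0] := eqVneq d 0.
    have c0 : c != 0 by rewrite -size_poly_gt0 (leq_ltn_trans _ ltdc).
    rewrite d0 modp0 euclid_sum0 euclid_sumE // mod0p euclid_sum0 addr0 sub0r.
    by rewrite xi_sym ?opprK // -d0.
  by rewrite euclid_sumE // addrK.
- rewrite (modp_small ltcd); have [c0|c0] := eqVneq c 0.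
    have d0 : d != 0 by rewrite -size_poly_gt0 (leq_ltn_trans _ ltcd).
    by rewrite c0 modp0 euclid_sum0 euclid_sumE // mod0p euclid_sum0 subr0 addr0.
  by rewrite (euclid_sumE d) // opprD addrCA subrr addr0 -(xi_sym dc).
have c0 : c != 0.
  apply: contraTneq cd => c0; move: eqs; rewrite c0 size_poly0 => /eqP.
  by rewrite size_poly_eq0 => /eqP->; rewrite coprimep0 eqp01.
have d0 : d != 0 by rewrite -size_poly_gt0 eqs size_poly_gt0.
have [u u0 cE] : exists2 u : F, u != 0 & c = u *: d + c %% d.
  have : size (c %/ d) == 1%N.
    rewrite size_divp // -eqs; case: (size d) d0 (size_poly_eq0 d) => [|n _ _].
      by rewrite eqxx => /negPf->.
    by rewrite subSnn.
  move=> /size_poly1P[u u0 e]; exists u => //.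
  by rewrite -mul_polyC -e -divp_eq.
have rE : d %% c = (- u^-1) *: (c %% d).
  have {1}-> : d = u^-1 *: c + (- u^-1) *: (c %% d).
    by rewrite {1}cE scalerDr scalerA mulVf // scale1r scaleNr addrK.
  by rewrite modpD modpZl modpp scaler0 add0r modp_small // size_scale
    ?oppr_eq0 ?invr_eq0 // -eqs ltn_modp.
set r := c %% d in cE rE *; have dr : coprimep d r by rewrite coprimep_modr.
have cr : coprimep c r.
  rewrite coprimep_sym cE addrC -[X in X + _]mul1r coprimep_addl_mul.
  by rewrite coprimepZr // coprimep_sym.
have -> : euclid_sum c (d %% c) = euclid_sum c r.
  by rewrite rE -[X in euclid_sum X _ = _]scale1r euclid_sumZ ?oner_neq0 ?oppr_eq0 ?invr_eq0.
have [r0|r0] := eqVneq r 0.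
  rewrite r0 addr0 in cE; rewrite r0 in dr *.
  have /= := xi_tri u0 dr; rewrite !addr0 -cE => ->.
  by rewrite {2}cE -[0 in RHS](scaler0 _ 1) xiZ ?oner_neq0 // scaler0 !euclid_sum0 !subrr.
rewrite (euclid_sumE c) // (euclid_sumE d) //.
have -> : c %% r = u *: (d %% r) by rewrite cE modpD modpp addr0 modpZl.
rewrite -[r in euclid_sum r (u *: _)]scale1r euclid_sumZ ?oner_neq0 //; last first.
  by rewrite coprimep_modr coprimep_sym.
by rewrite [in RHS]cE xi_tri // -cE opprD addrACA subrr addr0.
Qed.
End EuclidCocycle.

(** * Linear forms on modular symbols *)

Section LinearForm.
Variables (F : finFieldType) (p : {poly F}) (R : comNzRingType).
Local Notation A := {poly F}.
Local Notation P1K := (P1 {fraction A}).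
Variable h : P1K -> R.
Hypothesis hG : forall g, Gamma0 p g -> exists c, forall r, h (actA g r) = h r + c.

Let h_div (D : div0 R P1K) : R^o := fglift (h : P1K -> R^o) (val D).

Fact h_div_is_linear : linear h_div.
Proof. by move=> a D E; rewrite /h_div linearP. Qed.
HB.instance Definition _ := GRing.isLinear.Build R (div0 R P1K) R^o *:%R
  h_div h_div_is_linear.

Fact h_div_rel D : coinv_rel p D -> h_div D = 0.
Proof.
move=> [g Gg [E ->]]; have [c hc] := hG Gg.
rewrite linearB; apply/eqP; rewrite subr_eq0; apply/eqP.
have E0 : degree (kernel_val E) = 0 by case: E => E' /= /eqP.
rewrite /h_div /=.
have aff E' : fglift (h : P1K -> R^o) (pushforward (actA g) E') =
    fglift (h : P1K -> R^o) E' + c *: degree E'; last first.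
  by apply: etrans (aff _) _; rewrite E0 [c *: _]mulr0 addr0.
elim/freeg_ind: E' => [|a x E' IH]; first by rewrite !linear0 addr0.
rewrite !linearD /= IH pushforwardU !liftU degreeU hc !scalerDr.
by rewrite addrACA; congr (_ + _ + (_ + _)); rewrite /GRing.scale /= mulrC.
Qed.

Definition form_of : modsym p R -> R^o := lquot_lift h_div.
HB.instance Definition _ := GRing.isLinear.Build R (modsym p R) R^o *:%R
  form_of (lquot_lift_is_linear h_div_rel).

Lemma form_of_symb r s : form_of (symb p R r s) = h s - h r.
Proof.
rewrite /form_of /symb [LHS](lquot_lift_pi h_div_rel).
transitivity (fglift (h : P1K -> R^o) (<< s >> - << r >>)) => //.
by rewrite linearB /= !liftU !scale1r.
Qed.

(** A function that the group changes by constants is invariant on divisors of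
    degree zero. *)
Lemma invariant_form : exists l : {linear modsym p R -> R^o},
  forall r s, l (symb p R r s) = h s - h r.
Proof. by exists form_of; exact: form_of_symb. Qed.
End LinearForm.

Section ReducedRows.
Variables (F : finFieldType) (p : {poly F}).
Hypotheses (p_irr : irreducible_poly p) (p_size : size p = 4).
Local Notation A := {poly F}.

Definition reduced_row (c d c0 d0 : A) : Prop :=
  [/\ coprimep c0 d0, (size c0 <= 2)%N, (size d0 <= 2)%N & p %| c0 * d - d0 * c].

Lemma coprimep_small (q : A) : (size q <= 3)%N -> q != 0 -> coprimep p q.
Proof.
move=> sq q0; rewrite irreducible_poly_coprime //; apply/negP => /(dvdp_leq q0).
by rewrite p_size leqNgt ltnS sq.
Qed.

(** Let x be the residue of d / c modulo p, if p does not divide c. If x has degree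
    two, divide p by x: the quotient has degree one, and p = q x + r gives
    q x = - r modulo p. *)
Lemma reduced_row_ex c d : coprimep c d -> exists c0 d0, reduced_row c d c0 d0.
Proof.
move=> cd; have [pc|pc] := boolP (p %| c).
  exists 0, 1; split; rewrite ?size_poly0 ?size_poly1 ?coprimep1 //.
  by rewrite mul0r mul1r sub0r dvdpNr.
have /bezout1[w [z e]] : coprimep c p by rewrite coprimep_sym irreducible_poly_coprime.
set x := (d * z) %% p.
have sx : (size x <= 3)%N.
  by have := ltn_modp (d * z) p; rewrite irredp_neq0 // p_size.
have px : p %| d - x * c.
  have xE : x = d * z - d * z %/ p * p by rewrite {1}(divp_eq (d * z) p) addrC addKr.
  have -> : d - x * c = (d * z %/ p * c - d * w) * p; last exact: dvdp_mull.
  transitivity (d * (c * z - w * p) - x * c); first by rewrite e mulr1.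
  by rewrite xE; ring.
have redP c0 d0 : p %| c0 * x - d0 -> p %| c0 * d - d0 * c.
  move=> h; have -> : c0 * d - d0 * c = c0 * (d - x * c) + (c0 * x - d0) * c by ring.
  by apply: dvdp_add; [apply: dvdp_mull | apply: dvdp_mulr].
have [sx2|sx2] := leqP (size x) 2.
  exists 1, x; split; rewrite ?size_poly1 ?coprime1p //.
  by apply: redP; rewrite mul1r subrr dvdp0.
have x0 : x != 0 by rewrite -size_poly_gt0 (leq_trans _ sx2).
have sx3 : size x = 3 by apply/eqP; rewrite eqn_leq sx sx2.
exists (p %/ x), (- (p %% x)).
have sq : size (p %/ x) = 2 by rewrite size_divp // p_size sx3.
split; rewrite ?size_polyN ?sq //.
- apply/coprimepP => r rq; rewrite dvdpNr => rr.
  have rp : r %| p by rewrite (divp_eq p x) dvdp_add // dvdp_mulr.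
  have [//|/eqp_size sr] := irredp_XsubCP p_irr rp.
  have := dvdp_leq _ rq; rewrite -size_poly_eq0 sq sr p_size.
  by move=> /(_ isT).
- by have := ltn_modp p x; rewrite x0 sx3.
by apply: redP; rewrite opprK -divp_eq.
Qed.

(** As c and d generate the unit ideal, it is enough that p divides the products of
    the determinant by c and by d. *)
Lemma row_cross c d c0 d0 c1 d1 : coprimep c d ->
  p %| c0 * d - d0 * c -> p %| c1 * d - d1 * c -> p %| c0 * d1 - c1 * d0.
Proof.
move=> cd p0 p1; set y := _ - _.
have pd : p %| y * d.
  have -> : y * d = (c0 * d - d0 * c) * d1 - (c1 * d - d1 * c) * d0 by rewrite /y; ring.
  by rewrite dvdp_sub // dvdp_mulr.
have pc : p %| y * c.
  have -> : y * c = (c0 * d - d0 * c) * c1 - (c1 * d - d1 * c) * c0 by rewrite /y; ring.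
  by rewrite dvdp_sub // dvdp_mulr.
have [[u v] /= e] := Bezout_eq1_coprimepP _ _ cd.
rewrite -[y]mulr1 -e mulrDr [u * c]mulrC [v * d]mulrC !mulrA.
by rewrite dvdp_add // dvdp_mulr.
Qed.

(** The cross product of two reduced rows of the same class has degree at most two
    and is divisible by p, hence vanishes. *)
Lemma reduced_row_uniq c d c0 d0 c1 d1 : coprimep c d ->
  reduced_row c d c0 d0 -> reduced_row c d c1 d1 ->
  exists2 u : F, u != 0 & c1 = u *: c0 /\ d1 = u *: d0.
Proof.
move=> cd [cop0 sc0 sd0 p0] [cop1 sc1 sd1 p1].
apply: coprime_cross => //; apply/eqP; rewrite -subr_eq0.
apply: contraTT (row_cross cd p0 p1) => y0; apply/negP => /(dvdp_leq y0).
rewrite p_size leqNgt => /negP[]; rewrite ltnS.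
have sm (f g : A) : (size f <= 2)%N -> (size g <= 2)%N -> (size (f * g)%R <= 3)%N.
  move=> sf sg; apply: leq_trans (size_polyMleq _ _) _.
  by rewrite (@leq_trans (2 + 2).-1) // -!subn1 leq_sub2r // leq_add.
by rewrite (leq_trans (size_polyD _ _)) // geq_max size_polyN !sm.
Qed.

Section Weight.
Variables (R : comNzRingType) (n : A).
Hypothesis n_size : size n = 2.

Definition lin_weight (x : A) : R := (x %= n)%:R.

Lemma lin_weightZ (u : F) x : u != 0 -> lin_weight (u *: x) = lin_weight x.
Proof. by move=> u0; rewrite /lin_weight (eqp_ltrans (eqp_scale x u0)). Qed.

(** On reduced rows this is the coboundary of lin_weight. It satisfies the two-term
    and three-term relations because the reduced rows of (c, d), (d, c) and
    (u c + d, c) can be chosen compatibly. *)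
Definition row_weight c d : R :=
  let r := xget (0, 0) [set r | reduced_row c d r.1 r.2]%classic in
  lin_weight r.2 - lin_weight r.1.

Lemma row_weightE c d c0 d0 : coprimep c d -> reduced_row c d c0 d0 ->
  row_weight c d = lin_weight d0 - lin_weight c0.
Proof.
move=> cd red; rewrite /row_weight; set r := xget _ _.
have red' : reduced_row c d r.1 r.2.
  exact: (@xgetPex _ _ [set r | reduced_row c d r.1 r.2]%classic
    (ex_intro _ (c0, d0) red)).
by have [u u0 [-> ->]] := reduced_row_uniq cd red' red; rewrite !lin_weightZ.
Qed.

Lemma row_weight_cong c d c' d' : coprimep c d -> coprimep c' d' ->
  p %| c' * d - d' * c -> row_weight c' d' = row_weight c d.
Proof.
move=> cd cd' pp; have [c0 [d0 red]] := reduced_row_ex cd.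
rewrite (row_weightE cd red); apply: row_weightE => //.
case: red => cop sc sd p0; split=> //.
rewrite [c' * _]mulrC in pp; rewrite [d0 * _]mulrC.
by apply: row_cross cd p0 _; rewrite [c' * _]mulrC.
Qed.

Lemma row_weightZ (u v : F) c d : u != 0 -> v != 0 -> coprimep c d ->
  row_weight (u *: c) (v *: d) = row_weight c d.
Proof.
move=> u0 v0 cd; have [c0 [d0 red]] := reduced_row_ex cd.
rewrite (row_weightE cd red) (@row_weightE _ _ (u *: c0) (v *: d0)).
- by rewrite !lin_weightZ.
- by rewrite coprimepZl // coprimepZr.
case: red => cop sc sd p0; split; rewrite ?size_scale //.
  by rewrite coprimepZl // coprimepZr.
suff -> : (u *: c0) * (v *: d) - (v *: d0) * (u *: c) =
    (u%:P * v%:P) * (c0 * d - d0 * c) by apply: dvdp_mull.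
by rewrite -!mul_polyC; ring.
Qed.

Lemma row_weight_sym c d : coprimep c d -> row_weight d c = - row_weight c d.
Proof.
move=> cd; have [c0 [d0 red]] := reduced_row_ex cd.
rewrite (row_weightE cd red) (@row_weightE _ _ d0 c0) ?opprB //.
  by rewrite coprimep_sym.
case: red => cop sc sd p0; split=> //; first by rewrite coprimep_sym.
by rewrite -dvdpNr opprB.
Qed.

Lemma row_weight_tri (u : F) d r : u != 0 -> coprimep d r ->
  row_weight (u *: d + r) d = row_weight (u *: d + r) r - row_weight d r.
Proof.
move=> u0 dr; have [d0 [r0 red]] := reduced_row_ex dr.
have addmul (x y : A) : coprimep x y -> coprimep (u *: x + y) x /\ coprimep (u *: x + y) y.
  move=> xy; split.
    by rewrite coprimep_sym -mul_polyC coprimep_addl_mul.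
  by rewrite coprimep_sym addrC -[X in X + _]mul1r coprimep_addl_mul coprimepZr // coprimep_sym.
have [cop1 cop2] := addmul _ _ dr.
have [cop d2 r2 p0] := red; have [cop1' cop2'] := addmul _ _ cop.
have s2 : (size (u *: d0 + r0)%R <= 2)%N.
  by rewrite (leq_trans (size_polyD _ _)) // geq_max size_scale // d2.
rewrite (row_weightE dr red) (@row_weightE _ _ (u *: d0 + r0) d0) //; last first.
  split=> //; rewrite -dvdpNr.
  suff -> : - ((u *: d0 + r0) * d - d0 * (u *: d + r)) = d0 * r - r0 * d by [].
  by rewrite -!mul_polyC; ring.
rewrite (@row_weightE _ _ (u *: d0 + r0) r0) //; last first.
  split=> //; suff -> : (u *: d0 + r0) * r - r0 * (u *: d + r) = u *: (d0 * r - r0 * d).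
    by rewrite dvdpZr.
  by rewrite -!mul_polyC; ring.
by ring.
Qed.

Lemma lin_weight1 : lin_weight 1 = 0.
Proof.
by rewrite /lin_weight; case: (boolP (1 %= n)) => // /eqp_size; rewrite size_poly1 n_size.
Qed.

(** The row weights depend only on classes modulo p, so the associated function on
    the projective line changes by constants under the congruence subgroup. *)
Lemma dual_form : exists l : {linear modsym p R -> R^o},
  forall m : A, size m = 2 -> l (symb p R (pt 1 m) (Some 0)) = (m %= n)%:R.
Proof.
pose h := cocycle row_weight.
have diff (g : 'M[A]_2) : g \in unitmx ->
    h (actA g None) - h (actA g (Some 0)) = row_weight (g 1 0) (g 1 1).
  by apply: cocycle_diff; [exact: row_weightZ | exact: row_weight_sym | exact: row_weight_tri].
have hG g : Gamma0 p g -> exists c, forall r, h (actA g r) = h r + c.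
  move=> Gg; have [ug pg] := andP Gg; exists (h (actA g None) - h None).
  apply: gl2_ind => [|k uk]; first by rewrite addrC subrK.
  have ugk : g *m k \in unitmx by rewrite unitmx_mul ug.
  have k0 := unitmx_det0 uk.
  move=> IH; have := diff _ ugk; rewrite !actAM // (row_weight_cong (unitmx_row uk)) //.
  - rewrite -diff // IH => /eqP; rewrite subr_eq => /eqP->.
    by rewrite addrA subrK.
  - exact: unitmx_row.
  rewrite !mulmx2E.
  have -> : (g 1 0 * k 0 0 + g 1 1 * k 1 0) * k 1 1 -
    (g 1 0 * k 0 1 + g 1 1 * k 1 1) * k 1 0 = g 1 0 * (k 0 0 * k 1 1 - k 0 1 * k 1 0) by ring.
  by rewrite dvdp_mulr.
have [l lE] := invariant_form hG; exists l => m sm; rewrite lE.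
have ug : mx2 0 1 1 m \in unitmx :> bool.
  apply/unitmx2P; exists (-1); first by rewrite oppr_eq0 oner_neq0.
  by rewrite !mxE /= mul0r sub0r mulr1 polyCN.
have := diff _ ug; rewrite actA_oo actA_0 !mxE /=.
have -> : pt 0 1 = Some 0 :> P1 {fraction A} by rewrite /pt oner_eq0 tofrac0 mul0r.
move=> ->; rewrite (@row_weightE _ _ 1 m) ?coprime1p //; last first.
  by split; rewrite ?coprime1p ?size_poly1 ?sm // mul1r mulr1 subrr dvdp0.
by rewrite lin_weight1 subr0.
Qed.
End Weight.
End ReducedRows.

(** * Manin symbols *)

Section Symbols.
Variables (F : finFieldType) (p : {poly F}) (R : comNzRingType).
Local Notation A := {poly F}.
Local Notation P1K := (P1 {fraction A}).
Local Notation symb := (symb p R).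

Lemma symbD (r s t : P1K) : symb r s + symb s t = symb r t.
Proof.
rewrite /Defs.symb -linearD; congr msclass; apply: val_inj => /=.
by rewrite addrC addrA subrK.
Qed.

Lemma symb_refl (r : P1K) : symb r r = 0.
Proof. by apply: (addrI (symb r r)); rewrite symbD addr0. Qed.

Lemma symbN (r s : P1K) : symb s r = - symb r s.
Proof. by apply/eqP; rewrite -addr_eq0 symbD symb_refl. Qed.

Lemma symb_act g (r s : P1K) : Gamma0 p g -> symb (actA g r) (actA g s) = symb r s.
Proof.
move=> Gg; rewrite /Defs.symb -[RHS](msclass_act _ Gg); congr msclass.
by apply: val_inj; rewrite /= linearB /= !pushforwardU.
Qed.

Lemma boundary_symb (r s : P1K) :
  boundary (symb r s) = << cusp p s >> - << cusp p r >>.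
Proof.
rewrite /boundary /Defs.symb [LHS](lquot_lift_pi (@boundary0_rel _ p R)).
transitivity (pushforward (cusp p) (<< s >> - << r >> : {freeg P1K / R})) => //.
by rewrite linearB /= !pushforwardU.
Qed.

(** In degree zero the point at infinity may be subtracted from every point. *)
Lemma symb_span (D : div0 R P1K) : D =
  \sum_(x <- dom (kernel_val D)) coeff x (kernel_val D) *: segment R None x.
Proof.
apply: val_inj; rewrite raddf_sum /=; case: D => D /= /eqP D0.
under eq_bigr => x _ do rewrite scalerBr.
rewrite sumrB -scaler_suml.
have -> : \sum_(x <- dom D) coeff x D = 0.
  transitivity (degree (\sum_(x <- dom D) << coeff x D *g x >>)).
    rewrite linear_sum.
    by apply: eq_bigr => x _ /=; rewrite degreeU.
  by rewrite freeg_sumE.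
rewrite scale0r subr0 -[LHS](freeg_sumE D).
by apply: eq_bigr => x _; rewrite freegZ mulr1.
Qed.

Definition manin (g : 'M[A]_2) := symb (actA g (Some 0)) (actA g None).

(** The lower left entry of k g^-1 is, up to a constant, the determinant of the two
    lower rows, so k g^-1 belongs to the congruence subgroup. *)
Lemma manin_cong (g k : 'M[A]_2) : g \in unitmx -> k \in unitmx ->
  p %| k 1 0 * g 1 1 - k 1 1 * g 1 0 -> manin k = manin g.
Proof.
move=> ug uk pkg; pose h := k *m invmx g.
have hg : h *m g = k by rewrite /h mulmxKV.
have Gh : Gamma0 p h.
  rewrite /Gamma0 /h unitmx_mul uk unitmx_inv ug /= -/h.
  have [u u0 du] := unitmx2P _ ug.
  have : p %| h 1 0 * u%:P.
    rewrite -du; move: pkg; rewrite -hg !mulmx2E; congr (_ %| _); ring.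
  by rewrite mulrC mul_polyC dvdpZr.
have dg := unitmx_det0 ug.
by rewrite /manin -hg !(actAM h _ dg) symb_act.
Qed.

Lemma manin_swap (g : 'M[A]_2) : manin (g *m swap_mx F) = - manin g.
Proof. by rewrite /manin !actA_swap symbN. Qed.

Lemma pt01 : pt 0 1 = Some 0 :> P1K.
Proof. by rewrite /pt oner_eq0 tofrac0 mul0r. Qed.

Lemma pt10 a : pt a 0 = None :> P1K.
Proof. by rewrite /pt eqxx. Qed.

Lemma Gamma0_upper (a b d : A) : a \is a GRing.unit -> d \is a GRing.unit ->
  Gamma0 p (mx2 a b 0 d).
Proof.
by move=> ua ud; rewrite /Gamma0 unitmxE det_mx2 !mxE /= dvdp0 mulr0 subr0 unitrM ua ud.
Qed.

Lemma symb_pt_scale (u : F) (b m : A) : u != 0 -> (b != 0) || (m != 0) ->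
  symb (pt (u *: b) m) (Some 0) = symb (pt b m) (Some 0).
Proof.
move=> u0 bm; have uu : u%:P \is a GRing.unit by apply/unit_polyP; exists u.
have G := Gamma0_upper 0 uu (unitr1 _).
rewrite -[RHS](symb_act _ _ G) actA_pt // -pt01 actA_pt ?oner_neq0 ?orbT //.
by rewrite !mxE /= !mul0r !mulr0 !mul1r !add0r !addr0 mul_polyC.
Qed.

Lemma symb_inv_scale (u : F) (m : A) : u != 0 ->
  symb (pt 1 (u *: m)) (Some 0) = symb (pt 1 m) (Some 0).
Proof.
move=> u0; rewrite -(symb_pt_scale u0) ?oner_neq0 //.
by congr symb; rewrite -!mul_polyC pt_mull // polyC_eq0.
Qed.

Lemma symb_shift (b c : A) : c \is a GRing.unit ->
  symb (pt b c) None = symb (Some 0) None.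
Proof.
move=> /unit_polyP[u u0 ->].
(* The translation by b / c is integral, as c is a constant. *)
have G := Gamma0_upper (u^-1 *: b) (unitr1 _) (unitr1 _).
rewrite -[RHS](symb_act _ _ G) -pt01 actA_pt ?oner_neq0 ?orbT // actA_oo.
rewrite !mxE /= !mulr0 mulr1 !add0r pt10 mulr1 -[pt _ 1](@pt_mull _ u%:P).
  by rewrite mulr1 mul_polyC scalerA mulfV // scale1r.
by rewrite polyC_eq0.
Qed.
End Symbols.

(** * A basis of the parabolic symbols in degree three *)

Section Cusps.
Variables (F : finFieldType) (p : {poly F}).
Local Notation A := {poly F}.

Lemma cusp_pt (b m : A) : coprimep b m -> coprimep m p ->
  cusp p (pt b m) = cusp p (Some 0).
Proof.
move=> bm mp; have /bezout1[c [a e]] : coprimep m (b * p).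
  by rewrite coprimepMr coprimep_sym bm.
have G : Gamma0 p (mx2 a b (c * p) m).
  rewrite /Gamma0 !mxE /= dvdp_mulIr andbT; apply/unitmx2P.
  exists 1; rewrite ?oner_neq0 // !mxE /= polyC1 -e; ring.
by rewrite -[RHS](cusp_act _ G) actA_0 !mxE.
Qed.

(** A matrix of the congruence subgroup sending zero to infinity would have its
    determinant divisible by p. *)
Lemma cusp_oo_neq0 : (1 < size p)%N -> cusp p None <> cusp p (Some 0).
Proof.
move=> sp e; have : cusp p (Some 0) None.
  by rewrite -e; exists 1%:M; [exact: Gamma0_1 | exact: actA1].
case=> g Gg; rewrite actA_0 /pt; case: eqP => // g11 _.
have [ug pg] := andP Gg; have [u u0 du] := unitmx2P _ ug.
have : p %| u%:P by rewrite -du g11 mulr0 sub0r dvdpNr dvdp_mull.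
by move/dvdp_leq; rewrite polyC_eq0 => /(_ u0); rewrite size_polyC u0 leqNgt sp.
Qed.
End Cusps.

Section Basis.
Variables (F : finFieldType) (p : {poly F}) (R : comNzRingType).
Hypotheses (p_irr : irreducible_poly p) (p_size : size p = 4).
Local Notation A := {poly F}.
Local Notation P1K := (P1 {fraction A}).
Local Notation symb := (symb p R).

Definition inv_symb (m : A) := symb (pt 1 m) (Some 0).

Definition in_span (x : modsym p R) : Prop :=
  exists (a : R) (c : deg1 F -> R),
    x = a *: symb (Some 0) None + \sum_n c n *: inv_symb (deg1_gen n).

Lemma in_spanP a x y : in_span x -> in_span y -> in_span (a *: x + y).
Proof.
move=> [b [c ->]] [b' [c' ->]]; exists (a * b + b'), (fun n => a * c n + c' n).
rewrite scalerDr scaler_sumr addrACA scalerA -scalerDl -big_split /=.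
by congr (_ + _); apply: eq_bigr => n _; rewrite scalerDl scalerA.
Qed.

Lemma in_span0 : in_span 0.
Proof.
by exists 0, (fun=> 0); rewrite scale0r add0r big1 // => n _; rewrite scale0r.
Qed.

Lemma in_spanD x y : in_span x -> in_span y -> in_span (x + y).
Proof. by rewrite -{2}[x]scale1r; apply: in_spanP. Qed.

Lemma in_spanN x : in_span x -> in_span (- x).
Proof. by move=> sx; rewrite -[- x]addr0 -scaleN1r; apply: in_spanP in_span0. Qed.

Lemma in_span_0oo : in_span (symb (Some 0) None).
Proof.
exists 1, (fun=> 0); rewrite scale1r big1 ?addr0 // => n _.
by rewrite scale0r.
Qed.

Lemma deg1_gen_monic (n : deg1 F) : deg1_gen n \is monic.
Proof. by have /andP[] := valP n. Qed.

Lemma deg1_gen_size (n : deg1 F) : size (deg1_gen n) = 2.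
Proof. by have /andP[_ /eqP] := valP n. Qed.

Lemma deg1_gen_ex (m : A) : m \is monic -> size m = 2 ->
  exists n : deg1 F, deg1_gen n = m.
Proof.
move=> mm sm.
have sn : (size m <= 2)%N by rewrite sm.
have ok : ((npolyp 2 m : A) \is monic) && (size (npolyp 2 m : A) == 2).
  by rewrite npolypK // mm sm eqxx.
exists (exist (fun n : {poly_2 F} => ((n : A) \is monic) && (size n == 2)) _ ok).
by rewrite /deg1_gen /= npolypK.
Qed.

Lemma inv_symb_in (m : A) : m != 0 -> (size m <= 2)%N -> in_span (inv_symb m).
Proof.
move=> m0; rewrite leq_eqVlt => /orP[/eqP sm|].
  have l0 : lead_coef m != 0 by rewrite lead_coef_eq0.
  have [||n nE] := @deg1_gen_ex ((lead_coef m)^-1 *: m).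
  - by rewrite monicE lead_coefZ mulVf.
  - by rewrite size_scale ?invr_eq0.
  exists 0, (fun k => (k == n)%:R); rewrite scale0r add0r (bigD1 n) //= eqxx scale1r.
  rewrite big1 ?addr0 => [|k /negPf->]; last by rewrite scale0r.
  by rewrite nE /inv_symb symb_inv_scale // invr_eq0.
rewrite ltnS => sm; have -> : inv_symb m = 0; last exact: in_span0.
have um : m \is a GRing.unit.
  apply/unit_polyP; exists m`_0; last exact: size1_polyC.
  by rewrite -polyC_eq0 -size1_polyC.
by rewrite /inv_symb -(symbD _ _ _ None) symb_shift // symbD symb_refl.
Qed.

(** After scaling the lower row is (0, 1), (1, 0) or (1, m), which gives respectively
    the symbol [0, oo], its opposite and [1 / m, 0]. *)
Lemma manin_const_in (g : 'M[A]_2) : g \in unitmx ->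
  (size (g 1 0)%R <= 1)%N -> (size (g 1 1)%R <= 2)%N -> in_span (manin p R g).
Proof.
move=> ug sc sd; have [c0|c0] := eqVneq (g 1 0) 0.
  rewrite -(manin_cong _ ug (unitmx1 _ _)); last by rewrite c0 !mxE /= mul0r mulr0 subrr dvdp0.
  by rewrite /manin !actA1; exact: in_span_0oo.
have [d0|d0] := eqVneq (g 1 1) 0.
  rewrite -(manin_cong _ ug (swap_unit _)); last by rewrite d0 !mxE /= mul0r mulr0 subrr dvdp0.
  rewrite -[swap_mx F]mul1mx manin_swap; apply: in_spanN.
  by rewrite /manin !actA1; exact: in_span_0oo.
have cE := size1_polyC sc; set u := (g 1 0)`_0 in cE.
have u0 : u != 0 by rewrite -polyC_eq0 -cE.
have uk : mx2 0 1 1 (u^-1 *: g 1 1) \in unitmx :> bool.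
  apply/unitmx2P; exists (-1); first by rewrite oppr_eq0 oner_neq0.
  by rewrite !mxE /= mul0r mulr1 sub0r polyCN.
rewrite -(manin_cong _ ug uk); last first.
  rewrite !mxE /= mul1r cE [_ * u%:P]mulrC mul_polyC scalerA mulfV // scale1r subrr.
  exact: dvdp0.
rewrite /manin actA_0 actA_oo !mxE /= pt01; apply: inv_symb_in.
  by rewrite scaler_eq0 negb_or invr_eq0 u0.
by rewrite size_scale ?invr_eq0.
Qed.

(** Two entries of degree one differ, up to a constant factor, by a constant r: a
    third point then cuts the symbol into two symbols with a constant entry r. *)
Lemma manin_small_in (g : 'M[A]_2) : g \in unitmx ->
  (size (g 1 0)%R <= 2)%N -> (size (g 1 1)%R <= 2)%N -> in_span (manin p R g).
Proof.
move=> ug; rewrite leq_eqVlt => /orP[/eqP sc|]; last exact: manin_const_in.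
have swapE h : in_span (manin p R (h *m swap_mx F)) -> in_span (manin p R h).
  by rewrite manin_swap => /in_spanN; rewrite opprK.
rewrite leq_eqVlt => /orP[/eqP sd|sd]; last first.
  apply: swapE; apply: manin_const_in; rewrite ?mul_swapE ?sc //.
  by rewrite unitmx_mul ug swap_unit.
have c0 : g 1 0 != 0 by rewrite -size_poly_gt0 sc.
have [l l0 [r [sr dE]]] : exists2 l : F, l != 0 & exists r : A,
    (size r <= 1)%N /\ g 1 1 = l *: g 1 0 + r.
  have : size (g 1 1 %/ g 1 0) == 1%N by rewrite size_divp // sd sc.
  move=> /size_poly1P[l l0 e]; exists l => //; exists (g 1 1 %% g 1 0); split.
    by have := ltn_modp (g 1 1) (g 1 0); rewrite c0 sc.
  by rewrite -mul_polyC -e -divp_eq.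
pose g' := g *m shear_mx (- l%:P).
have ug' : g' \in unitmx by rewrite unitmx_mul ug shear_unit.
have g'10 : g' 1 0 = g 1 0 by rewrite mul_shearE.
have g'11 : g' 1 1 = r by rewrite mul_shearE dE mulrN mulrC mul_polyC addKr.
(* The path from g 0 to g oo is cut at g' 0. *)
pose k := mx2 (g' 0 1) (g 0 1) (g' 1 1) (g 1 1).
have kE : (k 0 0 = g' 0 1) * (k 0 1 = g 0 1) * (k 1 0 = g' 1 1) * (k 1 1 = g 1 1).
  by rewrite /k !mxE.
have uk : k \in unitmx.
  have [u u0 du] := unitmx2P _ ug; apply/unitmx2P; exists (- l * u).
    by rewrite mulf_neq0 ?oppr_eq0.
  rewrite !kE /g' !mul_shearE polyCM -du polyCN; ring.
have -> : manin p R g = manin p R k + manin p R g'.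
  rewrite /manin [actA k _]actA_0 [actA k _]actA_oo [actA g' _]actA_0.
  rewrite [actA g' None]actA_oo !kE symbD actA_0 actA_oo.
  by rewrite /g' !mul_shearE.
apply: in_spanD.
  by apply: manin_const_in; rewrite // !kE ?g'11 // sd.
apply: swapE; apply: manin_const_in; rewrite ?mul_swapE ?g'11 ?g'10 ?sc //.
by rewrite unitmx_mul ug' swap_unit.
Qed.

Lemma manin_in (g : 'M[A]_2) : g \in unitmx -> in_span (manin p R g).
Proof.
move=> ug; have [c0 [d0 [cop sc sd p0]]] := reduced_row_ex p_irr p_size (unitmx_row ug).
have [k uk [k10 k11]] := complete_row cop.
rewrite -(manin_cong _ ug uk) ?k10 ?k11 //.
by apply: manin_small_in; rewrite ?k10 ?k11.
Qed.

Lemma symb_in r : in_span (symb None r).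
Proof.
move: r; apply: gl2_ind => [|g ug IH]; first by rewrite symb_refl; exact: in_span0.
by rewrite -(symbD _ _ _ (actA g (Some 0))); apply/in_spanD/manin_in.
Qed.

(** Every symbol is a sum of Manin symbols, and the class modulo p of a lower row
    contains a reduced row. *)
Lemma modsym_in x : in_span x.
Proof.
have -> : x = msclass p (lquot_repr x) by rewrite /msclass lquot_reprK.
rewrite (symb_span (lquot_repr x)) linear_sum.
elim: (dom _) => [|y s IH]; first by rewrite big_nil; exact: in_span0.
by rewrite big_cons linearZ; apply: in_spanP => //; exact: symb_in.
Qed.

Lemma deg1_gen_coprime n : coprimep (deg1_gen n) p.
Proof.
by rewrite coprimep_sym (coprimep_small p_irr p_size) ?monic_neq0 ?deg1_gen_monic ?deg1_gen_size.
Qed.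

Fact inv_symb0_subproof n :
  in_kernel (@boundary _ p R) (inv_symb (deg1_gen n)).
Proof.
rewrite /in_kernel /= /inv_symb boundary_symb cusp_pt ?coprime1p ?subrr //.
exact: deg1_gen_coprime.
Qed.

Definition inv_symb0 n : modsym0 p R := Kernel (inv_symb0_subproof n).

(** The cusps zero and infinity are inequivalent, so the boundary map detects the
    coefficient of [0, oo]. *)
Lemma inv_symb0_span (x : modsym0 p R) :
  exists c : deg1 F -> R, x = \sum_n c n *: inv_symb0 n.
Proof.
have [a [c xE]] := modsym_in (val x); exists c; apply: val_inj.
rewrite raddf_sum /=; suff a0 : a = 0 by rewrite xE a0 scale0r add0r.
have : boundary (val x) = 0 by case: x {xE} => x /= /eqP.
rewrite xE linearD linear_sum big1 => [|n _]; last first.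
  by rewrite linearZ /= (eqP (inv_symb0_subproof n)) scaler0.
rewrite addr0 linearZ /= boundary_symb => /(congr1 (coeff (cusp p None))).
rewrite coeffZ coeffB !coeffU eqxx coeff0 !mul1r.
case: eqP => [/esym/cusp_oo_neq0|]; first by rewrite p_size => /(_ isT).
by rewrite subr0 mulr1.
Qed.

Lemma inv_symb0_free (c c' : deg1 F -> R) :
  \sum_n c n *: inv_symb0 n = \sum_n c' n *: inv_symb0 n -> c =1 c'.
Proof.
move=> e k; have [l lE] := @dual_form _ _ p_irr p_size R _ (deg1_gen_size k).
have lS (b : deg1 F -> R) : l (val (\sum_n b n *: inv_symb0 n)) = b k.
  rewrite raddf_sum linear_sum (bigD1 k) //= linearZ /= lE ?deg1_gen_size // eqpxx.
  rewrite [_ *: _]mulr1 big1 ?addr0 // => n nk.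
  rewrite linearZ /= lE ?deg1_gen_size // eqp_monic ?deg1_gen_monic //.
  rewrite -[deg1_gen n == _]/(val (val n) == val (val k)) !val_eqE (negPf nk).
  exact: mulr0.
by rewrite -[LHS]lS e lS.
Qed.
End Basis.

(** * Sums over residues and over divisors *)

Section ResidueSums.
Variables (F : finFieldType) (W : nmodType).
Local Notation A := {poly F}.

(** Polynomials of degree less than that of d represent the residues modulo d. *)
Definition residue_sum (d : A) (phi : A -> W) : W :=
  \sum_(b : {poly_((size d).-1) F}) phi b.

Lemma size_residue (d : A) (b : {poly_((size d).-1) F}) : d != 0 ->
  (size (b : A) < size d)%N.
Proof.
move=> d0; apply: leq_ltn_trans (size_npoly b) _.
by rewrite prednK ?size_poly_gt0.
Qed.

Lemma eq_residue_sum (d : A) (phi psi : A -> W) : phi =1 psi ->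
  residue_sum d phi = residue_sum d psi.
Proof. by move=> e; apply: eq_bigr => b _. Qed.

Lemma residue_sum_const (d : A) (w : W) :
  residue_sum d (fun=> w) = w *+ #|F| ^ (size d).-1.
Proof. by rewrite /residue_sum sumr_const card_npoly. Qed.

Lemma exchange_residue_sum (d d' : A) (phi : A -> A -> W) :
  residue_sum d (fun b => residue_sum d' (phi b)) =
  residue_sum d' (fun c => residue_sum d (phi^~ c)).
Proof. exact: exchange_big. Qed.

Definition periodic (d : A) (phi : A -> W) := forall x y, phi (x + d * y) = phi x.

Lemma periodic_mod d phi x : periodic d phi -> phi (x %% d) = phi x.
Proof. by move=> per; rewrite [in RHS](divp_eq x d) addrC mulrC per. Qed.

(** An affine map with slope prime to d permutes the residues. *)
Lemma residue_sum_affine (d u v : A) (phi : A -> W) :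
  d != 0 -> coprimep u d -> periodic d phi ->
  residue_sum d (fun b => phi (u * b + v)) = residue_sum d phi.
Proof.
move=> d0 ud per; have sz (x : A) : (size (x %% d)%R <= (size d).-1)%N.
  by rewrite -ltnS prednK ?size_poly_gt0 // ltn_modp.
pose h (b : {poly_((size d).-1) F}) := npolyp (size d).-1 ((u * b + v) %% d).
have hE b : (h b : A) = (u * b + v) %% d by rewrite npolypK.
rewrite /residue_sum [RHS](@reindex_inj _ _ _ _ h) /=.
  by apply: eq_bigr => b _; rewrite hE (periodic_mod _ per).
move=> b b' /(congr1 (@polyn _ _)); rewrite !hE => /eqP e; apply: val_inj => /=.
have : d %| u * (b - b' : A).
  rewrite /dvdp; move: e; rewrite -subr_eq0 -modpN -modpD.
  by rewrite opprD addrACA subrr addr0 -mulrBr.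
rewrite Gauss_dvdpr; last by rewrite coprimep_sym.
move=> dv; apply/eqP; rewrite -subr_eq0; apply: contraTT dv => bb.
apply/negP => /(dvdp_leq bb); rewrite leqNgt => /negP[].
by rewrite (leq_ltn_trans (size_polyD _ _)) // size_polyN gtn_max !size_residue.
Qed.

(** Euclidean division by d. *)
Lemma residue_sum_mul (l d : A) (phi : A -> W) : l != 0 -> d != 0 ->
  residue_sum (l * d) phi =
  residue_sum l (fun c => residue_sum d (fun b => phi (b + c * d))).
Proof.
move=> l0 d0; rewrite /residue_sum pair_bigA /=.
have ld0 : l * d != 0 by rewrite mulf_neq0.
have sd : (size d).-1.+1 = size d by rewrite prednK ?size_poly_gt0.
have sl : (size l).-1.+1 = size l by rewrite prednK ?size_poly_gt0.
have sld : size (l * d) = ((size l).-1 + size d)%N.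
  by rewrite size_mul // -{1}sl.
have sld' : (size (l * d)).-1.+1 = size (l * d) by rewrite prednK ?size_poly_gt0.
pose h (t : {poly_((size l).-1) F} * {poly_((size d).-1) F}) :=
  npolyp (size (l * d)).-1 ((t.2 : A) + (t.1 : A) * d).
pose k (x : {poly_((size (l * d)).-1) F}) :=
  (npolyp (size l).-1 (x %/ d), npolyp (size d).-1 (x %% d)).
have hE t : (h t : A) = (t.2 : A) + (t.1 : A) * d.
  rewrite npolypK // -ltnS sld'; apply: leq_ltn_trans (size_polyD _ _) _.
  rewrite gtn_max; apply/andP; split.
    by rewrite (leq_trans (size_residue _ d0)) // sld leq_addl.
  have [->|t0] := eqVneq (t.1 : A) 0; first by rewrite mul0r size_poly0 size_poly_gt0.
  rewrite size_mul // sld.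
  apply: (@leq_trans (size (t.1 : A) + size d)).
    by rewrite prednK // addn_gt0 !size_poly_gt0 d0 orbT.
  by rewrite leq_add2r size_npoly.
rewrite (reindex h) /=; first by apply: eq_bigr => t _; rewrite hE.
exists k => [t _|x _].
  have sb := size_residue t.2 d0.
  rewrite /k hE; case: t sb => c b /= sb; congr pair; apply: val_inj => /=.
    rewrite addrC divp_addl_mul // divp_small // addr0 npolypK // size_npoly //.
  by rewrite modpD modp_mull addr0 modp_small // npolypK // size_npoly.
have sm : (size (x %% d)%R <= (size d).-1)%N by rewrite -ltnS sd ltn_modp.
have sq : (size (x %/ d)%R <= (size l).-1)%N.
  have sx := size_npoly x; rewrite size_divp // leq_subLR; apply: leq_trans sx _.
  by rewrite sld -{1}sd addnS /= addnC.
by apply: val_inj; rewrite [LHS]hE /= !npolypK // addrC -divp_eq.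
Qed.
End ResidueSums.

Section DivisorSums.
Variables (F : finFieldType) (W : nmodType).
Local Notation A := {poly F}.

Definition divisor_sum (m : A) (f : A -> W) : W :=
  \sum_(d : {poly_(size m) F} | ((d : A) \is monic) && ((d : A) %| m)) f d.

Lemma eq_divisor_sum m (f g : A -> W) :
  (forall d, d \is monic -> d %| m -> f d = g d) ->
  divisor_sum m f = divisor_sum m g.
Proof. by move=> e; apply: eq_bigr => d /andP[md dm]; apply: e. Qed.

Lemma divisor_sumD m (f g : A -> W) :
  divisor_sum m (fun d => f d + g d) = divisor_sum m f + divisor_sum m g.
Proof. exact: big_split. Qed.

(** The divisors of m that are multiples of l are the products of l by the divisors
    of m with cofactor divisible by l. *)
Lemma divisor_sum_shift (l m : A) (f : A -> W) : l \is monic -> m != 0 ->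
  divisor_sum m (fun d => if l %| d then f d else 0) =
  divisor_sum m (fun d => if l %| m %/ d then f (l * d) else 0).
Proof.
move=> ml m0; rewrite /divisor_sum -!big_mkcondr /=.
have l0 := monic_neq0 ml.
have sz (d : A) : d %| m -> (size d <= size m)%N by apply: dvdp_leq.
have equiv (d : A) : d \is monic -> (l * d %| m) = (d %| m) && (l %| m %/ d).
  move=> md; have d0 := monic_neq0 md; apply/idP/andP => [ldm|[dm lm]].
    have dm : d %| m by rewrite (dvdp_trans _ ldm) // dvdp_mull.
    by split=> //; move: ldm; rewrite -{1}(divpK dm) dvdp_mul2r.
  by rewrite -(divpK dm) dvdp_mul2r.
pose h (d : {poly_(size m) F}) := npolyp (size m) (l * d).
pose k (d : {poly_(size m) F}) := npolyp (size m) (d %/ l).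
have kE (d : {poly_(size m) F}) : (k d : A) = d %/ l.
  by rewrite npolypK // (leq_trans (leq_divp _ _)) // size_npoly.
have hE (d : {poly_(size m) F}) : l * d %| m -> (h d : A) = l * d.
  by move=> /sz s; rewrite npolypK.
have hkE (d : {poly_(size m) F}) : l %| (h d : A) -> k (h d) = d -> (h d : A) = l * d.
  by move=> ld kd; rewrite -[in RHS]kd kE mulrC divpK.
rewrite (reindex_onto h k) /=.
  apply: eq_big => [d|d /andP[/andP[/andP[md dm] ld] /eqP kd]]; last first.
    by rewrite hkE.
  apply/andP/andP => [[/andP[/andP[md dm] ld] /eqP kd]|[/andP[md dm] ld]].
    have hd := hkE d ld kd.
    by rewrite hd monicMl // in md; rewrite hd equiv // in dm; have /andP[-> ->] := dm; rewrite md.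
  have hd : (h d : A) = l * d by rewrite hE // equiv // dm.
  rewrite hd monicMl // md dvdp_mulIl equiv // dm ld; split=> //.
  by apply/eqP/val_inj; rewrite [LHS]kE hd mulKp.
move=> d /andP[/andP[md dm] ld]; apply: val_inj => /=.
by rewrite npolypK kE ?[l * _]mulrC ?divpK // sz.
Qed.

Section Commutation.
Variable Psi : A -> A -> A -> W.
Hypothesis Psi_per : forall a b d y : A, a != 0 -> d != 0 ->
  Psi a (b + d * y) d = Psi a b d.
Hypothesis Psi_scale : forall k a b d : A, k != 0 -> a != 0 -> d != 0 ->
  Psi (k * a) (k * b) (k * d) = Psi a b d.

(** The two sides list the products of a triangular matrix of determinant n
    with one of determinant l, in the two orders, up to multiplication by
    unipotent and scalar matrices. They agree term by term unless l divides
    both factors, in which case the repeated scalar cosets match in pairs. *)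
Lemma hecke_sums_commute (l n : A) : irreducible_poly l -> l \is monic -> n != 0 ->
  divisor_sum n (fun d => residue_sum d (fun b => Psi (l * (n %/ d)) (l * b) d) +
    residue_sum d (fun b => residue_sum l (fun c => Psi (n %/ d) (b + c * d) (l * d)))) =
  divisor_sum n (fun d => residue_sum d (fun b => Psi (l * (n %/ d)) b d) +
    residue_sum d (fun b => residue_sum l (fun c => Psi (n %/ d) (c * (n %/ d) + l * b) (l * d)))).
Proof.
move=> irl ml n0; have l0 := monic_neq0 ml.
(* N is the number of residues modulo l. *)
pose N := (#|F| ^ (size l).-1)%N.
pose G (a d : A) := residue_sum d (fun b => Psi a b d).
have per a d : a != 0 -> d != 0 -> periodic d (fun b => Psi a b d).
  by move=> a0 d0 x y; apply: Psi_per.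
have a_n0 d : d %| n -> n %/ d != 0 by move=> dn; rewrite dvdp_div_eq0.
have d_n0 d : d %| n -> d != 0 by move=> dn; apply: contraTneq dn => ->; rewrite dvd0p.
rewrite !divisor_sumD.
(* When l divides d, the matrix is l times a matrix with lower entry d / l, and
   each residue modulo d / l occurs N times. *)
have -> : divisor_sum n (fun d => residue_sum d (fun b => Psi (l * (n %/ d)) (l * b) d)) =
    divisor_sum n (fun d => if l %| d then 0 else G (l * (n %/ d)) d) +
    divisor_sum n (fun d => if l %| d then G (n %/ d) (d %/ l) *+ N else 0).
  rewrite -divisor_sumD; apply: eq_divisor_sum => d md dn.
  have a0 := a_n0 _ dn; have d0 := monic_neq0 md.
  case: ifP => ld; rewrite ?addr0 ?add0r; last first.
    rewrite /G -[RHS](@residue_sum_affine _ _ d l 0) //; last first.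
    - by apply: per; rewrite // mulf_neq0.
    - by rewrite irreducible_poly_coprime // ld.
    by apply: eq_residue_sum => b; rewrite addr0.
  have [d' dE] := dvdpP _ _ ld; have d'0 : d' != 0.
    by apply: contraNneq d0 => d'0; rewrite dE d'0 mul0r.
  set a := n %/ d in a0 *; rewrite dE mulpK // [d' * l]mulrC residue_sum_mul //.
  rewrite -residue_sum_const; apply: eq_residue_sum => c.
  by apply: eq_residue_sum => b; rewrite Psi_scale // [c * _]mulrC Psi_per.
have -> : divisor_sum n (fun d => residue_sum d (fun b =>
      residue_sum l (fun c => Psi (n %/ d) (b + c * d) (l * d)))) =
    divisor_sum n (fun d => G (n %/ d) (l * d)).
  apply: eq_divisor_sum => d md dn; rewrite exchange_residue_sum /G.
  by rewrite [RHS]residue_sum_mul // d_n0.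
(* When l does not divide a = n / d, the entries c a + l b run over all residues
   modulo l d; otherwise the matrix is again l times a smaller one. *)
have -> : divisor_sum n (fun d => residue_sum d (fun b =>
      residue_sum l (fun c => Psi (n %/ d) (c * (n %/ d) + l * b) (l * d)))) =
    divisor_sum n (fun d => if l %| n %/ d then 0 else G (n %/ d) (l * d)) +
    divisor_sum n (fun d => if l %| n %/ d then G (n %/ d %/ l) d *+ N else 0).
  rewrite -divisor_sumD; apply: eq_divisor_sum => d md dn.
  have a0 := a_n0 _ dn; have d0 := monic_neq0 md.
  set a := n %/ d in a0 *; have ld0 : l * d != 0 by rewrite mulf_neq0.
  have pera := per a (l * d) a0 ld0.
  case: ifP => la; rewrite ?addr0 ?add0r; last first.
    have al : coprimep a l.
      by rewrite coprimep_sym irreducible_poly_coprime // la.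
    rewrite /G mulrC [RHS]residue_sum_mul //.
    apply: etrans (exchange_residue_sum _ _ _) _.
    rewrite [RHS]exchange_residue_sum.
    rewrite -[RHS](@residue_sum_affine _ _ l a 0) //; last first.
      move=> x y; rewrite -[RHS](@residue_sum_affine _ _ d 1 y) ?coprime1p //.
        apply: eq_residue_sum => b; congr Psi; ring.
      move=> x' y'; rewrite -[RHS](@Psi_per a _ _ y') ?mulf_neq0 //.
      by congr Psi; ring.
    apply: eq_residue_sum => c; apply: eq_residue_sum => b.
    by rewrite [d * l]mulrC; congr Psi; ring.
  have [a' aE] := dvdpP _ _ la; have a'0 : a' != 0.
    by apply: contraNneq a0 => a'0; rewrite aE a'0 mul0r.
  rewrite aE mulpK // exchange_residue_sum -residue_sum_const.
  apply: eq_residue_sum => c.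
  rewrite /G -(residue_sum_affine (c * a') d0 (coprime1p _) (per _ _ a'0 d0)).
  apply: eq_residue_sum => b; rewrite -[RHS](Psi_scale _ l0) // mulrC.
  by congr Psi; ring.
have -> : divisor_sum n (fun d => G (n %/ d) (l * d)) =
    divisor_sum n (fun d => if l %| n %/ d then 0 else G (n %/ d) (l * d)) +
    divisor_sum n (fun d => if l %| n %/ d then G (n %/ d) (l * d) else 0).
  rewrite -divisor_sumD; apply: eq_divisor_sum => d md dn.
  by case: ifP; rewrite ?addr0 ?add0r.
have -> : divisor_sum n (fun d => residue_sum d (fun b => Psi (l * (n %/ d)) b d)) =
    divisor_sum n (fun d => if l %| d then 0 else G (l * (n %/ d)) d) +
    divisor_sum n (fun d => if l %| d then G (l * (n %/ d)) d else 0).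
  rewrite -divisor_sumD; apply: eq_divisor_sum => d md dn.
  by case: ifP; rewrite ?addr0 ?add0r.
rewrite (divisor_sum_shift (fun d => G (n %/ d) (d %/ l) *+ N)) //.
rewrite (divisor_sum_shift (fun d => G (l * (n %/ d)) d)) //.
have divE d : d \is monic -> d %| n -> n %/ (l * d) = n %/ d %/ l.
  by move=> md dn; rewrite divp_divl mulrC.
have -> : divisor_sum n (fun d => if l %| n %/ d then
      G (n %/ (l * d)) (l * d %/ l) *+ N else 0) =
    divisor_sum n (fun d => if l %| n %/ d then G (n %/ d %/ l) d *+ N else 0).
  apply: eq_divisor_sum => d md dn; case: ifP => // _.
  by rewrite divE // mulKp.
have -> : divisor_sum n (fun d => if l %| n %/ d then
      G (l * (n %/ (l * d))) (l * d) else 0) =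
    divisor_sum n (fun d => if l %| n %/ d then G (n %/ d) (l * d) else 0).
  apply: eq_divisor_sum => d md dn; case: ifP => // la.
  by rewrite divE // [l * (_ %/ l)]mulrC divpK.
by rewrite addrACA [X in _ + X = _]addrC addrACA.
Qed.
End Commutation.
End DivisorSums.

(** * Hecke operators as sums over divisors and residues *)

Section HeckeSums.
Variables (F : finFieldType) (p : {poly F}).
Local Notation A := {poly F}.

Definition monic_gen (m : A) : A := (lead_coef m)^-1 *: m.

Lemma monic_gen_monic m : m != 0 -> monic_gen m \is monic.
Proof. by move=> m0; rewrite monicE lead_coefZ mulVf // lead_coef_eq0. Qed.

Lemma monic_gen_eqp m : m != 0 -> monic_gen m %= m.
Proof. by move=> m0; rewrite eqp_scale // invr_eq0 lead_coef_eq0. Qed.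

Lemma monic_gen_size m : size (monic_gen m) = size m.
Proof.
have [->|m0] := eqVneq m 0; first by rewrite /monic_gen scaler0.
by rewrite size_scale // invr_eq0 lead_coef_eq0.
Qed.

(** Bounded polynomials of different bounds are different types; this moves a sum
    from one to another. *)
Lemma npoly_sum_resize (W : nmodType) (n k : nat) (P : pred A) (phi : A -> W) :
  (forall b, P b -> (size b <= n)%N && (size b <= k)%N) ->
  \sum_(b : {poly_n F} | P b) phi b = \sum_(b : {poly_k F} | P b) phi b.
Proof.
move=> sP; have toK (b : A) : P b -> (npolyp k b : A) = b.
  by move=> /sP /andP[_ ?]; rewrite npolypK.
have toN (b : A) : P b -> (npolyp n b : A) = b.
  by move=> /sP /andP[? _]; rewrite npolypK.
rewrite (reindex_onto (fun b : {poly_k F} => npolyp n b)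
  (fun b : {poly_n F} => npolyp k b)) /= => [|b Pb]; last first.
  by apply: val_inj => /=; rewrite toN ?toK.
apply: eq_big => [b|b /andP[Pb /eqP bE]].
  apply/andP/idP => [[Pb /eqP bE]|Pb]; last first.
    by rewrite toN // Pb; split=> //; apply/eqP/val_inj; rewrite /= toK.
  by rewrite -bE toK.
by rewrite -{2}bE toK.
Qed.

(** A triangular matrix of the Hecke set of m is determined by its lower right entry
    d, a monic divisor of m, and by a residue modulo d. *)
Lemma hecke_sumE (W : nmodType) (m : A) (Phi : A -> A -> A -> W) :
    m != 0 -> coprimep m p ->
  \sum_(t in hecke_set p m) Phi t.1.1 t.1.2 t.2 =
  divisor_sum (monic_gen m) (fun d =>
    residue_sum d (fun b => Phi (monic_gen m %/ d) b d)).
Proof.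
move=> m0 mp; set m' := monic_gen m; have m'm : m' \is monic := monic_gen_monic m0.
have m'e : m' %= m := monic_gen_eqp m0; have sm' : size m' = size m := monic_gen_size m.
have m'0 := monic_neq0 m'm.
have inner (d : A) (phi : A -> W) : d != 0 -> (size d <= size m)%N ->
    residue_sum d phi = \sum_(b : {poly_(size m) F} | (size (b : A) < size d)%N) phi b.
  move=> d0 sd; pose P (b : A) := (size b < size d)%N.
  transitivity (\sum_(b : {poly_((size d).-1) F} | P b) phi b).
    by apply: eq_bigl => b; rewrite /P size_residue.
  apply: npoly_sum_resize => b; rewrite /P => sb.
  by rewrite -ltnS prednK ?size_poly_gt0 // sb (leq_trans (ltnW sb)).
pose P (d : A) := (d \is monic) && (d %| m').
have sP (d : A) : P d -> (size d <= size m)%N.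
  by move=> /andP[_ /(dvdp_leq m'0)]; rewrite sm'.
transitivity (\sum_(d : {poly_(size m) F} | P d)
    residue_sum d (fun b => Phi (m' %/ d) b d)); last first.
  by apply: npoly_sum_resize => d /sP sd; rewrite sd sm' sd.
transitivity (\sum_(d : {poly_(size m) F} | P d)
   \sum_(b : {poly_(size m) F} | (size (b : A) < size (d : A))%N) Phi (m' %/ d) b d); last first.
  apply: eq_bigr => d Pd; rewrite [RHS]inner ?sP //.
  by case/andP: Pd => /monic_neq0.
rewrite pair_big_dep /=.
have sq (d : {poly_(size m) F}) : (size (m' %/ d)%R <= size m)%N.
  by rewrite (leq_trans (leq_divp _ _)) // sm'.
rewrite (reindex_onto
  (fun db : {poly_(size m) F} * {poly_(size m) F} => (npolyp (size m) (m' %/ db.1), db.2, db.1))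
  (fun t : hecke_index m => (t.2, t.1.2))) /= => [|[[a b] d]].
  apply: eq_big => [[d b]|[d b] _] /=; last by rewrite npolypK.
  rewrite inE /hecke_cond !npolypK // eqxx andbT /P.
  have [md|] := boolP ((d : A) \is monic); last by rewrite !andbF.
  rewrite andbT /=; have d0 := monic_neq0 md.
  have [dm|dm] := boolP ((d : A) %| m') => /=.
    rewrite divpK // m'e /=.
    have -> : (m' %/ d) \is monic by rewrite -(monicMl _ md) mulrC divpK.
    rewrite andbT; have -> : coprimep (m' %/ d) p => //.
    rewrite (coprimep_dvdr _ mp) // -(eqp_dvdr _ m'e) -{2}(divpK dm).
    exact: dvdp_mulr.
  apply/negP => /and4P[e _ _ _]; case/negP: dm.
  by rewrite (eqp_dvdr _ m'e) -(eqp_dvdr _ e) dvdp_mull.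
rewrite inE => /and5P[ad _ _ ma md]; congr (_, _, _); apply: val_inj => /=.
rewrite npolypK //.
have adE : (a : A) * d = m'.
  apply/eqP; rewrite -eqp_monic ?monicMl // (eqp_trans ad) // eqp_sym //.
by rewrite -adE mulpK // monic_neq0.
Qed.
End HeckeSums.

Section PrimeSums.
Variables (F : finFieldType) (p : {poly F}) (W : nmodType).
Local Notation A := {poly F}.

Lemma residue_sum1 (phi : A -> W) : residue_sum 1 phi = phi 0.
Proof.
rewrite /residue_sum size_poly1 /= (big_pred1 0) // => b.
by apply/esym/eqP/val_inj/eqP; rewrite -size_poly_leq0 size_npoly.
Qed.

Lemma divisor_sum_irr (l : A) (f : A -> W) : irreducible_poly l -> l \is monic ->
  divisor_sum l f = f 1 + f l.
Proof.
move=> irl ml; have sl : (1 < size l)%N by case: irl.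
have E1 : (npolyp (size l) 1 : A) = 1 by rewrite npolypK // size_poly1 ltnW.
have El : (npolyp (size l) l : A) = l by rewrite npolypK.
rewrite /divisor_sum (bigD1 (npolyp (size l) 1)) /=; last by rewrite E1 monic1 dvd1p.
rewrite (bigD1 (npolyp (size l) l)) /=; last first.
  rewrite El ml dvdpp /=; apply/eqP => /(congr1 (@polyn _ _)).
  by rewrite El E1 => l1; rewrite l1 size_poly1 in sl.
rewrite E1 El big1 ?addr0 // => d /andP[/andP[/andP[md dl] d1] dl'].
have [/eqP dE|/eqP dE] : (d : A) == 1 \/ (d : A) == l.
  by have [e|e] := irredp_XsubCP irl dl; [left | right];
    rewrite -eqp_monic ?monic1.
  by case/eqP: d1; apply: val_inj; rewrite /= E1.
by case/eqP: dl'; apply: val_inj; rewrite /= El.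
Qed.

Lemma hecke_sum_irr (l : A) (Phi : A -> A -> A -> W) :
    irreducible_poly l -> coprimep l p ->
  \sum_(t in hecke_set p l) Phi t.1.1 t.1.2 t.2 =
  Phi (monic_gen l) 0 1 + residue_sum (monic_gen l) (fun b => Phi 1 b (monic_gen l)).
Proof.
move=> irl lp; have l0 := irredp_neq0 irl.
have ml := monic_gen_monic l0; have l'0 := monic_neq0 ml.
rewrite hecke_sumE // divisor_sum_irr //.
  by rewrite residue_sum1 divp1 divpp.
case: irl => sl irl; split; first by rewrite monic_gen_size.
move=> q sq; rewrite (eqp_dvdr _ (monic_gen_eqp l0)) => ql.
by apply: eqp_trans (irl _ sq ql) _; rewrite eqp_sym monic_gen_eqp.
Qed.
End PrimeSums.

Section HeckeOperators.
Variables (F : finFieldType) (p : {poly F}) (R : comNzRingType).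
Local Notation A := {poly F}.
Local Notation P1K := (P1 {fraction A}).

Lemma hecke_msclass m (D : div0 R P1K) : hecke m (msclass p D) =
  \sum_(t in hecke_set p m) msclass p (pushforward0 (actA (hecke_mx t)) D).
Proof. exact: (lquot_lift_pi (@hecke_div_rel _ p R m)). Qed.

Definition tri_class (D : div0 R P1K) (a b d : A) : modsym p R :=
  msclass p (pushforward0 (actA (mx2 a b 0 d)) D).

Lemma det_tri (a b d : A) : \det (mx2 a b 0 d) = a * d.
Proof. by rewrite det_mx2 !mxE /= mulr0 subr0. Qed.

Lemma tri_mul (a b d a' b' d' : A) :
  mx2 a b 0 d *m mx2 a' b' 0 d' = mx2 (a * a') (a * b' + b * d') 0 (d * d').
Proof.
by apply: mx2_eqP; rewrite mulmx2E !mxE /= ?mulr0 ?mul0r ?addr0 ?add0r.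
Qed.

Lemma tri_class_comp D (a b d a' b' d' : A) : a' != 0 -> d' != 0 ->
  tri_class (pushforward0 (actA (mx2 a' b' 0 d')) D) a b d =
  tri_class D (a * a') (a * b' + b * d') (d * d').
Proof.
move=> a0 d0; rewrite /tri_class -pushforward0M ?det_tri ?mulf_neq0 //.
by rewrite tri_mul.
Qed.

Lemma tri_class_periodic D (a b d y : A) : a != 0 -> d != 0 ->
  tri_class D a (b + d * y) d = tri_class D a b d.
Proof.
move=> a0 d0; have G := Gamma0_upper p y (unitr1 _) (unitr1 _).
rewrite -[RHS](msclass_act _ G) -pushforward0M ?det_tri ?mulf_neq0 //.
by rewrite tri_mul !mul1r [y * d]mulrC.
Qed.

Lemma actA_scalar (k : A) (r : P1K) : k != 0 -> actA (mx2 k 0 0 k) r = r.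
Proof.
move=> k0; have [a [c [cop ->]]] := pt_coprime r.
rewrite actA_pt //.
  by rewrite !mxE /= !mul0r addr0 add0r pt_mull.
exact: coprimep_neq0 cop.
Qed.

Lemma tri_class_scale D (k a b d : A) : k != 0 -> a != 0 -> d != 0 ->
  tri_class D (k * a) (k * b) (k * d) = tri_class D a b d.
Proof.
move=> k0 a0 d0; rewrite /tri_class; congr msclass; apply: val_inj => /=.
congr pushforward; apply/funext => r.
have -> : mx2 (k * a) (k * b) 0 (k * d) = mx2 k 0 0 k *m mx2 a b 0 d.
  by rewrite tri_mul mul0r addr0.
by rewrite actAM ?det_tri ?mulf_neq0 // actA_scalar.
Qed.

Lemma hecke_mxE m (t : hecke_index m) :
  hecke_mx t = mx2 (t.1.1 : A) t.1.2 0 t.2.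
Proof. by case: t => [[a b] d]. Qed.

Lemma hecke_class m D : m != 0 -> coprimep m p -> hecke m (msclass p D) =
  divisor_sum (monic_gen m) (fun d =>
    residue_sum d (fun b => tri_class D (monic_gen m %/ d) b d)).
Proof.
move=> m0 mp; rewrite hecke_msclass -(@hecke_sumE _ p _ m (tri_class D)) //.
by apply: eq_bigr => t _; rewrite hecke_mxE.
Qed.

Lemma hecke_class_irr l D : irreducible_poly l -> coprimep l p ->
  hecke l (msclass p D) = tri_class D (monic_gen l) 0 1 +
    residue_sum (monic_gen l) (fun b => tri_class D 1 b (monic_gen l)).
Proof.
move=> irl lp; rewrite hecke_msclass -(@hecke_sum_irr _ p _ l (tri_class D)) //.
by apply: eq_bigr => t _; rewrite hecke_mxE.
Qed.

(** Both composites are sums over products of triangular matrices, in the two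
    orders. *)
Lemma hecke_commute (l m : A) (x : modsym p R) :
  irreducible_poly l -> l \is monic -> coprimep l p -> m != 0 -> coprimep m p ->
  hecke l (hecke m x) = hecke m (hecke l x).
Proof.
move=> irl ml lp m0 mp; have l0 := monic_neq0 ml.
have -> : x = msclass p (lquot_repr x) by rewrite /msclass lquot_reprK.
set D := lquot_repr x; rewrite hecke_class // hecke_class_irr //.
have lE : monic_gen l = l by rewrite /monic_gen (monicP ml) invr1 scale1r.
rewrite lE; set n := monic_gen m.
have mn : n \is monic := monic_gen_monic m0; have n0 := monic_neq0 mn.
have a_n0 d : d %| n -> n %/ d != 0 by move=> dn; rewrite dvdp_div_eq0.
have -> : hecke l (divisor_sum n (fun d => residue_sum d (fun b => tri_class D (n %/ d) b d))) =
  divisor_sum n (fun d => residue_sum d (fun b => tri_class D (l * (n %/ d)) (l * b) d) +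
    residue_sum d (fun b => residue_sum l (fun c => tri_class D (n %/ d) (b + c * d) (l * d)))).
  rewrite /divisor_sum linear_sum; apply: eq_bigr => d /andP[md dn].
  have d0 := monic_neq0 md; have a0 := a_n0 _ dn.
  rewrite linear_sum -big_split /=; apply: eq_bigr => b _.
  rewrite {1}/tri_class hecke_class_irr // lE tri_class_comp // mul0r addr0 mul1r.
  congr (_ + _); apply: eq_residue_sum => c.
  by rewrite tri_class_comp // !mul1r.
rewrite (hecke_sums_commute (@tri_class_periodic D) (@tri_class_scale D)) //.
rewrite divisor_sumD linearD /=; congr (_ + _).
  apply: etrans (esym (hecke_class _ m0 mp)); rewrite -/n; apply: eq_divisor_sum => d md dn.
  apply: eq_residue_sum => b; rewrite tri_class_comp ?oner_neq0 //.
  by rewrite mulr0 add0r !mulr1 mulrC.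
rewrite linear_sum.
transitivity (residue_sum l (fun c => divisor_sum n (fun d => residue_sum d (fun b =>
    tri_class D (n %/ d) (c * (n %/ d) + l * b) (l * d))))).
  rewrite /residue_sum /divisor_sum exchange_big /=; apply: eq_bigr => d _.
  exact: exchange_big.
apply: eq_bigr => c _; apply: etrans (esym (hecke_class _ m0 mp)); rewrite -/n.
apply: eq_divisor_sum => d md dn; apply: eq_residue_sum => b.
rewrite tri_class_comp ?oner_neq0 // mulr1 [l * d]mulrC; congr tri_class.
by rewrite mulrC [l * _]mulrC.
Qed.
End HeckeOperators.

(** * Eisenstein operators on the symbol from zero to infinity *)

Section EtaWinding.
Variables (F : finFieldType) (p : {poly F}) (R : comNzRingType).
Local Notation A := {poly F}.
Local Notation P1K := (P1 {fraction A}).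
Local Notation symb := (symb p R).

(** Sort the nonzero polynomials by leading coefficient. *)
Lemma sum_scalar_orbits (W : nmodType) (k : nat) (phi : A -> W) :
  (forall u b, u != 0 -> b != 0 -> phi (u *: b) = phi b) ->
  \sum_(b : {poly_k F}) phi b =
  phi 0 + (\sum_(b : {poly_k F} | (b : A) \is monic) phi b) *+ (#|F| - 1).
Proof.
move=> phiZ; rewrite (bigD1 0) //=; congr (_ + _).
rewrite (partition_big (fun b : {poly_k F} => lead_coef b) (fun u => u != 0)) /=.
  transitivity (\sum_(u : F | u != 0)
      \sum_(b : {poly_k F} | (b : A) \is monic) phi b); last first.
    rewrite sumr_const; congr (_ *+ _); rewrite subn1 -(cardC1 (0 : F)).
    exact: eq_card.
  apply: eq_bigr => u u0.
  rewrite (reindex_onto (fun b : {poly_k F} => u *: b)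
    (fun b : {poly_k F} => u^-1 *: b)) /= => [|b _]; last first.
    by rewrite scalerA mulfV // scale1r.
  apply: eq_big => [b|b /andP[/andP[b0 _] _]].
    rewrite scalerA mulVf // scale1r eqxx andbT lead_coefZ.
    have -> : (u * lead_coef b == u) = ((b : A) \is monic).
      by rewrite -[X in _ == X]mulr1 (inj_eq (mulfI u0)) monicE.
    rewrite scaler_eq0 (negPf u0) /=.
    rewrite andb_idl // => mb; apply: contraTneq mb => ->.
    by rewrite /= monicE lead_coef0 eq_sym oner_eq0.
  rewrite phiZ //; apply: contraNneq b0 => b0; apply/eqP/val_inj => /=.
  by rewrite b0 scaler0.
move=> b b0; rewrite lead_coef_eq0; apply: contraNneq b0 => b0.
exact/eqP/val_inj.
Qed.

Lemma hecke_0oo (m : A) : irreducible_poly m -> coprimep m p ->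
  hecke m (symb (Some 0) None) =
  symb (Some 0) None + residue_sum (monic_gen m) (fun b => symb (pt b (monic_gen m)) None).
Proof.
move=> irm mp; rewrite hecke_symb.
pose Phi a b d := symb (actA (mx2 a b 0 d) (Some 0)) (actA (mx2 a b 0 d) None).
transitivity (\sum_(t in hecke_set p m) Phi t.1.1 t.1.2 t.2).
  by apply: eq_bigr => t _; rewrite hecke_mxE.
rewrite hecke_sum_irr // /Phi actA_0 actA_oo !mxE /= pt01 pt10; congr (_ + _).
by apply: eq_residue_sum => b; rewrite actA_0 actA_oo !mxE /= pt10.
Qed.

(** The matrices (1, b; 0, m) give [b / m, oo] = [b / m, 0] + [0, oo], and diagonal
    matrices identify [b / m, 0] with [u b / m, 0] for constants u. *)
Lemma eta_0oo (m : A) : irreducible_poly m -> coprimep m p ->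
  hecke m (symb (Some 0) None) - symb (Some 0) None *+ (#|F| ^ (size m).-1 + 1) =
  (\sum_(b : {poly_((size (monic_gen m)).-1) F} | (b : A) \is monic)
     symb (pt b (monic_gen m)) (Some 0)) *+ (#|F| - 1).
Proof.
move=> irm mp; rewrite hecke_0oo //; set m' := monic_gen m.
have m'0 : m' != 0 by rewrite monic_neq0 // monic_gen_monic // irredp_neq0.
set s := symb (Some 0) None.
have -> : residue_sum m' (fun b => symb (pt b m') None) =
    residue_sum m' (fun b => symb (pt b m') (Some 0)) + s *+ (#|F| ^ (size m).-1).
  rewrite -(monic_gen_size m) -residue_sum_const /residue_sum -big_split /=.
  by apply: eq_bigr => b _; rewrite symbD.
rewrite addn1 mulrS addrCA addrK.
rewrite /residue_sum (@sum_scalar_orbits _ _ (fun b => symb (pt b m') (Some 0))).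
  by rewrite [pt 0 m']/pt (negPf m'0) tofrac0 mul0r symb_refl add0r.
by move=> u b u0 b0; rewrite symb_pt_scale // b0.
Qed.

Lemma eta_integral (m : A) : irreducible_poly m -> coprimep m p ->
  exists z : modsym0 p R,
    hecke m (symb (Some 0) None) - symb (Some 0) None *+ (#|F| ^ (size m).-1 + 1) =
    val z *+ (#|F| - 1).
Proof.
move=> irm mp; rewrite eta_0oo //; set z := \sum_(b | _) _.
suff z0 : in_kernel (@boundary _ p R) z by exists (Kernel z0).
rewrite /in_kernel linear_sum big1 // => b mb /=.
rewrite boundary_symb cusp_pt ?subrr //; last first.
  by rewrite (eqp_coprimepl _ (monic_gen_eqp (irredp_neq0 irm))).
rewrite coprimep_sym (eqp_coprimepl _ (monic_gen_eqp (irredp_neq0 irm))).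
have b0 := monic_neq0 mb; rewrite irreducible_poly_coprime //.
apply/negP => /(dvdp_leq b0); rewrite leqNgt -(monic_gen_size m) size_residue //.
by rewrite monic_neq0 // monic_gen_monic // irredp_neq0.
Qed.

Lemma deg1_irreducible (m : A) : size m = 2 -> irreducible_poly m.
Proof.
move=> sm; split; first by rewrite sm.
move=> q sq qm; have m0 : m != 0 by rewrite -size_poly_gt0 sm.
have q0 : q != 0 by apply: contraTneq qm => ->; rewrite dvd0p.
rewrite -dvdp_size_eqp // sm eqn_leq -{1}sm dvdp_leq //=.
by move: sq; rewrite -size_poly_gt0 in q0; case: (size q) q0 => [|[|]].
Qed.
End EtaWinding.

Section EtaDegreeOne.
Variables (F : finFieldType) (p : {poly F}) (R : comNzRingType).
Hypotheses (p_irr : irreducible_poly p) (p_size : size p = 4).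
Local Notation symb := (symb p R).

Lemma eta_deg1 (n : deg1 F) :
  hecke (deg1_gen n) (symb (Some 0) None) -
    symb (Some 0) None *+ (#|F| ^ (size (deg1_gen n)).-1 + 1) =
  val (inv_symb0 R p_irr p_size n) *+ (#|F| - 1).
Proof.
have sn := deg1_gen_size n; have irn := deg1_irreducible sn.
rewrite eta_0oo ?deg1_gen_coprime //.
have -> : monic_gen (deg1_gen n) = deg1_gen n.
  by rewrite /monic_gen (monicP (deg1_gen_monic n)) invr1 scale1r.
congr (_ *+ _); rewrite sn /= (big_pred1 (npolyp 1 1)) => [|b].
  by rewrite npolypK // size_poly1.
have E : (npolyp 1 1 : {poly F}) = 1 by rewrite npolypK // size_poly1.
apply/idP/eqP => [mb|->]; last by rewrite E monic1.
apply: val_inj; rewrite /= E.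
have := size1_polyC (size_npoly b); move: mb; rewrite monicE => /eqP mb bE.
by move: mb; rewrite bE lead_coefC => ->.
Qed.
End EtaDegreeOne.

(** * Extension of scalars *)

Section BaseChange.
Variables (F : finFieldType) (p : {poly F}).
Local Notation A := {poly F}.
Local Notation P1K := (P1 {fraction A}).

Section OneMorphism.
Variables (R S : comNzRingType) (f : {rmorphism R -> S}).

Fact modsym_base_is_additive : zmod_morphism (@modsym_base _ p _ _ f).
Proof.
move=> x y; rewrite -[x]lquot_reprK -[y]lquot_reprK.
rewrite -[lquot_pi _ (lquot_repr x)]/(msclass p _) -[lquot_pi _ (lquot_repr y)]/(msclass p _).
rewrite -linearB !modsym_base_class -linearB; congr msclass.
by apply: val_inj; rewrite /= raddfB.
Qed.
HB.instance Definition _ := GRing.isZmodMorphism.Build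
  (modsym p R) (modsym p S) (@modsym_base _ p _ _ f) modsym_base_is_additive.

Lemma modsym_base_symb (r s : P1K) :
  modsym_base f (symb p R r s) = symb p S r s.
Proof.
rewrite /symb modsym_base_class; congr msclass; apply: val_inj => /=.
by rewrite raddfB /= !base_changeU rmorph1.
Qed.

Lemma modsym_base_hecke m (x : modsym p R) :
  modsym_base f (hecke m x) = hecke m (modsym_base f x).
Proof.
have -> : x = msclass p (lquot_repr x) by rewrite /msclass lquot_reprK.
rewrite modsym_base_class !hecke_msclass raddf_sum; apply: eq_bigr => t _.
rewrite /= modsym_base_class; congr msclass; apply: val_inj => /=.
by rewrite pushforward_base_change.
Qed.

Fact modsym0_base_is_additive : zmod_morphism (@modsym0_base _ p _ _ f).
Proof. by move=> x y; apply: val_inj; rewrite /= raddfB. Qed.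
HB.instance Definition _ := GRing.isZmodMorphism.Build
  (modsym0 p R) (modsym0 p S) (@modsym0_base _ p _ _ f) modsym0_base_is_additive.

Lemma modsym0_base_hecke m (x : modsym0 p R) :
  modsym0_base f (hecke0 m x) = hecke0 m (modsym0_base f x).
Proof. by apply: val_inj; rewrite /= modsym_base_hecke. Qed.
End OneMorphism.

(** The third morphism is a separate argument because the embeddings of the integers
    through the rationals and directly agree only pointwise. *)
Lemma modsym_base_comp (R S T : comNzRingType) (f : {rmorphism R -> S})
    (g : {rmorphism S -> T}) (h : {rmorphism R -> T}) (x : modsym p R) :
  (forall a, g (f a) = h a) -> modsym_base g (modsym_base f x) = modsym_base h x.
Proof.
move=> gf; have -> : x = msclass p (lquot_repr x) by rewrite /msclass lquot_reprK.
rewrite !modsym_base_class; congr msclass; apply: val_inj => /=.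
by apply/eqP/freeg_eqP => y; rewrite !coeff_base_change gf.
Qed.
End BaseChange.

(** * Laurent series at infinity *)

Section PowerSeriesOrder.
Variable F : fieldType.
Implicit Types f g : powser F.

Lemma coefps0M f g : coefps (f * g) 0 = coefps f 0 * coefps g 0.
Proof. by rewrite [LHS]big_ord_recl big_ord0 /= addr0. Qed.

Lemma coefps0D f g : coefps (f + g) 0 = coefps f 0 + coefps g 0.
Proof. by []. Qed.

Definition coefps0 f : F := coefps f 0.

Fact coefps0_is_zmod_morphism : zmod_morphism coefps0.
Proof. by []. Qed.
HB.instance Definition _ := GRing.isZmodMorphism.Build (powser F) F coefps0
  coefps0_is_zmod_morphism.

Fact coefps0_is_monoid_morphism : monoid_morphism coefps0.
Proof. by split=> // f g; exact: coefps0M. Qed.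
HB.instance Definition _ := GRing.isMonoidMorphism.Build (powser F) F coefps0
  coefps0_is_monoid_morphism.

Lemma coefps_XM f n :
  coefps (powserX F * f) n = if n is k.+1 then coefps f k else 0.
Proof.
case: n => [|n]; first by rewrite coefps0M mul0r.
rewrite [LHS]big_ord_recl /= mul0r add0r big_ord_recl /= mul1r subSS subn0.
by rewrite big1 ?addr0 // => i _; rewrite mul0r.
Qed.

Lemma powserX_neq0 : powserX F != 0.
Proof. by apply/eqP => /(congr1 (coefps^~ 1%N)) /eqP /=; rewrite oner_eq0. Qed.

Lemma powserX_divP f : coefps f 0 = 0 -> exists g, f = powserX F * g.
Proof.
move=> f0; exists (PowSer (fun n => coefps f n.+1)); apply: powserP => n.
by rewrite coefps_XM; case: n.
Qed.

(** Divide by the uniformizer until the constant term is nonzero. *)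
Lemma powser_orderP f : f != 0 ->
  exists n u, coefps u 0 != 0 /\ f = powserX F ^+ n * u.
Proof.
move=> f0; have [n] : exists n, coefps f n != 0.
  apply: contrapT => /forallNP all0; case/negP: f0; apply/eqP; apply: powserP => i.
  by have /negP := all0 i; rewrite negbK => /eqP.
elim: n f {f0} => [|n IH] f fn; first by exists 0%N, f; rewrite expr0 mul1r.
have [f0|f0] := eqVneq (coefps f 0) 0; last by exists 0%N, f; rewrite expr0 mul1r.
have [g fE] := powserX_divP f0; have gn : coefps g n != 0.
  by move: fn; rewrite fE coefps_XM.
have [k [u [u0 gE]]] := IH _ gn; exists k.+1, u; split=> //.
by rewrite fE gE exprS mulrA.
Qed.

Lemma powserX_exp_le f g m n : coefps f 0 != 0 ->
  powserX F ^+ m * f = powserX F ^+ n * g -> (n <= m)%N.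
Proof.
move=> f0 e; rewrite leqNgt; apply/negP => lt; move: e.
rewrite -(subnKC lt) addSnnS exprD -mulrA => e; have {e} := mulfI (expf_neq0 m powserX_neq0) e.
rewrite exprS -mulrA => fE; move: f0.
by rewrite fE coefps_XM eqxx.
Qed.

Fact powserC_is_zmod_morphism : zmod_morphism (@powserC F).
Proof.
by move=> a b; apply: powserP => -[|n] //=; rewrite subrr.
Qed.
HB.instance Definition _ := GRing.isZmodMorphism.Build F (powser F) (@powserC F)
  powserC_is_zmod_morphism.

Fact powserC_is_monoid_morphism : monoid_morphism (@powserC F).
Proof.
split=> // a b; apply: powserP => -[|n]; first by rewrite coefps0M.
rewrite [RHS]big_ord_recl /= mulr0 add0r big1 // => i _; exact: mul0r.
Qed.
HB.instance Definition _ := GRing.isMonoidMorphism.Build F (powser F) (@powserC F)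
  powserC_is_monoid_morphism.
End PowerSeriesOrder.

Section Completion.
Variable F : finFieldType.
Local Notation A := {poly F}.
Local Notation O := (powser F).
Local Notation Kinf := {fraction (powser F)}.
Local Notation X := (powserX F).
Local Notation pi := (pi_inf F).

Lemma pi_neq0 : pi != 0.
Proof. by rewrite tofrac_eq0 powserX_neq0. Qed.

Let iota : {rmorphism F -> Kinf} := (@tofrac O \o @powserC F).

Lemma poly_KinfE (a : A) : poly_Kinf a = (map_poly iota a).[pi^-1].
Proof. by []. Qed.

Fact poly_Kinf_is_zmod_morphism : zmod_morphism (@poly_Kinf F).
Proof. by move=> a b; rewrite !poly_KinfE rmorphB hornerD hornerN. Qed.
HB.instance Definition _ := GRing.isZmodMorphism.Build A Kinf (@poly_Kinf F)
  poly_Kinf_is_zmod_morphism.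

Fact poly_Kinf_is_monoid_morphism : monoid_morphism (@poly_Kinf F).
Proof.
by split=> [|a b]; rewrite !poly_KinfE ?rmorph1 ?hornerC // rmorphM hornerM.
Qed.
HB.instance Definition _ := GRing.isMonoidMorphism.Build A Kinf (@poly_Kinf F)
  poly_Kinf_is_monoid_morphism.

(** The variable is sent to the inverse of the uniformizer, so that after this
    normalization the leading term becomes the constant term. *)
Lemma poly_Kinf_lead (a : A) : exists s : O,
  pi ^+ (size a).-1 * poly_Kinf a = tofrac s /\ coefps s 0 = lead_coef a.
Proof.
elim/poly_ind: a => [|a c [s [sE s0]]].
  exists 0; split; last by rewrite lead_coef0.
  by rewrite rmorph0 mulr0 tofrac0.
have [a0|a0] := eqVneq a 0.
  exists (powserC c); rewrite a0 mul0r add0r lead_coefC; split=> //.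
  by rewrite size_polyC; case: (c != 0); rewrite expr0 mul1r poly_KinfE map_polyC hornerC.
exists (s + X ^+ (size a) * powserC c); split; last first.
  rewrite coefps0D s0 lead_coefDl; last first.
    by rewrite size_mulX // ltnS (leq_trans (size_polyC_leq1 _)) // size_poly_gt0.
  rewrite lead_coefMX -[size a]prednK ?size_poly_gt0 // exprS -mulrA coefps_XM.
  by rewrite addr0.
have -> : poly_Kinf (a * 'X + c%:P) = poly_Kinf a / pi + tofrac (powserC c).
  by rewrite poly_KinfE rmorphD rmorphM /= map_polyX map_polyC hornerMXaddC.
rewrite size_MXaddC (negPf a0) /= mulrDr tofracD tofracM tofracXn -sE; congr (_ + _).
rewrite -{1}[size a]prednK ?size_poly_gt0 // exprSr -!mulrA; congr (_ * _).
by rewrite mulrCA mulfV ?mulr1 // pi_neq0.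
Qed.

(** The local ring of K_oo and its maximal ideal, up to denominators that are
    units of the ring of power series. *)
Definition near_integral (x : Kinf) : Prop :=
  exists v h : O, coefps v 0 != 0 /\ tofrac v * x = tofrac h.
Definition near_maximal (x : Kinf) : Prop :=
  exists v h : O, coefps v 0 != 0 /\ tofrac v * x = tofrac (X * h).

Lemma near_maximalM x y : near_maximal x -> near_integral y -> near_maximal (x * y).
Proof.
move=> [v [h [v0 vx]]] [w [k [w0 wy]]]; exists (v * w), (h * k); split.
  by rewrite coefps0M mulf_neq0.
by rewrite tofracM mulrACA vx wy -tofracM mulrA.
Qed.

Lemma near_integral_tofrac h : near_integral (tofrac h).
Proof. by exists 1, h; rewrite tofrac1 mul1r oner_neq0. Qed.

(** The valuation at infinity of a nonzero polynomial is at most zero. *)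
Lemma near_maximal_poly (a : A) : near_maximal (poly_Kinf a) -> a = 0.
Proof.
move=> [v [h [v0 va]]]; have [s [sE s0]] := poly_Kinf_lead a.
have : v * s = X * (h * X ^+ (size a).-1).
  apply/eqP; rewrite -tofrac_eq tofracM -sE mulrCA va -tofracXn -tofracM mulrC mulrA.
  by rewrite eqxx.
move/(congr1 (coefps^~ 0%N)); rewrite coefps0M coefps_XM s0 => /eqP.
by rewrite mulf_eq0 (negPf v0) lead_coef_eq0 => /eqP.
Qed.

Lemma poly_Kinf_eq0 (a : A) : (poly_Kinf a == 0) = (a == 0).
Proof.
apply/eqP/eqP => [a0|->]; last exact: rmorph0.
apply: near_maximal_poly; exists 1, 0; rewrite a0 !mulr0 tofrac0; split=> //.
exact: oner_neq0.
Qed.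

(** Comparing orders: the order of the numerator must exceed that of the
    denominator. *)
Lemma near_maximal_sqr z : near_maximal (z ^+ 2) -> near_maximal z.
Proof.
have [->|z0] := eqVneq z 0.
  by move=> _; exists 1, 0; rewrite !mulr0 tofrac0 oner_neq0.
have zE := fraction_numden z; set n := \n_(repr z)%qT in zE; set d := \d_(repr z)%qT in zE.
have d0 : d != 0 := denom_ratioP _.
have n0 : n != 0 by apply: contraNneq z0 => n0; rewrite zE n0 tofrac0 mul0r.
have [i [u [u0 nE]]] := powser_orderP n0; have [j [w [w0 dE]]] := powser_orderP d0.
move=> [v [h [v0 vz]]].
have zd : z * tofrac d = tofrac n by rewrite {1}zE mulfVK // tofrac_eq0.
have e : X ^+ (i + i) * (v * u ^+ 2) = X ^+ (j + j).+1 * (h * w ^+ 2).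
  have : v * n ^+ 2 = X * h * d ^+ 2.
    apply/eqP; rewrite -tofrac_eq [tofrac (v * _)]tofracM [tofrac (X * h * _)]tofracM.
    by rewrite -vz !tofracXn -zd exprMn mulrA.
  rewrite nE dE !exprMn -!exprM !muln2 -!addnn => e.
  by rewrite mulrCA e [X ^+ _.+1]exprS -!mulrA [h * _]mulrCA.
have ij : (j < i)%N.
  have := powserX_exp_le _ e; rewrite coefps0M expr2 coefps0M !mulf_neq0 // => /(_ isT).
  by rewrite !addnn ltn_double.
exists w, (X ^+ (i - j.+1) * u); split=> //.
have pw : pi ^+ j * tofrac w = tofrac d by rewrite dE tofracM tofracXn.
apply: (mulfI (expf_neq0 j pi_neq0)).
rewrite [LHS]mulrA pw mulrC zd nE.
rewrite mulrA -exprS -(subnKC ij) addKn addSnnS exprD -mulrA tofracM tofracXn.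
by rewrite -/pi.
Qed.

Lemma near_integral_pi y : exists N, forall n, (N <= n)%N -> near_integral (y * pi ^+ n).
Proof.
have yE := fraction_numden y; set a := \n_(repr y)%qT in yE; set d := \d_(repr y)%qT in yE.
have d0 : d != 0 := denom_ratioP _; have [j [w [w0 dE]]] := powser_orderP d0.
have yd : y * tofrac d = tofrac a by rewrite {1}yE mulfVK // tofrac_eq0.
exists j => n jn; exists w, (a * X ^+ (n - j)); split=> //.
rewrite -{1}(subnKC jn) exprD tofracM -yd dE tofracM !tofracXn; ring.
Qed.
End Completion.

(** * The action of matrices on the tree *)

Section TreeAction.
Variable F : finFieldType.
Local Notation A := {poly F}.
Local Notation O := (powser F).
Local Notation Kinf := {fraction (powser F)}.
Local Notation X := (powserX F).
Local Notation pi := (pi_inf F).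
Local Notation "g ^K" := (map_mx (@tofrac O) g) (at level 2).
Local Open Scope classical_set_scope.
Implicit Types g h : 'M[Kinf]_2.

Lemma translate_vertex h g : translate h (vertex g) = vertex (h *m g).
Proof.
apply/seteqP; split=> x /=.
  by move=> [y [z z0 [k kO <-]] <-]; exists z => //; exists k; rewrite // -scalemxAr !mulmxA.
move=> [z z0 [k kO <-]]; exists (z *: (g *m k ^K)); first by exists z => //; exists k.
by rewrite -scalemxAr !mulmxA.
Qed.

Lemma translate_edge h g : translate h (edge g) = edge (h *m g).
Proof.
apply/seteqP; split=> x /=.
  by move=> [y [z z0 [k kO <-]] <-]; exists z => //; exists k; rewrite // -scalemxAr !mulmxA.
move=> [z z0 [k kO <-]]; exists (z *: (g *m k ^K)); first by exists z => //; exists k.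
by rewrite -scalemxAr !mulmxA.
Qed.

Lemma translateM h h' (c : set 'M[Kinf]_2) :
  translate (h *m h') c = translate h (translate h' c).
Proof.
apply/seteqP; split=> x /=; first by move=> [y cy <-]; exists (h' *m y); [exists y | rewrite mulmxA].
by move=> [_ [y cy <-] <-]; exists y; rewrite // mulmxA.
Qed.

Lemma translate1 (c : set 'M[Kinf]_2) : translate 1%:M c = c.
Proof.
apply/seteqP; split=> x /=; first by move=> [y cy <-]; rewrite mul1mx.
by move=> cx; exists x; rewrite ?mul1mx.
Qed.

Lemma translate_inj h : h \in unitmx -> injective (translate h).
Proof.
by move=> uh c d e; rewrite -[c]translate1 -[d]translate1 -(mulVmx uh) !translateM e.
Qed.

Lemma translate_origin h (c : set 'M[Kinf]_2) :
  translate h (origin c) = origin (translate h c).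
Proof.
apply/seteqP; split=> x /=.
  by move=> [_ [y cy [k kO <-]] <-]; exists (h *m y); [exists y | exists k; rewrite // mulmxA].
move=> [_ [y cy <-] [k kO <-]]; exists (y *m k ^K); last by rewrite mulmxA.
by exists y => //; exists k.
Qed.

Lemma translate_opposite h (c : set 'M[Kinf]_2) :
  translate h (opposite c) = opposite (translate h c).
Proof.
apply/seteqP; split=> x /=.
  by move=> [_ [y cy <-] <-]; exists (h *m y); [exists y | rewrite mulmxA].
move=> [_ [y cy <-] <-]; exists (y *m mx2 0 1 pi 0); last by rewrite mulmxA.
by exists y.
Qed.

Lemma edges_translate h (e : set 'M[Kinf]_2) : h \in unitmx -> edges e -> edges (translate h e).
Proof.
move=> uh [g ug <-]; rewrite translate_edge; apply: imageP.
by rewrite /GL2_Kinf /= unitmx_mul uh.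
Qed.

Lemma mem_vertex g : vertex g g.
Proof.
exists 1; first by rewrite /scalar_Kinf /= oner_eq0.
by exists 1%:M; rewrite ?scale1r ?map_mx1 ?mulmx1 // /GL2_O /= unitmx1.
Qed.

Lemma iwahori1 : @iwahori F 1%:M.
Proof. by split; [exact: unitmx1 | exists 0; rewrite mulr0 mxE]. Qed.

Lemma iwahoriM k k' : @iwahori F k -> @iwahori F k' -> @iwahori F (k *m k').
Proof.
move=> [uk [h kh]] [uk' [h' kh']]; split; first by rewrite unitmx_mul uk.
exists (h * k' 0 0 + k 1 1 * h'); rewrite mulmx2E kh kh'; ring.
Qed.

Lemma iwahoriV k : @iwahori F k -> @iwahori F (invmx k).
Proof.
move=> [uk [h kh]]; split; first by rewrite unitmx_inv.
exists (- ((\det k)^-1 * h)).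
have -> : (invmx k) 1 0 = - ((\det k)^-1 * k 1 0).
  rewrite /invmx uk !mxE /cofactor !det_mx11 !mxE /= expr1 mulN1r mulrN.
  by congr (- (_ * k _ _)); apply: val_inj.
by rewrite kh mulrN; congr (- _); rewrite mulrCA.
Qed.

Lemma mem_edge g : edge g g.
Proof.
exists 1; first by rewrite /scalar_Kinf /= oner_eq0.
by exists 1%:M; rewrite ?scale1r ?map_mx1 ?mulmx1 //; exact: iwahori1.
Qed.

(** The Iwahori subgroup is stable under products and inverses. *)
Lemma edge_iwahori g k : @iwahori F k -> edge (g *m k ^K) = edge g.
Proof.
have sub g' k' : @iwahori F k' -> edge (g' *m k' ^K) `<=` edge g'.
  move=> Ik' x [z z0 [k1 Ik1 <-]]; exists z => //; exists (k' *m k1); first exact: iwahoriM.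
  by rewrite map_mxM mulmxA.
move=> Ik; apply/seteqP; split; first exact: sub.
have [uk _] := Ik.
have {1}-> : g = (g *m k ^K) *m (invmx k) ^K by rewrite -mulmxA -map_mxM mulmxV // map_mx1 mulmx1.
exact/sub/iwahoriV.
Qed.

Lemma edge_scale z g : z != 0 -> edge (z *: g) = edge g.
Proof.
move=> z0; apply/seteqP; split=> x [y y0 [k Ik <-]].
  exists (y * z); first exact: mulf_neq0.
  by exists k; [exact: Ik | rewrite -scalemxAl scalerA].
exists (y / z); first by apply: mulf_neq0; rewrite ?invr_eq0.
by exists k; [exact: Ik | rewrite -scalemxAl scalerA mulfVK].
Qed.

Lemma translate_scalar (z : Kinf) (e : set 'M[Kinf]_2) : z != 0 -> edges e ->
  translate z%:M e = e.
Proof. move=> z0 [g ug <-]; rewrite translate_edge (mul_scalar_mx z g).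
exact: edge_scale z0. Qed.

Definition star g : set (set 'M[Kinf]_2) := [set e | edges e /\ origin e = vertex g].

(** An edge leaving a vertex is determined by a matrix with entries in the
    residue field, since matrices congruent to the identity modulo the
    uniformizer lie in the Iwahori subgroup. *)
Lemma star_finite g : finite_set (star g).
Proof.
pose B (m : 'M[F]_2) := edge (g *m (map_mx (@powserC F) m) ^K).
apply: (@sub_finite_set _ _ (B @` setT)); last first.
  by apply: finite_image; exact: finite_finset.
move=> e [[g' ug' <-] oe].
have : vertex g g'.
  rewrite -oe; exists g'; first exact: mem_edge.
  by exists 1%:M; rewrite ?map_mx1 ?mulmx1 // /GL2_O /= unitmx1.
move=> [z z0 [k kO <-]]; rewrite (edge_scale _ z0).
pose k0 := map_mx (@coefps0 F) k; pose C := map_mx (@powserC F) k0.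
exists k0; [exact: I | rewrite /B -/C].
have uk0 : k0 \in unitmx by rewrite unitmxE det_map_mx rmorph_unit -?unitmxE.
have uC : C \in unitmx by rewrite map_unitmx.
have kC : C *m (invmx C *m k) = k by rewrite mulKVmx.
have Ik1 : @iwahori F (invmx C *m k).
  split; first by rewrite unitmx_mul unitmx_inv uC.
  apply: powserX_divP; set k1 := invmx C *m k in kC *.
  have k10 : map_mx (@coefps0 F) k1 = 1%:M.
    have CE : map_mx (@coefps0 F) C = k0 by apply/matrixP => i j; rewrite !mxE.
    by rewrite -[LHS](mulKmx uk0) -{2}CE -map_mxM kC mulVmx.
  by have := congr1 (fun M : 'M[F]_2 => M 1 0) k10; rewrite !mxE.
by rewrite -[in RHS]kC (map_mxM _ C) mulmxA (edge_iwahori _ Ik1).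
Qed.

Lemma set_bij_star h g : h \in unitmx -> set_bij (star g) (star (h *m g)) (translate h).
Proof.
move=> uh; split.
- move=> e [Ee oe]; split; first exact: edges_translate.
  by rewrite -translate_origin oe translate_vertex.
- by move=> e e' _ _; apply: translate_inj.
move=> e [Ee oe]; exists (translate (invmx h) e).
  split; first by apply: edges_translate; rewrite ?unitmx_inv.
  by rewrite -translate_origin oe translate_vertex mulKmx.
by rewrite -translateM mulmxV // translate1.
Qed.
End TreeAction.

(** * Ends and rays of the tree *)

Section FieldIdentities.
Variable L : fieldType.

Lemma triangular_rows (G B K : 'M[L]_2) (x y z : L) : B 1 0 = 0 ->
  G *m B *m mx2 x 0 0 1 = z *: (B *m mx2 y 0 0 1 *m K) ->
  G 1 0 * B 0 0 * x = z * (B 1 1 * K 1 0) /\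
  G 1 0 * B 0 1 + G 1 1 * B 1 1 = z * (B 1 1 * K 1 1).
Proof.
move=> B10 e; have E j : (G *m B *m mx2 x 0 0 1) 1 j = z * (B *m mx2 y 0 0 1 *m K) 1 j.
  by rewrite e mxE.
have := E 0; have := E 1; rewrite !mulmx2E !mxE /= B10.
by rewrite !(mul0r, mulr0, addr0, add0r, mulr1) => -> ->.
Qed.

Lemma cancel_det (U d p z k : L) (n m : nat) : (n < m)%N -> d != 0 -> p != 0 ->
  U * d * p ^- n = z ^+ 2 * (d * p ^- m * k) ->
  k * z ^+ 2 = p * (U * p ^+ (m - n.+1)).
Proof.
move=> nm d0 p0 e; have pn i : p ^+ i != 0 by rewrite expf_neq0.
have pm : p ^+ m = p ^+ n * (p * p ^+ (m - n.+1)).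
  by rewrite -exprS -exprD addnS -addSn subnKC.
apply: (mulfI d0); transitivity (z ^+ 2 * (d * p ^- m * k) * p ^+ m).
  by field.
by rewrite -e pm; field.
Qed.

Lemma cancel_row (a b0 b1 x z k : L) : b0 != 0 -> x != 0 ->
  a * b0 * x^-1 = z * (b1 * k) -> a = z * k * (b1 / b0 * x).
Proof.
move=> b00 x0 e; transitivity (a * b0 * x^-1 * (x / b0)); first by field; rewrite b00.
by rewrite e; field.
Qed.
End FieldIdentities.

Section Embedding.
Variable F : finFieldType.
Local Notation A := {poly F}.
Local Notation Kinf := {fraction (powser F)}.
Local Notation P1K := (P1 {fraction A}).
Local Notation pi := (pi_inf F).
Local Notation "g ^K" := (map_mx (@poly_Kinf F) g) (at level 2).

(** The value does not depend on the fraction chosen, the embedding of polynomials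
    being injective. *)
Lemma ratfrac_Kinf_div (a c : A) : c != 0 ->
  ratfrac_Kinf (tofrac a / tofrac c) = poly_Kinf a / poly_Kinf c.
Proof.
move=> c0; set x := tofrac a / tofrac c; rewrite /ratfrac_Kinf.
have := fraction_numden x; have d0 : \d_(repr x)%qT != 0 := denom_ratioP _.
move: (\n_(repr x)%qT) (\d_(repr x)%qT) d0 => n d d0 /eqP.
rewrite /x eqr_div ?tofrac_eq0 // -!tofracM tofrac_eq => /eqP e.
apply/eqP; rewrite eqr_div ?poly_Kinf_eq0 //; apply/eqP.
by rewrite -!rmorphM -e mulrC.
Qed.

Lemma P1_Kinf_pt (a c : A) : P1_Kinf (pt a c) = ptL (poly_Kinf a) (poly_Kinf c).
Proof.
rewrite /P1_Kinf /pt /ptL poly_Kinf_eq0; case: eqP => //= /eqP c0.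
by rewrite ratfrac_Kinf_div.
Qed.

Lemma P1_Kinf_act (g : 'M[A]_2) (r : P1K) : \det g != 0 ->
  P1_Kinf (actA g r) = homography g ^K (P1_Kinf r).
Proof.
move=> g0; have [a [c [cop ->]]] := pt_coprime r.
have ac : (a != 0) || (c != 0).
  exact: coprimep_neq0 cop.
rewrite (actA_pt _ ac) !P1_Kinf_pt homography_ptL; last by rewrite !poly_Kinf_eq0.
by rewrite !mxE !rmorphD !rmorphM.
Qed.

Lemma map_Kinf_unit (g : 'M[A]_2) : \det g != 0 -> g ^K \in unitmx.
Proof. by move=> g0; rewrite unitmxE det_map_mx unitfE poly_Kinf_eq0. Qed.

Lemma unitmx_neq0 (g : 'M[Kinf]_2) : g \in unitmx -> \det g != 0.
Proof. by rewrite unitmxE unitfE. Qed.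

Lemma tends_to_translate (h : 'M[Kinf]_2) v x : h \in unitmx ->
  tends_to v x -> tends_to (fun n => translate h (v n)) (homography h x).
Proof.
move=> uh [g [ug <- [k [l vE]]]]; exists (h *m g); split.
- by rewrite /GL2_Kinf /= unitmx_mul uh.
- by rewrite homographyM //; apply: unitmx_neq0.
by exists k, l => n; rewrite vE translateM.
Qed.

Lemma geodesic_translate (h : 'M[Kinf]_2) r s c : h \in unitmx ->
  geodesic r s c ->
  geodesic (homography h r) (homography h s) (fun i => translate h (c i)).
Proof.
move=> uh [cE co cn cr cs]; split.
- by move=> i; apply: edges_translate.
- by move=> i; rewrite -translate_opposite -!translate_origin co.
- move=> i; rewrite -translate_opposite => /(translate_inj uh); exact: cn.
- have := tends_to_translate uh cr.
  by congr tends_to; apply/funext => n; rewrite translate_origin.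
have := tends_to_translate uh cs.
by congr tends_to; apply/funext => n; rewrite translate_origin.
Qed.

Definition ray_mx (n : nat) : 'M[Kinf]_2 := mx2 (pi ^- n) 0 0 1.

Lemma poly_KinfC (u : F) : poly_Kinf u%:P = tofrac (powserC u).
Proof. by rewrite poly_KinfE map_polyC hornerC. Qed.

(** If a matrix of GL_2(A) fixing the cusp carried one vertex of the ray to a
    farther one, the scalar relating the two would lie in the maximal ideal,
    and so would the lower row of the matrix, whose entries are polynomials. *)
Lemma ray_inequivalent_upper (b : 'M[Kinf]_2) : b \in unitmx -> b 1 0 = 0 ->
  exists N, forall n m (g : 'M[A]_2), (N <= n)%N -> (n < m)%N -> g \in unitmx ->
    ~ vertex (b *m ray_mx m) (g ^K *m b *m ray_mx n).
Proof.
move=> ub b10; have detb := unitmx_neq0 ub.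
have detbE : \det b = b 0 0 * b 1 1 by rewrite det_mx2 b10 mulr0 subr0.
have b00 : b 0 0 != 0 by apply: contraNneq detb => e; rewrite detbE e mul0r.
have [N HN] := near_integral_pi (b 1 1 / b 0 0); exists N => n m g Nn nm ug.
move=> [z z0 [k kO e]].
have [u u0 gu] := unitmx2P _ ug.
have detr i : \det (ray_mx i) = pi ^- i by rewrite det_mx2 !mxE /= mulr1 mulr0 subr0.
have zmax : near_maximal z.
  apply: near_maximal_sqr; exists (\det k), (powserC u * powserX F ^+ (m - n.+1)).
  split.
    have : @coefps0 F (\det k) \is a GRing.unit by rewrite rmorph_unit // -unitmxE.
    by rewrite unitfE.
  have gK : \det (g ^K) = tofrac (powserC u).
    by rewrite det_map_mx (det_mx2 g) gu; exact: poly_KinfC.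
  have := congr1 determinant e; rewrite detZ !det_mulmx !detr gK det_map_mx => e'.
  have := cancel_det nm detb (pi_neq0 F) (esym e').
  by rewrite !tofracM tofracXn.
have [row0 row1] := triangular_rows b10 (esym e).
have g10 : g 1 0 = 0.
  apply: near_maximal_poly.
  have -> : poly_Kinf (g 1 0) = z * tofrac (k 1 0) * (b 1 1 / b 0 0 * pi ^+ n).
    apply: cancel_row b00 _ _; first by rewrite expf_neq0 // pi_neq0.
    by move: row0; rewrite !mxE.
  apply: near_maximalM; last exact: HN.
  apply: near_maximalM zmax _; exact: near_integral_tofrac.
have g11 : g 1 1 = 0.
  apply: near_maximal_poly.
  have -> : poly_Kinf (g 1 1) = z * tofrac (k 1 1).
    have b11 : b 1 1 != 0 by apply: contraNneq detb => e'; rewrite detbE e' mulr0.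
    apply: (mulIf b11); move: row1; rewrite !mxE g10 rmorph0 mul0r add0r => ->.
    by rewrite [b 1 1 * _]mulrC mulrA.
  apply: near_maximalM zmax _; exact: near_integral_tofrac.
by move: gu; rewrite g10 g11 !mulr0 subrr => /esym/eqP; rewrite polyC_eq0 (negPf u0).
Qed.
End Embedding.

(** * The support of a cuspidal cochain along a geodesic *)

Section CochainSupport.
Variable F : finFieldType.
Local Notation A := {poly F}.
Local Notation Kinf := {fraction (powser F)}.
Local Notation P1K := (P1 {fraction A}).
Local Notation "g ^K" := (map_mx (@poly_Kinf F) g) (at level 2).
Local Open Scope classical_set_scope.

(** Moving the end to infinity by a matrix of GL_2(A) reduces to upper triangular
    matrices. *)
Lemma ray_inequivalent (g : 'M[Kinf]_2) (r : P1K) : g \in unitmx ->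
  homography g None = P1_Kinf r ->
  exists N, forall n m (h : 'M[A]_2), (N <= n)%N -> (n < m)%N -> h \in unitmx ->
    translate h ^K (vertex (g *m ray_mx F n)) <> vertex (g *m ray_mx F m).
Proof.
move=> ug gr; have [k uk kr] := pt_gl2 r.
have uk' : invmx k \in unitmx by rewrite unitmx_inv.
pose b := (invmx k) ^K *m g.
have uK : (invmx k) ^K \in unitmx by apply/map_Kinf_unit/unitmx_det0.
have ub : b \in unitmx by rewrite /b unitmx_mul uK ug.
have b10 : b 1 0 = 0.
  have : homography b None = None.
    rewrite (homographyM _ _ (unitmx_neq0 ug)) gr -(P1_Kinf_act _ (unitmx_det0 uk')).
    by rewrite -kr -(actAM _ _ (unitmx_det0 uk)) (mulVmx uk) actA1.
  by rewrite /homography; case: eqP.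
have [N HN] := ray_inequivalent_upper ub b10; exists N => n m h Nn nm uh.
rewrite translate_vertex => e.
have := mem_vertex (h ^K *m (g *m ray_mx F n)); rewrite e => hm.
have uh' : invmx k *m h *m k \in unitmx by rewrite !unitmx_mul uh uk' uk.
apply: (HN n m _ Nn nm uh').
have -> : (invmx k *m h *m k) ^K *m b *m ray_mx F n =
    (invmx k) ^K *m (h ^K *m (g *m ray_mx F n)).
  have kk : k ^K *m (invmx k) ^K = 1%:M by rewrite -map_mxM (mulmxV uk) map_mx1.
  rewrite /b !map_mxM -!mulmxA; congr (_ *m (_ *m _)).
  by rewrite mulmxA kk mul1mx.
rewrite /b -mulmxA -translate_vertex; exact: imageP.
Qed.

Variables (p : A) (f : set 'M[Kinf]_2 -> rat).
Hypothesis f_cusp : cuspidal p f.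

(** By finiteness of the support modulo the group, infinitely many edges in the
    support along a ray would give equivalent vertices on that ray. *)
Lemma ray_support_finite (c : nat -> set 'M[Kinf]_2) (r : P1K) :
  (forall n, edges (c n)) -> tends_to (fun n => origin (c n)) (P1_Kinf r) ->
  finite_set [set n | f (c n) != 0].
Proof.
move=> cE [g [ug gr [k [l vE]]]].
have [N HN] := ray_inequivalent ug gr.
have [_ _ _ [S Sfin HS]] := f_cusp.
pose I s := [set n | exists2 h, Gamma0 p h & c n = translate h ^K s].
have vE' n : (k <= n)%N -> origin (c n) = vertex (g *m ray_mx F (n - k + l)).
  by move=> kn; rewrite -[n in LHS](subnK kn) vE /ray_infty translate_vertex.
have noI s n m : I s n -> I s m -> (k + N <= n)%N -> (n < m)%N -> False.
  move=> [h Gh cn] [h' Gh' cm] kn nm.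
  have [uh _] := andP Gh; have [uh' _] := andP Gh'.
  have kn' : (k <= n)%N by rewrite (leq_trans _ kn) // leq_addr.
  have km' : (k <= m)%N by rewrite (leq_trans kn') // ltnW.
  apply: (HN (n - k + l)%N (m - k + l)%N (h' *m invmx h)).
  - by rewrite (leq_trans _ (leq_addr _ _)) // leq_subRL.
  - by rewrite ltn_add2r ltn_sub2r // (leq_ltn_trans kn').
  - by rewrite unitmx_mul uh' unitmx_inv.
  rewrite -!vE' // cn cm -!translate_origin -translateM -map_mxM.
  by rewrite -mulmxA (mulVmx uh) mulmx1.
have Ifin s : finite_set (I s).
  have [[n [In kn]]|none] := pselect (exists n, I s n /\ (k + N <= n)%N).
    apply: (@sub_finite_set _ _ (`I_(k + N) `|` [set n])).
      move=> m Im /=; case: (ltnP m (k + N)) => [|km]; [by left | right].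
      by case: (ltngtP m n) => // mn; [case: (noI s m n) | case: (noI s n m)].
    by rewrite finite_setU; split; [exact: finite_II | exact: finite_set1].
  apply: (@sub_finite_set _ _ `I_(k + N)); last exact: finite_II.
  move=> m Im /=; rewrite ltnNge; apply/negP => km; apply: none.
  by exists m.
apply: (@sub_finite_set _ _ (\bigcup_(s in S) I s)); last exact: bigcup_finite.
move=> n /= fn; have [h [s [Gh Ss cn]]] := HS _ (cE n) fn.
by exists s => //; exists h.
Qed.

(** A geodesic between two cusps consists of a finite path and two rays. *)
Lemma geodesic_support_finite (r s : P1K) c : geodesic (P1_Kinf r) (P1_Kinf s) c ->
  finite_set [set e | range c e /\ f e != 0].
Proof.
move=> [cE _ _ cr cs].
have fr := ray_support_finite (fun n => cE (- n%:Z)) cr.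
have fs := ray_support_finite (fun n => cE n%:Z) cs.
apply: (@sub_finite_set _ _ (((fun n : nat => c (- n%:Z)) @` [set n : nat | f (c (- n%:Z)) != 0])
  `|` ((fun n : nat => c n%:Z) @` [set n : nat | f (c n%:Z) != 0]))); last first.
  by rewrite finite_setU; split; apply: finite_image.
move=> e [[i _ <-] fi]; case: i fi => n fn; first by right; exists n.
by left; exists n.+1; rewrite // -NegzE.
Qed.
End CochainSupport.

(** * Hecke operators on cochains *)

Section HeckeCochain.
Variable F : finFieldType.
Local Notation A := {poly F}.
Local Notation Kinf := {fraction (powser F)}.
Local Notation P1K := (P1 {fraction A}).
Local Notation "g ^K" := (map_mx (@poly_Kinf F) g) (at level 2).
Local Open Scope classical_set_scope.

Lemma fsum_exchange (T : choiceType) (J : finType) (Q : pred J) (D : set T)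
    (f : J -> T -> rat) : finite_set D ->
  \sum_(x \in D) \sum_(j | Q j) f j x = \sum_(j | Q j) \sum_(x \in D) f j x.
Proof.
move=> Dfin; rewrite fsbig_finite // exchange_big; apply: eq_bigr => j _.
by rewrite fsbig_finite.
Qed.

Variables (p m : A) (f : set 'M[Kinf]_2 -> rat).
Hypotheses (m0 : m != 0) (mp : coprimep m p) (f_cusp : cuspidal p f).

Definition hecke_cochain (e : set 'M[Kinf]_2) : rat :=
  \sum_(t in hecke_set p m) f (translate (hecke_mx t) ^K e).

Lemma hecke_mx_unit t : t \in hecke_set p m -> (hecke_mx t) ^K \in unitmx.
Proof. by move=> /hecke_det; apply: map_Kinf_unit. Qed.

(** The adjugate of a triangular matrix of determinant m is, up to the determinant,
    its inverse, and its determinant is m up to a constant; so the Hermite forms of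
    its right translates belong to the same finite set. *)
Lemma hecke_adj_cosets (t : hecke_index m) (g : 'M[A]_2) :
  t \in hecke_set p m -> Gamma0 p g ->
  exists (t' : hecke_index m) u,
    Gamma0 p u /\ \adj (hecke_mx t) *m g = u *m hecke_mx t'.
Proof.
move=> tm Gg; have [ug pg] := andP Gg; have [v v0 gv] := unitmx2P _ ug.
move: tm; case: t => [[a b] d]; rewrite inE /= => /and5P[ad ap _ ma md].
have a0 := monic_neq0 ma; have d0 := monic_neq0 md.
have adjE : \adj (mx2 (a : A) b 0 d) = mx2 (d : A) (- (b : A)) 0 a.
  apply: mx2_eqP; rewrite !mxE /cofactor !det_mx11 !mxE /=.
  - by rewrite expr0 mul1r.
  - by rewrite expr1 mulN1r.
  - by rewrite expr1 mulr0.
  - by rewrite expr2 mulrNN !mul1r.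
rewrite adjE; set N := _ *m g.
have dp : coprimep (d : A) p.
  by rewrite (coprimep_dvdr _ mp) // -(eqp_dvdr _ ad) dvdp_mulIr.
have N00 : N 0 0 = (d : A) * g 0 0 - (b : A) * g 1 0.
  by rewrite /N mulmx2E !mxE /= mulNr.
have N10 : N 1 0 = (a : A) * g 1 0 by rewrite /N mulmx2E !mxE /= mul0r add0r.
have detN : \det N = (d : A) * a * v%:P by rewrite det_mulmx det_tri (det_mx2 g) gv.
have Nm : \det N %= m.
  apply: eqp_trans ad; rewrite detN mulrC mul_polyC [(d : A) * _]mulrC.
  by rewrite eqp_scale.
have cop : coprimep (N 0 0) p.
  rewrite coprimep_sym N00; have [w wE] := dvdpP _ _ pg.
  have -> : (d : A) * g 0 0 - (b : A) * g 1 0 = - ((b : A) * w) * p + (d : A) * g 0 0.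
    by rewrite wE; ring.
  rewrite coprimep_addl_mul coprimepMr coprimep_sym dp /=.
  have : coprimep (g 1 0) (g 0 0) by rewrite coprimep_sym unitmx_col.
  exact: coprimep_dvdr pg.
have pN : p %| N 1 0 by rewrite N10 dvdp_mull.
have N0 : \det N != 0 by rewrite detN !mulf_neq0 // polyC_eq0.
have [u [a' [b' [d' [Gu NE [ad' _ bd' ma' md']]]]]] := hermite cop pN N0.
have adm' : a' * d' %= m := eqp_trans ad' Nm.
have sa : (size a' <= size m)%N by rewrite dvdp_leq // -(eqp_dvdr _ adm') dvdp_mulIl.
have sd : (size d' <= size m)%N by rewrite dvdp_leq // -(eqp_dvdr _ adm') dvdp_mulIr.
have sb : (size b' <= size m)%N by rewrite (leq_trans (ltnW bd')).
exists (npolyp _ a', npolyp _ b', npolyp _ d'), u; split=> //.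
by rewrite NE /= !npolypK.
Qed.

(** Translation carries the edges leaving a vertex to those leaving its image, and
    permutes the left cosets of the congruence subgroup in the Hecke set. *)
Lemma hecke_cochain_cuspidal : cuspidal p hecke_cochain.
Proof.
have [f_alt f_harm f_inv [S Sfin HS]] := f_cusp; split.
- move=> e Ee; rewrite /hecke_cochain -sumrN; apply: eq_bigr => t tm.
  by rewrite translate_opposite f_alt //; apply: edges_translate (hecke_mx_unit tm) Ee.
- move=> g ug; rewrite fsum_exchange; last exact: star_finite.
  apply: big1 => t tm; have ut := hecke_mx_unit tm.
  apply: etrans (esym (reindex_fsbig _ _ _ f (set_bij_star g ut))) _.
  by apply: f_harm; rewrite /GL2_Kinf /= unitmx_mul ut ug.
- move=> g e Gg Ee; rewrite /hecke_cochain.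
  pose Phi (N : 'M[A]_2) := f (translate N ^K e).
  rewrite -[RHS](@hecke_sum_Gamma0 _ p m _ Phi g) //; last first.
    move=> u N Gu N0; rewrite /Phi map_mxM translateM; apply: f_inv Gu _.
    exact: edges_translate (map_Kinf_unit N0) Ee.
  by apply: eq_bigr => t _; rewrite /Phi map_mxM translateM.
exists [set translate (hecke_mx t) ^K s | t in (setT : set (hecke_index m)) & s in S].
  by apply: finite_image2 => //; exact: finite_finset.
move=> e Ee fe.
have [t tm ft] : exists2 t, t \in hecke_set p m & f (translate (hecke_mx t) ^K e) != 0.
  apply: contrapT => none; case/negP: fe; apply/eqP/big1 => t tm.
  by apply/eqP/negPn/negP => ft; apply: none; exists t.
have ut := hecke_mx_unit tm.
have [h [s [Gh Ss he]]] := HS _ (edges_translate ut Ee) ft.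
have [t' [u [Gu uE]]] := hecke_adj_cosets tm Gh.
exists u, (translate (hecke_mx t') ^K s); split=> //.
  by exists t' => //; exists s.
rewrite -translateM -map_mxM -uE map_mxM translateM -he -translateM -map_mxM mul_adj_mx.
rewrite map_scalar_mx translate_scalar // poly_Kinf_eq0.
exact: hecke_det tm.
Qed.

(** Translates of geodesics are geodesics; the sums over edges and over the Hecke
    set may be exchanged because only finitely many edges contribute. *)
Lemma hecke_cochain_pairing (l : {scalar (modsym p rat)}) :
  is_pairing f l -> is_pairing hecke_cochain (l \o hecke m : {scalar (modsym p rat)}).
Proof.
move=> lf r s c geo; rewrite /= hecke_symb linear_sum.
pose D := [set e | range c e /\
  exists2 t, t \in hecke_set p m & f (translate (hecke_mx t) ^K e) != 0].
have geo_t t : t \in hecke_set p m ->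
    geodesic (P1_Kinf (actA (hecke_mx t) r)) (P1_Kinf (actA (hecke_mx t) s))
      (fun i => translate (hecke_mx t) ^K (c i)).
  move=> tm; rewrite !P1_Kinf_act ?(hecke_det tm) //.
  exact: geodesic_translate (hecke_mx_unit tm) geo.
have Dfin : finite_set D.
  apply: (@sub_finite_set _ _ (\bigcup_(t in [set t | t \in hecke_set p m])
    translate (invmx (hecke_mx t) ^K) @`
      [set e | range (fun i => translate (hecke_mx t) ^K (c i)) e /\ f e != 0])).
    move=> e [[i _ <-] [t tm ft]]; exists t => //.
    exists (translate (hecke_mx t) ^K (c i)); first by split=> //; exists i.
    by rewrite -translateM (mulVmx (hecke_mx_unit tm)) translate1.
  apply: bigcup_finite; first exact: finite_finset.
  by move=> t tm; apply: finite_image; have := geodesic_support_finite f_cusp (geo_t t tm).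
transitivity (\sum_(t in hecke_set p m) \sum_(e \in D) f (translate (hecke_mx t) ^K e)).
  apply: eq_bigr => t tm; rewrite (lf _ _ _ (geo_t t tm)).
  have -> : range (fun i => translate (hecke_mx t) ^K (c i)) =
      translate (hecke_mx t) ^K @` range c.
    apply/seteqP; split=> [_ [i _ <-]|_ [_ [i _ <-] <-]]; last by exists i.
    by apply: imageP; exists i.
  rewrite fsbig_image; last by move=> ? ? _ _; exact: (translate_inj (hecke_mx_unit tm)).
  symmetry; apply: fsbig_widen; first by move=> e [].
  move=> e [ce nD] /=; apply/eqP/negPn/negP => ft; apply: nD; split=> //.
  by exists t.
rewrite -fsum_exchange //; apply: fsbig_widen; first by move=> e [].
move=> e [ce nD] /=; apply: big1 => t tm.
by apply/eqP/negPn/negP => ft; apply: nD; split=> //; exists t.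
Qed.
End HeckeCochain.

(** * The Eisenstein ideal and the winding homomorphism *)

Section LinearPredicate.
Variables (R : nzRingType) (U V : lmodType R) (t : U -> V).
Hypothesis t_lin : linear t.

Lemma linear_scale a x : t (a *: x) = a *: t x.
Proof.
pose t' : {linear U -> V} := HB.pack t (GRing.isLinear.Build _ _ _ _ t t_lin).
by rewrite -[t]/(t' : U -> V) linearZ.
Qed.

Lemma linear_combination (I : finType) (a : I -> R) (x : I -> U) :
  t (\sum_i a i *: x i) = \sum_i a i *: t (x i).
Proof.
pose t' : {linear U -> V} := HB.pack t (GRing.isLinear.Build _ _ _ _ t t_lin).
apply: etrans (linear_sum t' _ _ _) _.
by apply: eq_bigr => i _; exact: linear_scale.
Qed.

Lemma linear_eta x y N : t (x - y *+ N) = t x - t y *+ N.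
Proof.
pose t' : {linear U -> V} := HB.pack t (GRing.isLinear.Build _ _ _ _ t t_lin).
by apply: etrans (raddfB t' _ _) _; congr (_ - _); exact: (raddfMn t').
Qed.
End LinearPredicate.

Section HeckeCuspidal.
Variables (F : finFieldType) (p m : {poly F}) (R : comNzRingType).

Fact hecke0_is_linear : linear (@hecke0 F p R m).
Proof. by move=> a x y; apply: val_inj; rewrite /= linearP. Qed.
HB.instance Definition _ := GRing.isLinear.Build R (modsym0 p R) (modsym0 p R)
  *:%R (@hecke0 F p R m) hecke0_is_linear.

Lemma hecke0B (x y : modsym0 p R) : hecke0 m (x - y) = hecke0 m x - hecke0 m y.
Proof. exact: raddfB. Qed.

Lemma hecke0D (x y : modsym0 p R) : hecke0 m (x + y) = hecke0 m x + hecke0 m y.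
Proof. exact: raddfD. Qed.

Lemma hecke0Mn (x : modsym0 p R) N : hecke0 m (x *+ N) = hecke0 m x *+ N.
Proof. exact: raddfMn. Qed.

Lemma val_eta (x : modsym0 p R) N :
  val (hecke0 m x - x *+ N) = hecke m (val x) - val x *+ N.
Proof. by rewrite raddfB raddfMn. Qed.
End HeckeCuspidal.

Section WindingElement.
Variables (F : finFieldType) (p : {poly F}) (e : modsym0 p rat).
Hypothesis e_wind : unique (@is_winding F p) e.

(** Adding x to the winding element would give another winding element. *)
Lemma winding_nondegenerate (x : modsym0 p rat) :
  (forall f l, cuspidal p f -> is_pairing f l -> l (val x) = 0) -> x = 0.
Proof.
move=> x0; have [we ue] := e_wind.
have : e = e + x.
  apply: ue => f l fc fl; have -> : val (e + x) = val e + val x by [].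
  by rewrite linearD (we _ _ fc fl) (x0 _ _ fc fl) addr0.
by rewrite -{1}[e]addr0 => /addrI.
Qed.

(** Composing a pairing with a Hecke operator gives the pairing with another cuspidal
    cochain, so the winding element and [0, oo] have the same pairings after
    applying the operator. *)
Lemma winding_eta (m : {poly F}) (N : nat) (z : modsym0 p rat) :
  m != 0 -> coprimep m p ->
  hecke m (symb p rat (Some 0) None) - symb p rat (Some 0) None *+ N = val z ->
  hecke0 m e - e *+ N = z.
Proof.
move=> m0 mp zE; have [we _] := e_wind.
apply/eqP; rewrite -subr_eq0; apply/eqP/winding_nondegenerate => f l fc fl.
have wT := we _ _ (hecke_cochain_cuspidal m0 mp fc) (hecke_cochain_pairing m fc fl).
have -> : val (hecke0 m e - e *+ N - z) = hecke m (val e) - val e *+ N -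
    (hecke m (symb p rat (Some 0) None) - symb p rat (Some 0) None *+ N).
  by rewrite zE -val_eta.
have le : l (val e) = l (symb p rat (Some 0) None) := we _ _ fc fl.
have lTe : l (hecke m (val e)) = l (hecke m (symb p rat (Some 0) None)) := wT.
rewrite !(raddfB l) !(raddfMn l); apply/eqP; rewrite subr_eq0; apply/eqP.
by congr (_ - _ *+ _).
Qed.
End WindingElement.

Section HeckeAlgebra.
Variables (R : realType) (F : finFieldType) (p : {poly F}).
Local Notation V := (modsym0 p R[i]).

Lemma hecke0_commute (l m : {poly F}) (x : V) :
  irreducible_poly l -> l \is monic -> coprimep l p -> m != 0 -> coprimep m p ->
  hecke0 l (hecke0 m x) = hecke0 m (hecke0 l x).
Proof. by move=> *; apply: val_inj; apply: hecke_commute. Qed.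

Lemma hecke_alg_linear (t : V -> V) : hecke_alg t -> linear t.
Proof.
elim=> [|m _ _|s u _ IHs _ IHu|s u _ IHs _ IHu] a x y //=.
- exact: linearP.
- by rewrite IHs IHu scalerBr opprD addrACA.
by rewrite IHu IHs.
Qed.

Lemma eisenstein_op_linear (m : {poly F}) : linear (@eisenstein_op R F p m).
Proof.
move=> a x y; rewrite /eisenstein_op linearP mulrnDl opprD addrACA scalerBr.
by rewrite scalerMnr.
Qed.

Lemma eis_ideal_linear (t : V -> V) : eis_ideal t -> linear t.
Proof.
elim=> [m _ _|s u _ IHs _ IHu|s u /hecke_alg_linear IHs _ IHu] a x y /=.
- exact: eisenstein_op_linear.
- by rewrite IHs IHu scalerDr addrACA.
by rewrite IHu IHs.
Qed.

Lemma irreducible_coprime (m : {poly F}) : irreducible_poly p ->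
  irreducible_poly m -> ~~ (m %= p) -> coprimep m p.
Proof.
move=> irp irm mp; rewrite coprimep_sym irreducible_poly_coprime //.
apply: contra mp => pm; have [p1|] := irredp_XsubCP irm pm; last by rewrite eqp_sym.
by have := eqp_size p1; rewrite size_poly1 => sp; case: irp; rewrite sp.
Qed.

Section Commutant.
Hypothesis p_irr : irreducible_poly p.
Variable l : {poly F}.
Hypotheses (l_irr : irreducible_poly l) (l_monic : l \is monic) (lp : coprimep l p).

Lemma hecke_alg_commute (t : V -> V) : hecke_alg t ->
  forall x, t (hecke0 l x) = hecke0 l (t x).
Proof.
elim=> [|m m0 mp|s u _ IHs _ IHu|s u _ IHs _ IHu] x //=.
- exact/esym/hecke0_commute.
- by rewrite IHs IHu hecke0B.
by rewrite IHu IHs.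
Qed.

Lemma eis_ideal_commute (t : V -> V) : eis_ideal t ->
  forall x, t (hecke0 l x) = hecke0 l (t x).
Proof.
elim=> [m irm mp|s u _ IHs _ IHu|s u /hecke_alg_commute IHs _ IHu] x /=.
- rewrite /eisenstein_op hecke0B hecke0Mn; congr (_ - _).
  have mcop := irreducible_coprime p_irr irm mp.
  exact/esym/hecke0_commute/mcop/irredp_neq0/irm.
- by rewrite IHs IHu hecke0D.
by rewrite IHu IHs.
Qed.
End Commutant.

Fact int_base_is_additive : zmod_morphism (@int_base R F p).
Proof. exact: modsym0_base_is_additive. Qed.
HB.instance Definition _ := GRing.isZmodMorphism.Build (modsym0 p int) V
  (@int_base R F p) int_base_is_additive.

Lemma int_baseZ (c : int) (x : modsym0 p int) : int_base R (c *: x) = c%:~R *: int_base R x.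
Proof. by rewrite -[c in LHS]intz !scaler_int raddfMz. Qed.

(** Hecke operators are defined over the integers. *)
Lemma hecke_alg_int (t : V -> V) : hecke_alg t ->
  forall y, exists z, t (int_base R y) = int_base R z.
Proof.
elim=> [|m _ _|s u _ IHs _ IHu|s u _ IHs _ IHu] y /=.
- by exists y.
- by exists (hecke0 m y); rewrite /int_base modsym0_base_hecke.
- by have [[z ->] [z' ->]] := (IHs y, IHu y); exists (z - z'); rewrite raddfB.
by have [z ->] := IHu y.
Qed.

Section DegreeThree.
Hypotheses (p_irr : irreducible_poly p) (p_size : size p = 4).
Local Notation b := (inv_symb0 int p_irr p_size).

Lemma int_base_inv_symb0 n : int_base R (b n) = inv_symb0 R[i] p_irr p_size n.
Proof. by apply: val_inj; rewrite /= /inv_symb modsym_base_symb. Qed.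

Lemma int_base_inj : injective (@int_base R F p).
Proof.
move=> x y; have [c ->] := inv_symb0_span p_irr p_size x.
have [d ->] := inv_symb0_span p_irr p_size y.
rewrite !raddf_sum => e; suff cd : c =1 d by apply: eq_bigr => n _; rewrite cd.
have E k : \sum_n int_base R (k n *: b n) =
    \sum_n (k n)%:~R *: inv_symb0 R[i] p_irr p_size n.
  by apply: eq_bigr => n _; rewrite int_baseZ int_base_inv_symb0.
move: e; rewrite !E => /(inv_symb0_free (c := fun n => (c n)%:~R)) cd n.
by apply: (@intr_inj R[i]); exact: cd.
Qed.

Variable e : modsym0 p rat.
Hypothesis e_wind : unique (@is_winding F p) e.
Local Notation E := (rat_base R e).
Local Notation kappa := (#|F|%:R - 1 : R[i]).

Lemma kappaE : kappa = (#|F| - 1)%:R.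
Proof. by rewrite natrB // ltnW // card_finNzRing_gt1. Qed.

Lemma kappa_neq0 : kappa != 0.
Proof. by rewrite kappaE pnatr_eq0 subn_eq0 -ltnNge card_finNzRing_gt1. Qed.

Lemma eisenstein_winding (m : {poly F}) (z : modsym0 p int) :
  m != 0 -> coprimep m p ->
  hecke m (symb p int (Some 0) None) -
    symb p int (Some 0) None *+ (#|F| ^ (size m).-1 + 1) = val z *+ (#|F| - 1) ->
  eisenstein_op m E = kappa *: int_base R z.
Proof.
move=> m0 mp zE.
pose z' : modsym0 p rat := modsym0_base (intr : {rmorphism int -> rat}) z.
have zQ : hecke m (symb p rat (Some 0) None) -
    symb p rat (Some 0) None *+ (#|F| ^ (size m).-1 + 1) = val (z' *+ (#|F| - 1)).
  transitivity (val z' *+ (#|F| - 1)); last by rewrite raddfMn.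
  have := congr1 (modsym_base (intr : {rmorphism int -> rat})) zE.
  by rewrite raddfB !raddfMn /= modsym_base_hecke modsym_base_symb.
transitivity (rat_base R (hecke0 m e - e *+ (#|F| ^ (size m).-1 + 1))).
  rewrite /eisenstein_op /rat_base [RHS]raddfB /= modsym0_base_hecke; congr (_ - _).
  by rewrite [RHS]raddfMn.
rewrite (winding_eta e_wind m0 mp zQ) /rat_base raddfMn kappaE scaler_nat.
congr (_ *+ _); apply: val_inj => /=; apply: modsym_base_comp => a /=.
by rewrite ratr_int.
Qed.

(** The generators send the winding element to integral symbols divisible by q - 1,
    and Hecke operators preserve integrality. *)
Lemma eis_ideal_int (t : V -> V) : eis_ideal t ->
  exists z, t E = kappa *: int_base R z.
Proof.
elim=> [m irm mp|s u _ [z sz] _ [z' uz]|s u Hs _ [z uz]].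
- have cmp := irreducible_coprime p_irr irm mp.
  have [z zE] := eta_integral int irm cmp.
  by exists z; apply: eisenstein_winding => //; exact: irredp_neq0.
- by exists (z + z'); rewrite sz uz raddfD scalerDr.
have [z' sz'] := hecke_alg_int Hs z; exists z' => /=.
by rewrite uz (linear_scale (hecke_alg_linear Hs)) sz'.
Qed.

Lemma winding_homE (t : V -> V) : eis_ideal t ->
  int_base R (winding_hom e t) = kappa^-1 *: t E.
Proof.
move=> /eis_ideal_int[z tz].
apply: (@xgetPex _ 0 [set y | int_base R y = kappa^-1 *: t E]%classic).
by exists z; rewrite /= tz scalerA mulVf ?kappa_neq0 // scale1r.
Qed.

Lemma eis_eta_deg1 n : @eis_ideal R F p (eisenstein_op (deg1_gen n)).
Proof.
apply: eis_eta; first exact: deg1_irreducible (deg1_gen_size n).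
by apply/negP => /eqp_size; rewrite deg1_gen_size p_size.
Qed.

Lemma winding_hom_deg1 n : winding_hom e (@eisenstein_op R F p (deg1_gen n)) = b n.
Proof.
apply: int_base_inj; rewrite winding_homE; last exact: eis_eta_deg1.
rewrite (eisenstein_winding _ _ (eta_deg1 int p_irr p_size n)).
- by rewrite scalerA mulVf ?kappa_neq0 // scale1r.
- by rewrite monic_neq0 // deg1_gen_monic.
exact: deg1_gen_coprime.
Qed.

(** The values at the basis are Eisenstein operators of degree one applied to the
    winding element, up to a factor, and these commute with t and u. *)
Lemma eis_ideal_determined (t u : V -> V) : eis_ideal t -> eis_ideal u ->
  t E = u E -> t = u.
Proof.
move=> It Iu tu; apply/funext => x.
have [c ->] := inv_symb0_span p_irr p_size x.
have bE n : inv_symb0 R[i] p_irr p_size n = kappa^-1 *: eisenstein_op (deg1_gen n) E.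
  rewrite -int_base_inv_symb0 -winding_hom_deg1 winding_homE //.
  exact: eis_eta_deg1.
have onE v n : eis_ideal v ->
    v (eisenstein_op (deg1_gen n) E) = eisenstein_op (deg1_gen n) (v E).
  move=> Iv; have lin := eis_ideal_linear Iv; set l := deg1_gen n.
  rewrite /eisenstein_op (linear_eta lin); congr (_ - _).
  apply: (eis_ideal_commute p_irr _ _ _ Iv); last exact: deg1_gen_coprime.
    exact: deg1_irreducible (deg1_gen_size n).
  exact: deg1_gen_monic.
have sumE v : eis_ideal v -> v (\sum_n c n *: inv_symb0 R[i] p_irr p_size n) =
    \sum_n c n *: (kappa^-1 *: eisenstein_op (deg1_gen n) (v E)).
  move=> Iv; have lin := eis_ideal_linear Iv.
  rewrite (linear_combination lin); apply: eq_bigr => n _.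
  by rewrite bE (linear_scale lin) (onE _ _ Iv).
by rewrite !sumE // tu.
Qed.

(** The image is a subgroup containing the basis. *)
Lemma winding_hom_surj (y : modsym0 p int) :
  exists2 t, @eis_ideal R F p t & winding_hom e t = y.
Proof.
suff [t It tE] : exists2 t, @eis_ideal R F p t & int_base R y = kappa^-1 *: t E.
  by exists t => //; apply: int_base_inj; rewrite winding_homE.
have [c ->] := inv_symb0_span p_irr p_size y.
pose P (x : modsym0 p int) :=
  exists2 t, @eis_ideal R F p t & int_base R x = kappa^-1 *: t E.
have PD x x' : P x -> P x' -> P (x + x').
  move=> [t It xE] [t' It' xE']; exists (fun z => t z + t' z); first exact: eisD.
  by rewrite raddfD /= xE xE' scalerDr.
have Pb n : P (b n).
  exists (eisenstein_op (deg1_gen n)); first exact: eis_eta_deg1.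
  by rewrite -winding_homE ?winding_hom_deg1 //; exact: eis_eta_deg1.
have PZ0 x : P x -> P 0 /\ P (- x).
  move=> [t It xE].
  have alg0 : @hecke_alg R F p (fun z => id z - id z) by apply: hecke_algB; exact: hecke_alg1.
  have algN : @hecke_alg R F p (fun z => (id z - id z) - id z).
    by apply: hecke_algB alg0 _; exact: hecke_alg1.
  split; [exists ((fun z => id z - id z) \o t); first exact: eisM | ].
    by rewrite raddf0 /= subrr scaler0.
  exists ((fun z => (id z - id z) - id z) \o t); first exact: eisM.
  by rewrite raddfN /= subrr sub0r scalerN xE.
have [n0 _] : exists n : deg1 F, deg1_gen n = 'X.
  by apply: deg1_gen_ex; rewrite ?monicX ?size_polyX.
have [P0 _] := PZ0 _ (Pb n0).
have PN x : P x -> P (- x) by move=> Px; case: (PZ0 _ Px).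
have PMn x k : P x -> P (x *+ k).
  by move=> Px; elim: k => [|k IH]; rewrite ?mulr0n // mulrS; exact: PD.
apply: (big_ind P) => // n _; rewrite -[c n]intz scaler_int.
by case: (c n) => k; [exact: PMn | rewrite NegzE mulrNz; exact/PN/PMn].
Qed.

Lemma winding_hom_basis : is_Zbasis
  (fun n : deg1 F => winding_hom e (@eisenstein_op R F p (deg1_gen n))).
Proof.
move=> x; have [c xE] := inv_symb0_span p_irr p_size x.
have sumE (d : {ffun deg1 F -> int}) :
    \sum_n winding_hom e (@eisenstein_op R F p (deg1_gen n)) *~ d n =
    \sum_n d n *: b n.
  by apply: eq_bigr => n _; rewrite winding_hom_deg1 -[d n in RHS]intz scaler_int.
exists [ffun n => c n]; split.
  by rewrite sumE xE; apply: eq_bigr => n _; rewrite ffunE.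
move=> d; rewrite sumE xE => /inv_symb0_free cd.
by apply/ffunP => n; rewrite ffunE cd.
Qed.

Lemma winding_hom_inj (t u : V -> V) : eis_ideal t -> eis_ideal u ->
  winding_hom e t = winding_hom e u -> t = u.
Proof.
move=> It Iu /(congr1 (@int_base R F p)); rewrite !winding_homE //.
move=> /(congr1 (fun x => kappa *: x)); rewrite !scalerA mulfV ?kappa_neq0 // !scale1r.
exact: eis_ideal_determined.
Qed.

Lemma winding_homD (t u : V -> V) : eis_ideal t -> eis_ideal u ->
  winding_hom e (fun x => t x + u x) = winding_hom e t + winding_hom e u.
Proof.
move=> It Iu; apply: int_base_inj; rewrite raddfD /= !winding_homE //.
  by rewrite scalerDr.
exact: eisD.
Qed.

Lemma winding_homM (s t : V -> V) : hecke_alg s -> eis_ideal t ->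
  winding_hom e (s \o t) = hecke_act s (winding_hom e t).
Proof.
move=> Hs It; apply: int_base_inj; have lin := hecke_alg_linear Hs.
have [z sz] := hecke_alg_int Hs (winding_hom e t).
have -> : int_base R (hecke_act s (winding_hom e t)) = s (int_base R (winding_hom e t)).
  apply: (@xgetPex _ 0
    [set y | int_base R y = s (int_base R (winding_hom e t))]%classic).
  by exists z.
rewrite winding_homE; last exact: eisM.
by rewrite winding_homE //= (linear_scale lin).
Qed.
End DegreeThree.
End HeckeAlgebra.

Theorem proposition8p2 (R : realType) (F : finFieldType) (p : {poly F})
    (e : modsym0 p rat) :
  irreducible_poly p -> size p = 4%N ->
  unique (@is_winding F p) e ->
  let IE := @eis_ideal R F p in
  let w := @winding_hom R F p e in
  [/\ is_Zbasis (fun n : deg1 F => w (eisenstein_op (deg1_gen n))),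
      forall t, IE t -> int_base R (w t) = (#|F|%:R - 1)^-1 *: t (rat_base R e),
      forall t u, IE t -> IE u -> w (fun x => t x + u x) = w t + w u,
      forall s t, hecke_alg s -> IE t -> w (s \o t) = hecke_act s (w t) &
      set_bij IE setT w].
Proof.
move=> p_irr p_size e_wind IE w; split.
- exact: winding_hom_basis.
- exact: winding_homE.
- exact: winding_homD.
- exact: winding_homM.
split.
- by [].
- by move=> t u /set_mem It /set_mem Iu; exact: winding_hom_inj.
by move=> y _; have [t It tE] := winding_hom_surj R p_irr p_size e_wind y; exists t.
Qed.
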